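(* Assume $T$ is countable and that for every $k<\omega$, $T$ is $k$-stable over $P$. Let $n<\omega$, $I=\mathcal{P}^-(n)$, and let $\langle A_s:s\in I\rangle$ be a good system, with $B=\bigcup_{s\in I}A_s$. Then there is a model $M\prec\mathcal{C}$ which is locally constructible over $B$. Moreover, if $\bar c$ is a tuple with $\mathrm{tp}(\bar c/B)\in S_*(B)$, then there is a model which is locally constructible over $B\cup\bar c$.
   Context: Setting: $T$ is a complete first-order theory in a vocabulary with no function symbols, with a unary predicate $P$, $T$ implies $P$ is infinite; $\mathcal{C}$ is its monster model, all sets are subsets of $\mathcal{C}$, models are elementary submodels of $\mathcal{C}$; $T$ is Morleyized and sets are identified with induced substructures ($A\equiv A'$ means elementary equivalence of these). $P$ is stably embedded, every subset of $P^{\mathcal{C}}$ definable in $\mathcal{C}$ is definable in the theory $T^P$ of the induced structure $\mathcal{C}^P$ on $P^{\mathcal{C}}$, and every model $M\prec\mathcal{C}$ is stable over $P$. $P^A=A\cap P^{\mathcal{C}}$. Complete set: $A$ such that for all $\psi(\bar x,\bar y)$, $\bar b\subseteq A$, if $\models(\exists\bar x\in P)\psi(\bar x,\bar b)$ then $\models\psi(\bar a,\bar b)$ for some $\bar a\subseteq P\cap A$. For complete $A$, $S_*(A)=\{\mathrm{tp}(\bar c/A): P\cap(A\cup\bar c)=P\cap A,\ A\cup\bar c\text{ complete}\}$; $A$ is stable (over $P$) if $|S_*(A')|\le|A'|^{|T|}$ for all $A'\equiv A$. A type $p$ over a set $D$ is locally isolated if for every formula $\varphi(\bar x,\bar y)$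 some formula $\theta_\varphi(\bar x,\bar a_\varphi)\in p$ implies $p\restriction\varphi$ (the $\varphi$-instances and their negations in $p$). A model $M$ is locally constructible over a set $D$ if $P^M\subseteq D\subseteq M$ and $M=D\cup\{d_i:i<\alpha\}$ for a sequence with $\mathrm{tp}(d_i/D\cup\{d_j:j<i\})$ locally isolated for all $i<\alpha$. Notation: $n=\{0,\dots,n-1\}$, $\mathcal{P}(Y)$ power set, $\mathcal{P}^-(Y)=\mathcal{P}(Y)\setminus\{Y\}$. Order $\mathcal{P}(n)$ lexicographically: $s<t$ iff at the least $k\in s\triangle t$ we have $k\in t$. $I$ is weakly nice if for some $n=n_I$, $I\subseteq\mathcal{P}(n)$, $\mathcal{P}(\{1,\dots,n-1\})\subseteq I$, and $I$ is closed under subsets; nice if also an initial segment of $\mathcal{P}(n)$. A presystem $\langle A_s:s\in I\rangle$ ($I$ weakly nice) is viewed as a structure with universe $\bigcup_sA_s$, the induced structure, and a unary predicate for each $A_s$. By induction on $n=n_I$ it is a good system if: (i) $I$ is nice; (ii) $A_s\cap A_t=A_{s\cap t}$; (iii) $0\notin s\Rightarrow A_s\prec\mathcal{C}^P$, $0\in s\Rightarrow A_s\prec\mathcal{C}$; (iv) $A_s\cap P^{\mathcal{C}}=A_{s\setminus\{0\}}$; (v) if $n\ge2$, $\langle A_s:s\in\mathcal{P}(\{1,\dots,n-2\})\rangle\prec\langle A_{s\cup\{n-1\}}:s\in\mathcal{P}(\{1,\dots,n-2\})\rangle$ and these are good systems; (vi) $\bigcup_{t\in\mathcal{P}^-(s)}A_t$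 is stable whenever $0\in s\in I$; (vii) for every $\phi$ and $\bar b_s\in A_s$ ($s\in I$) with $\models\phi(\dots,\bar b_s,\dots)$ there are $\bar b'_s\in A_{s\setminus\{n-1\}}$ with $\models\phi(\dots,\bar b'_s,\dots)$, and $\bar b'_s=\bar b_s$ can be chosen when $n-1\notin s$; (viii) $\langle A_{s\cup\{n-1\}}:s\in I_{[n-1]}\rangle$ and $\langle A_s:s\in I^{[n-1]}\rangle$ are good systems, where $I^{[n-1]}=\{s\in I:n-1\notin s\}$, $I_{[n-1]}=\{s:n-1\notin s,\ s\cup\{n-1\}\in I\}$. $T$ is $k$-stable over $P$ if for every good system $\langle A_s:s\in\mathcal{P}^-(k)\rangle$ the union $\bigcup_{s\in\mathcal{P}^-(k)}A_s$ is stable over $P$.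
   Formalization: Clauses (vii) and (viii) of ''good system'' are imposed only for n ≥ 2: at n = 0 the index n−1 does not exist, and at n = 1 they would require a good system on the empty index set or force the model A_{0} inside P, so no good systems of higher dimension would exist. *)

(* Defs.v *)
From mathcomp Require Import all_boot.
From mathcomp Require Import boolp wochoice classical_sets functions cardinality.

Set Implicit Arguments.
Unset Strict Implicit.
Unset Printing Implicit Defensive.

Local Open Scope classical_set_scope.
Local Open Scope card_scope.

(* Purely relational vocabularies, so that every subset of a structure is the
   universe of an induced substructure. *)
Record vocabulary := Vocabulary { symb : Type; arity : symb -> nat }.

(* formula L n: first-order L-formulas with equality whose free variables are
   among x_0, ..., x_{n-1}.  In fAll f the bound variable is x_0 of f and x_i of
   fAll f is x_{i+1} of f. *)
Inductive formula (L : vocabulary) : nat -> Type :=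
| fEq n (i j : 'I_n) : formula L n
| fRel n (R : symb L) (v : 'I_(arity R) -> 'I_n) : formula L n
| fBot n : formula L n
| fImp n (f g : formula L n) : formula L n
| fAll n (f : formula L n.+1) : formula L n.

Definition sentence (L : vocabulary) := formula L 0.
Definition fNot L n (f : formula L n) : formula L n := fImp f (fBot L n).

Record structure (L : vocabulary) := Structure {
  carrier :> Type;
  interp : forall R : symb L, ('I_(arity R) -> carrier) -> Prop }.

Definition vcons (X : Type) n (x : X) (v : 'I_n -> X) : 'I_n.+1 -> X :=
  fun i => if unlift ord0 i is Some j then v j else x.

Definition vcat (X : Type) m k (x : 'I_m -> X) (y : 'I_k -> X) : 'I_(m + k) -> X :=
  fun i => match fintype.split i with inl j => x j | inr j => y j end.

Fixpoint sat L (M : structure L) n (f : formula L n) : ('I_n -> M) -> Prop :=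
  match f in formula _ n return ('I_n -> M) -> Prop with
  | fEq _ i j => fun v => v i = v j
  | fRel _ R w => fun v => interp (fun i => v (w i))
  | fBot _ => fun=> False
  | fImp _ g h => fun v => sat g v -> sat h v
  | fAll _ g => fun v => forall x, sat g (vcons x v)
  end.

Definition holds L (M : structure L) (s : sentence L) :=
  forall v : 'I_0 -> M, sat s v.

Definition is_model L (M : structure L) (T : set (sentence L)) :=
  forall s, T s -> holds M s.

(* Complete theories are taken deductively closed. *)
Definition complete_theory L (T : set (sentence L)) :=
  (exists M : structure L, is_model M T) /\ forall s, T s \/ T (fNot s).

Definition predicate L (P : symb L) (M : structure L) : set M :=
  [set x | interp (fun _ : 'I_(arity P) => x)].
Arguments predicate {L} P M.

Definition morleyized L (T : set (sentence L)) :=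
  forall n (f : formula L n.+1),
  exists (R : symb L) (v : 'I_(arity R) -> 'I_n.+1),
  forall M : structure L, is_model M T ->
  forall x : 'I_n.+1 -> M, sat f x <-> sat (fRel v) x.

Definition induced L (M : structure L) (A : set M) : structure L :=
  @Structure L A (fun R v => interp (fun i => val (v i))).

Definition elem_equiv L (M N : structure L) :=
  forall s : sentence L, holds M s <-> holds N s.

Definition elementary L (M N : structure L) (h : M -> N) :=
  forall n (f : formula L n) (v : 'I_n -> M), sat f v <-> sat f (h \o v).

Definition elem_sub L (M : structure L) (A : set M) :=
  @elementary L (induced A) M val.

(* Elementary substructure, for structures whose elements are taken from a
   common set X along i and j. *)
Definition elem_incl L (X : Type) (M N : structure L) (i : M -> X) (j : N -> X) :=
  exists h : M -> N, (forall x, j (h x) = i x) /\ elementary h.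

(* D is a subset of M^m defined in M by a formula with parameters from A. *)
Definition definable_over L (M : structure L) (A : set M) m
    (D : set ('I_m -> M)) :=
  exists k (f : formula L (m + k)) (a : 'I_k -> M),
    (forall i, A (a i)) /\ forall x, D x <-> sat f (vcat x a).

Definition subset_lt (s t : set nat) :=
  exists k, [/\ t k, ~ s k & forall j, j < k -> (s j <-> t j)].

Definition powset (Y : set nat) : set (set nat) := [set s | s `<=` Y].
Definition proper_powset (Y : set nat) : set (set nat) := [set s | s `<` Y].

Definition weakly_nice n (I : set (set nat)) :=
  [/\ I `<=` powset `I_n,
      powset [set j | 0 < j < n] `<=` I
    & forall s t, I t -> s `<=` t -> I s].

Definition nice n (I : set (set nat)) :=
  weakly_nice n I /\
  forall s t, I t -> s `<=` `I_n -> subset_lt s t -> I s.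

Definition system_voc (L : vocabulary) (I : set (set nat)) : vocabulary :=
  @Vocabulary (symb L + I)%type
    (fun R => match R with inl R0 => arity R0 | inr _ => 1 end).

Definition system_struct L (C : structure L) (I : set (set nat))
    (A : set nat -> set C) : structure (system_voc L I) :=
  @Structure (system_voc L I) (\bigcup_(s in I) A s)
    (fun R => match R return ('I_(@arity (system_voc L I) R) ->
                              (\bigcup_(s in I) A s)) -> Prop with
     | inl R0 => fun v => @interp L C R0 (fun i => val (v i))
     | inr s => fun v => A (val s) (val (v ord0))
     end).

Section OverPredicate.
Variables (L : vocabulary) (P : symb L) (T : set (sentence L)).
(* K stands for the cardinal of saturation of the monster model C. *)
Variables (K : Type) (C : structure L).

Local Notation PC := (predicate P C).

Definition small (X : Type) (A : set X) :=
  (A #<= [set: K]) && ~~ ([set: K] #<= A).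

Definition strong_limit := forall X : set K, small X -> small [set: set X].

(* Formulas f(x, a) in the variables x = (x_0, ..., x_{m-1}) with a tuple a of
   parameters from C. *)
Definition pformula m := {k : nat & (formula L (m + k) * ('I_k -> C))%type}.
Definition PFormula m k (f : formula L (m + k)) (a : 'I_k -> C) : pformula m :=
  existT _ k (f, a).
Definition params m (f : pformula m) : set C := range (projT2 f).2.
Definition psat m (f : pformula m) (x : 'I_m -> C) :=
  sat (projT2 f).1 (vcat x (projT2 f).2).

Definition saturated :=
  forall (A : set C) m (p : set (pformula m)), small A ->
    (forall f, p f -> params f `<=` A) ->
    (forall q, finite_set q -> q `<=` p ->
       exists x, forall f, q f -> psat f x) ->
    exists x, forall f, p f -> psat f x.

Definition automorphism (g : C -> C) :=
  bijective g /\ forall R (v : 'I_(arity R) -> C), interp v <-> interp (g \o v).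

Definition strongly_homogeneous :=
  forall (A : set C) (h : C -> C), small A ->
    (forall n (f : formula L n) (v : 'I_n -> C), (forall i, A (v i)) ->
       (sat f v <-> sat f (h \o v))) ->
    exists g, automorphism g /\ forall x, A x -> g x = h x.

Definition monster :=
  [/\ is_model C T, small T, strong_limit, saturated & strongly_homogeneous].

Definition model (M : set C) := small M /\ elem_sub M.

Definition stably_embedded :=
  forall m (D : set ('I_m -> C)), (forall x, D x -> forall i, PC (x i)) ->
    definable_over setT D -> definable_over PC D.

Definition no_new_structure :=
  forall m (D : set ('I_m -> C)), (forall x, D x -> forall i, PC (x i)) ->
    definable_over setT D ->
    @definable_over L (induced PC) setT m [set x | D (fun i => val (x i))].

Definition complete_set (A : set C) :=
  forall m k (f : formula L (m + k)) (b : 'I_k -> C), (forall i, A (b i)) ->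
    (exists x : 'I_m -> C, (forall i, PC (x i)) /\ sat f (vcat x b)) ->
    exists a : 'I_m -> C, (forall i, (PC `&` A) (a i)) /\ sat f (vcat a b).

Definition tp m (c : 'I_m -> C) (A : set C) : set (pformula m) :=
  [set f | params f `<=` A /\ psat f c].

Definition S_star (A : set C) : set {m : nat & set (pformula m)} :=
  [set p | exists m (c : 'I_m -> C),
     [/\ PC `&` (A `|` range c) = PC `&` A, complete_set (A `|` range c)
       & p = existT _ m (tp c A)]].

(* [set: T -> A'] has cardinality |A'|^|T|. *)
Definition stable (A : set C) :=
  complete_set A /\
  forall A' : set C, small A' -> elem_equiv (induced A') (induced A) ->
    S_star A' #<= [set: T -> A'].

Definition pimplies m (f g : pformula m) := forall x, psat f x -> psat g x.

Definition locally_isolated m (p : set (pformula m)) :=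
  forall k (f : formula L (m + k)),
  exists2 th : pformula m, p th &
    forall b : 'I_k -> C,
      (p (PFormula f b) -> pimplies th (PFormula f b)) /\
      (p (PFormula (fNot f) b) -> pimplies th (PFormula (fNot f) b)).

(* The sequence d is indexed by an arbitrary well-ordered type W in place of an
   ordinal; le is the non-strict order. *)
Definition locally_constructible (M D : set C) :=
  [/\ model M, PC `&` M `<=` D, D `<=` M &
    exists (W : Type) (le : W -> W -> bool) (d : W -> C),
    [/\ well_order le, M = D `|` range d &
      forall i, locally_isolated
        (tp (fun _ : 'I_1 => d i) (D `|` d @` [set j | le j i /\ j <> i]))]].

(* The tuples b_s, s in I, are concatenated into a single tuple b; t i is the
   index s of the tuple b_s that the i-th coordinate comes from. *)
Definition pulls_back l (I : set (set nat)) (A : set nat -> set C) :=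
  forall m (f : formula L m) (t : 'I_m -> set nat) (b : 'I_m -> C),
    (forall i, I (t i) /\ A (t i) (b i)) -> sat f b ->
    exists b' : 'I_m -> C,
      [/\ forall i, A (t i `\ l) (b' i),
          forall i, ~ t i l -> b' i = b i & sat f b'].

Definition shift l (A : set nat -> set C) (s : set nat) : set C :=
  A (s `|` [set l]).

(* The values of A outside I are irrelevant.  The clauses involving the last
   index l = n - 1 apply for n >= 2 only: for n = 1 they would exclude the
   systems (P^M, M) indexed by the subsets of {0}. *)
Fixpoint good_system (n : nat) (I : set (set nat)) (A : set nat -> set C)
    {struct n} : Prop :=
  [/\ nice n I,
      forall s, I s -> small (A s),
      forall s t, I s -> I t -> A s `&` A t = A (s `&` t),
      forall s, I s ->
        (~ s 0 -> @elem_incl L C (induced (A s)) (induced PC) val val) /\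
        (s 0 -> elem_sub (A s))
    & forall s, I s -> A s `&` PC = A (s `\ 0)] /\
  (forall s, I s -> s 0 -> stable (\bigcup_(t in proper_powset s) A t)) /\
  match n with
  | 0 => True
  | l.+1 => 0 < l ->
    let J := powset [set j | 0 < j < l] in
    [/\ @elem_incl _ C (system_struct J A) (system_struct J (shift l A)) val val,
        good_system l J A /\ good_system l J (shift l A),
        pulls_back l I A,
        good_system l [set s | ~ s l /\ I (s `|` [set l])] (shift l A)
      & good_system l [set s | I s /\ ~ s l] A]
  end.

Definition k_stable k :=
  forall A, good_system k (proper_powset `I_k) A ->
    stable (\bigcup_(s in proper_powset `I_k) A s).

End OverPredicate.

(* Main.v *)
(* Induction on the cardinality of E = B u c, for all dimensions n at once.

   Countable E: over a stable complete set the locally isolated types are dense,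
   so a Henkin construction of length omega that realizes only locally isolated
   types in S_star yields the model.

   Uncountable E: write E as the union of a chain of hulls H_w of smaller
   cardinality, each closed under countably many Skolem functions of the system,
   so that the traces A_s n H_w form good systems elementary in A.  Let M_w be
   locally constructible over H_w together with the union M_{<w} of the earlier
   models.  It exists because A_s n H_{<w}, A_s n H_w and M_{<w} are the faces of
   an (n+1)-dimensional good system.  Elementarity makes the isolating formulas
   over H_w isolate over all of E, so the sequences for the M_w concatenate. *)
Require Import Defs.
From mathcomp Require Import all_boot.
From mathcomp Require Import boolp wochoice classical_sets functions cardinality.
From mathcomp Require filter.
From Stdlib Require List Eqdep_dec.

Set Implicit Arguments.
Unset Strict Implicit.
Unset Printing Implicit Defensive.

Local Open Scope classical_set_scope.
Local Open Scope card_scope.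

(** The invariant along the chain is that each finite tuple of [M_w] is isolated over all of E by
    formulas with parameters in [H_w]. It works three times: it keeps [M_w] from meeting E outside
    [H_w], it yields the pull-back clause of the (n+1)-dimensional system, and it turns isolation
    over the base of a stage into isolation over that base and E. That system must also satisfy the
    stability clause on mixed faces, partly in [H_w] and partly in [H_{<w}]. Such a face is itself
    the union of an amalgam of smaller dimension, so k-stability is used for many k within one step.
    Two further points shape the induction. The models need a cardinality bound, since [M_{<w}]
    belongs to the next base, which has to be smaller than E. And the tuple c lies in every hull, so
    from the second stage on it is absorbed by the model face, and the systems met by the induction
    hypothesis carry no tuple. *)

(** * Comparing cardinalities *)

Lemma card_le_inj (T U : Type) (A : set T) (B : set U) (f : T -> U) :
  (forall x, A x -> B (f x)) ->
  (forall x y, A x -> A y -> f x = f y -> x = y) -> A #<= B.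
Proof.
move=> fAB finj; have [g] : $|{injfun A >-> B}|.
  by apply/injfunPex; exists f => // x y /set_mem Ax /set_mem Ay; exact: finj.
exact: inj_card_le.
Qed.

Lemma card_le_rel (T U : Type) (A : set T) (B : set U) (R : T -> U -> Prop) :
  (forall x, A x -> exists2 y, B y & R x y) ->
  (forall x y z, A x -> A y -> R x z -> R y z -> x = y) -> A #<= B.
Proof.
move=> tot inj; have [->|/set0P[x0 Ax0]] := eqVneq A set0; first exact: card_ge0.
have [u0 _ _] := tot _ Ax0.
have /choice[f fP] : forall x, exists y, A x -> B y /\ R x y.
  move=> x; case: (pselect (A x)) => [/tot[y ? ?]|?]; first by exists y.
  by exists u0.
apply: (@card_le_inj _ _ _ _ f) => [x /fP[]//|x y Ax Ay e].
by apply: (inj _ _ (f x)) => //; [have [] := fP _ Ax|rewrite e; have [] := fP _ Ay].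
Qed.

Lemma card_le_injP (T U : Type) (A : set T) (B : set U) (u0 : U) :
  A #<= B -> exists f : T -> U, (forall x, A x -> B (f x)) /\
    (forall x y, A x -> A y -> f x = f y -> x = y).
Proof.
move=> /card_leP[f].
exists (fun x => if pselect (A x) is left Ax then val (f (SigSub (mem_set Ax))) else u0).
split=> [x Ax|x y Ax Ay]; first by case: pselect => // Ax'; exact: set_valP.
case: pselect => // Ax'; case: pselect => // Ay' /val_inj /(@inj _ _ _ f).
by move=> /(_ (mem_set I) (mem_set I)) [].
Qed.

Lemma card_le_funP (T U : Type) (u0 : U) :
  [set: T] #<= [set: U] -> exists f : T -> U, injective f.
Proof. by move=> /(card_le_injP u0)[f [_ fi]]; exists f => x y; exact: fi. Qed.

Lemma fun_card_le (T U : Type) (A : set T) (f : T -> U) :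
  (forall x y, A x -> A y -> f x = f y -> x = y) -> A #<= [set: U].
Proof. exact: card_le_inj. Qed.

(** ** Well-orders *)

Definition well_ordered (W : Type) (lt : W -> W -> Prop) :=
  [/\ forall x, ~ lt x x, forall x y z, lt x y -> lt y z -> lt x z &
      forall S : set W, S !=set0 -> exists2 m, S m & forall z, S z -> lt m z \/ m = z].

Section WellOrdered.
Variables (W : Type) (lt : W -> W -> Prop).
Hypothesis wo : well_ordered lt.

Lemma wo_total x y : [\/ lt x y, x = y | lt y x].
Proof.
have [_ _ /(_ [set x; y])[|m]] := wo; first by exists x; left.
case=> ->; [move=> /(_ y)|move=> /(_ x)].
- by case; [right|apply: Or31|apply: Or32].
- by case; [left|apply: Or33|move=> ->; apply: Or32].
Qed.

Lemma wo_wf : well_founded lt.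
Proof.
move=> a; apply: contrapT => na; have [_ tr /(_ [set x | ~ Acc lt x])[|m]] := wo.
  by exists a.
move=> nm mmin; apply: nm; constructor => y ym; apply: contrapT => ny.
have [irr _ _] := wo; have [my|my] := mmin _ ny; last by apply: (irr m); rewrite {1}my.
by apply: (irr m); apply: tr ym.
Qed.

(** [G] receives a total function, set to the default [v0] off the initial segment of [w]; the
    recursion equation then involves no dependent types. *)
Lemma wo_recursion (V : Type) (v0 : V) (G : (W -> V) -> W -> V) :
  exists F, forall w, F w = G (fun y => if `[< lt y w >] then F y else v0) w.
Proof.
pose body (x : W) (rec : forall y, lt y x -> V) : V :=
  G (fun y => if pselect (lt y x) is left p then rec y p else v0) x.
exists (Fix wo_wf (fun _ => V) body) => w; rewrite Fix_eq; last first.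
  move=> x f g fg; rewrite /body; congr (G _ x); apply: funext => y.
  by case: pselect.
rewrite {1}/body; congr (G _ w); apply: funext => y.
by case: pselect => p; case: asboolP.
Qed.

(* A version of Hartogs' theorem: a well-order none of whose initial segments
   dominates Y injects into Y, by choosing a fresh element at each step. *)
Lemma initial_segments_card_le (D : set W) (U : Type) (Y : set U) :
  (forall x, D x -> ~ (Y #<= [set z | D z /\ lt z x])) -> D #<= Y.
Proof.
move=> nY; have [->|/set0P[d0 Dd0]] := eqVneq D set0; first exact: card_ge0.
have [u0 Yu0] : exists u0, Y u0.
  apply: contrapT => nY0; apply: (nY _ Dd0).
  by have -> : Y = set0; [rewrite -subset0 => u Yu; apply: nY0; exists u|exact: card_ge0].
have /choice[G GP] : forall p : (W -> U) * W, exists u, D p.2 ->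
    Y u /\ forall z, D z -> lt z p.2 -> p.1 z <> u.
  case=> F x /=; have [Dx|nDx] := pselect (D x); last by exists u0.
  apply: contrapT => /forallNP nu; apply: (nY _ Dx).
  apply: (card_le_rel (R := fun u z => F z = u)) => [u Yu|u v z _ _ <- //].
  apply: contrapT => nz; apply: (nu u) => _; split=> // z Dz zx Fz.
  by apply: nz; exists z.
have [F FE] := wo_recursion u0 (fun F w => G (F, w)).
apply: (@card_le_inj _ _ _ _ F) => [x Dx|x y Dx Dy Fxy].
  by rewrite FE; exact: (proj1 (GP (_, x) Dx)).
have main a b : D a -> D b -> lt a b -> F a <> F b.
  move=> Da Db ab; rewrite [F b]FE.
  have [_ /(_ a Da ab)] := GP (fun y => if `[< lt y b >] then F y else u0, b) Db.
  by rewrite /=; case: asboolP.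
by case: (wo_total x y) => [/(main _ _ Dx Dy)//|//|/(main _ _ Dy Dx) []].
Qed.

End WellOrdered.

Lemma well_ordered_of (W : Type) (R : W -> W -> bool) : well_order R ->
  well_ordered (fun x y => R x y /\ x <> y).
Proof.
(* [well_order] quantifies over boolean subsets, which are easiest to form over an [eqType];
   [{classic W}] supplies one. *)
suff main (T : eqType) (S : rel T) : well_order S -> well_ordered (fun x y => S x y /\ x <> y).
  exact: (main {classic W}).
move=> {W R} Rw; have Rwo : wo_chain S predT by move=> A _; apply: Rw.
split=> [x [] //|x y z [xy nxy] [yz nyz]|Q [x Qx]].
- have Ranti := wo_chain_antisymmetric Rwo.
  (* Transitivity is read off the least element of the set of [x], [y], [z]. *)
  have [m [[mS mle] _]] := Rw [pred t | t \in [:: x; y; z]] (ex_intro _ x (mem_head _ _)).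
  have [mx my mz] : [/\ S m x, S m y & S m z].
    by split; apply: mle; rewrite !inE eqxx ?orbT.
  have xz : S x z.
    move: mS; rewrite !inE => /or3P[] /eqP e; subst m => //.
      by case: nxy; apply: Ranti => //; apply/andP.
    have yz' : y = z by apply: Ranti => //; apply/andP.
    by case: nyz.
  split=> // xz'; subst z; apply: nxy; apply: Ranti => //; exact/andP.
- have [|m [[mS mle] _]] := Rw [pred t | `[< Q t >]]; first by exists x; rewrite unfold_in; exact/asboolP.
  exists m; first by move: mS; rewrite unfold_in => /asboolP.
  move=> z Qz; have [->|nmz] := pselect (m = z); [by right|left; split => //].
  by apply: mle; rewrite unfold_in; exact/asboolP.
Qed.

Lemma well_ordering (W : Type) : exists lt : W -> W -> Prop, well_ordered lt.
Proof.
have [R Rwo] := well_ordering_principle {classic W}.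
by exists (fun x y : W => R x y /\ x <> y); exact: (@well_ordered_of W).
Qed.

Lemma well_order_of (W : Type) (lt : W -> W -> Prop) : well_ordered lt ->
  well_order (fun x y => `[< lt x y \/ x = y >]).
Proof.
move=> wo; have [irr tr mn] := wo; apply: antisymmetric_well_order.
  move=> x y /andP[/asboolP[xy|//] /asboolP[yx|->//]].
  by case: (irr x); apply: tr yx.
move=> A [x xA]; have [|m mA mmin] := mn [set z | z \in A]; first by exists x.
by exists m; split=> // z /mmin ?; apply/asboolP.
Qed.

Lemma wo_pull (X Y : Type) (lt : Y -> Y -> Prop) (f : X -> Y) :
  well_ordered lt -> injective f -> well_ordered (fun x y => lt (f x) (f y)).
Proof.
move=> [irr tr mn] fi; split=> [x|x y z|S [x Sx]]; [exact: irr|exact: tr|].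
have [|_ [m Sm <-] mmin] := mn (f @` S); first by exists (f x); exists x.
exists m => // z Sz; have [|?|/fi] := mmin (f z); first (by exists z); by [left|right].
Qed.

Lemma existT_inj (W : Type) (V : W -> Type) w (i j : V w) :
  existT V w i = existT V w j -> i = j.
Proof. by apply: Eqdep_dec.inj_pair2_eq_dec => x y; exact: pselect. Qed.

(** Equality with an [existT] over the first component of [q] stands for a transport of the second
    component of [p]. *)
Definition lex_lt (W : Type) (V : W -> Type) (lt : W -> W -> Prop)
    (ltV : forall w, V w -> V w -> Prop) (p q : {w & V w}) : Prop :=
  lt (projT1 p) (projT1 q) \/
  exists2 i, p = existT V (projT1 q) i & ltV _ i (projT2 q).

Lemma wo_lex (W : Type) (V : W -> Type) (lt : W -> W -> Prop)
    (ltV : forall w, V w -> V w -> Prop) :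
  well_ordered lt -> (forall w, well_ordered (ltV w)) ->
  well_ordered (@lex_lt W V lt ltV).
Proof.
move=> [irr tr mn] woV; split.
- move=> [w i] []; [exact: irr|case=> i1 e1 ii1].
  move: (existT_inj e1) ii1 => <-.
  by have [irrV _ _] := woV w; apply: irrV.
- move=> [w i] [v j] [u k]; case=> /= [wv|[i1 e ij]]; case=> /= [vu|[j1 e1 jk]].
  + by left; apply: tr vu.
  + by left => /=; rewrite -(congr1 (@projT1 _ _) e1 : v = u).
  + by left => /=; rewrite (congr1 (@projT1 _ _) e : w = v).
  + right; have ev : v = u := congr1 (@projT1 _ _) e1.
    subst v; exists i1 => //.
    have [_ trV _] := woV u; apply: trV ij _.
    by rewrite (existT_inj e1).
- move=> S [[w0 i0] S0]; have [|w [i Si] wmin] := mn [set w | exists i, S (existT V w i)].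
    by exists w0, i0.
  have [_ _ /(_ [set i | S (existT V w i)])[|m Sm mmin]] := woV w; first by exists i.
  exists (existT V w m) => // -[v j] Svj.
  have [|wv|e] := wmin v; [by exists j|by left; left|subst v].
  by have [mj|->] := mmin _ Svj; [left; right; exists m|right].
Qed.

(** ** Cardinal arithmetic *)

Definition absorbing (Q : Type) :=
  [set: nat] #<= [set: Q] /\ [set: Q * Q] #<= [set: Q].

(** Hilbert's hotel along a copy of the natural numbers in [A]. *)
Lemma infinite_card_addn (T : Type) (A : set T) (x : T) :
  [set: nat] #<= A -> A `|` [set x] #<= A.
Proof.
move=> /(card_le_injP x)[f [fA fi]].
pose g z := if pselect (z = x) is left _ then f 0 else
  if pselect (exists n, z = f n) is left h then f (sval (cid h)).+1 else z.
apply: (@card_le_inj _ _ _ _ g).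
  move=> z Az; rewrite /g; case: pselect => [_|nzx]; first exact: fA.
  by case: pselect => [h|_]; [exact: fA|case: Az].
move=> y z _ _; rewrite /g; case: (pselect (y = x)) => [->|nyx]; case: (pselect (z = x)) => [->|nzx] //.
- case: pselect => [h|nh]; first by move/fi => /(_ I I).
  by move=> e; case: nh; exists 0.
- case: pselect => [h|nh]; first by move/fi => /(_ I I).
  by move=> e; case: nh; exists 0.
- case: (pselect (exists n, y = f n)) => [h|nh]; case: (pselect (exists n, z = f n)) => [h'|nh'] //.
  + move/fi => /(_ I I) [] e.
    by rewrite (svalP (cid h)) (svalP (cid h')) e.
  + by move=> e; case: nh'; eexists; rewrite -e.
  + by move=> e; case: nh; eexists; rewrite e.
Qed.

Lemma card_leX (T U T' U' : Type) (A : set T) (B : set U) (A' : set T') (B' : set U') :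
  A #<= A' -> B #<= B' -> A `*` B #<= A' `*` B'.
Proof.
have [->|/set0P[[a b] [Aa Bb]]] := eqVneq (A `*` B) set0; first by move=> *; exact: card_ge0.
move=> AA' BB'.
have [a' _] : exists a', A' a'.
  have /set0P[//] : A' != set0 by apply/eqP => A'0; move: AA'; rewrite A'0 => /card_le0P A0; rewrite A0 in Aa.
  by move=> x A'x; exists x.
have [b' _] : exists b', B' b'.
  have /set0P[//] : B' != set0 by apply/eqP => A'0; move: BB'; rewrite A'0 => /card_le0P A0; rewrite A0 in Bb.
  by move=> x A'x; exists x.
have [f [fA fi]] := card_le_injP a' AA'; have [g [gB gi]] := card_le_injP b' BB'.
apply: (@card_le_inj _ _ _ _ (fun p => (f p.1, g p.2))) => [[x y] [/fA ? /gB]//|].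
by move=> [x y] [z t] [/= ? ?] [/= ? ?] [/fi -> // /gi ->].
Qed.

(* Hessenberg's theorem, by induction along a well-order of Q: order Q * Q by
   the maximum of the coordinates first; every initial segment is then contained
   in a square of a proper initial segment of Q. *)
Lemma infinite_absorbing (Q : Type) : [set: nat] #<= [set: Q] -> absorbing Q.
Proof.
move=> Qinf; split=> //; have [lt wo] := well_ordering Q; have [irr tr _] := wo.
pose seg x := [set z | lt z x].
pose mx x y := if `[< lt x y >] then y else x.
have le_mx x y z : z = mx x y -> (lt x z \/ x = z) /\ (lt y z \/ y = z).
  rewrite /mx => ->; case: asboolP => xy; first by split; [left|right].
  by split; [right|case: (wo_total wo x y) => // ?; [right|left]].
pose key (p : Q * Q) : {_ : Q & {_ : Q & Q}} := existT _ (mx p.1 p.2) (existT _ p.1 p.2).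
pose ltG := lex_lt lt (fun _ : Q => lex_lt lt (fun _ : Q => lt)).
have woG : well_ordered (fun p q => ltG (key p) (key q)).
  apply: wo_pull; first by apply: wo_lex => // _; exact: wo_lex.
  by move=> [a b] [c d] [_ -> ->].
have segG (p q : Q * Q) : ltG (key q) (key p) ->
    lt (mx q.1 q.2) (mx p.1 p.2) \/ mx q.1 q.2 = mx p.1 p.2.
  by case=> [|[i e _]]; [left|right; exact: (congr1 (@projT1 _ _) e)].
(* An arbitrary initial segment [D] serves both the induction along [seg x] and the final case of
   all of [Q]. *)
suff main (D : set Q) : (forall x y, D y -> lt x y -> D x) -> [set: nat] #<= D ->
    (forall x, D x -> [set: nat] #<= seg x -> seg x `*` seg x #<= seg x) -> D `*` D #<= D.
  have IH x : [set: nat] #<= seg x -> seg x `*` seg x #<= seg x.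
    elim/(well_founded_induction (wo_wf wo)): x => x IH xinf.
    by apply: main => [y z /= zx yz||y /IH] //; apply: tr zx.
  by rewrite -setXTT; apply: main => // x _; exact: IH.
move=> Ddown Dinf IH; apply: contrapT => nDD.
(* If no segment of the square dominated [D], Hartogs would inject the square into [D]. *)
have [p [Dp DG]] : exists p, (D `*` D) p /\ D #<= [set q | (D `*` D) q /\ ltG (key q) (key p)].
  apply: contrapT => np; apply: nDD; apply: (initial_segments_card_le woG) => x Dx Dle.
  by apply: np; exists x.
pose m := mx p.1 p.2.
have Dm : D m by rewrite /m /mx; case: Dp => ? ?; case: asboolP.
pose A := seg m `|` [set m].
have DA : D #<= A `*` A.
  apply: card_le_trans DG _; apply: subset_card_le => q [_ /segG mq].
  have [q1 q2] := le_mx q.1 q.2 _ erefl.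
  split; rewrite /A /= /seg /=.
    case: q1 => [q1|->]; last by case: mq; [left|right].
    by left; case: mq => mq; [apply: tr mq|rewrite /m -mq].
  case: q2 => [q2|->]; last by case: mq; [left|right].
  by left; case: mq => mq; [apply: tr mq|rewrite /m -mq].
have minf : [set: nat] #<= seg m.
  apply/infiniteP => fm; move/infiniteP: Dinf; apply; apply: card_le_finite DA _.
  by apply: finite_setX; rewrite finite_setU; split => //; exact: finite_set1.
have Am : A #<= seg m by exact: infinite_card_addn.
have Dm' : D #<= seg m.
  by apply: card_le_trans DA _; apply: card_le_trans (card_leX Am Am) (IH _ Dm minf).
apply: nDD; apply: card_le_trans (card_leX Dm' Dm') _.
by apply: card_le_trans (IH _ Dm minf) _; apply: subset_card_le => z /Ddown; exact.
Qed.

Section Absorbing.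
Variable Q : Type.
Hypothesis Qabs : absorbing Q.

Lemma absorbing_nat : exists e : nat -> Q, injective e.
Proof.
have [Qn _] := Qabs; have [q0 _] : [set: Q] !=set0; last exact: (card_le_funP q0 Qn).
apply: contrapT => /nonemptyPn Q0; move: Qn; rewrite Q0 => /card_le0P.
by move=> n0; have : [set: nat] 0 by []; rewrite n0.
Qed.

Lemma absorbing_pair : exists pr : Q -> Q -> Q, forall a b c d,
  pr a b = pr c d -> a = c /\ b = d.
Proof.
have [e _] := absorbing_nat; have [_ /(card_le_funP (e 0))[f fi]] := Qabs.
by exists (fun a b => f (a, b)) => a b c d /fi [].
Qed.

Lemma absorbing_seq (T : Type) :
  [set: T] #<= [set: Q] -> [set: seq T] #<= [set: Q].
Proof.
have [e ei] := absorbing_nat; have [pr pri] := absorbing_pair.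
move=> /(card_le_funP (e 0))[f fi].
(* [c] alone need not be injective, since [e 0] may be a pair; hence the length is recorded next to
   it. *)
pose c := foldr (fun t => pr (f t)) (e 0).
apply: (fun_card_le (f := fun s => pr (e (size s)) (c s))) => s t _ _ /pri[/ei].
by elim: s t => [|x s IH] [|y t] //= [sz] /pri[/fi -> /(IH _ sz) ->].
Qed.

Lemma absorbing_sum (S T : Type) : [set: S] #<= [set: Q] ->
  [set: T] #<= [set: Q] -> [set: S + T] #<= [set: Q].
Proof.
have [e ei] := absorbing_nat; have [pr pri] := absorbing_pair.
move=> /(card_le_funP (e 0))[f fi] /(card_le_funP (e 0))[g gi].
apply: (fun_card_le (f := fun p => match p with inl s => pr (e 0) (f s)
  | inr t => pr (e 1) (g t) end)).
by move=> [s|s] [t|t] _ _ /pri[] => [_ /fi->|/ei|/ei|_ /gi->].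
Qed.

Lemma absorbing_prod (S T : Type) : [set: S] #<= [set: Q] ->
  [set: T] #<= [set: Q] -> [set: S * T] #<= [set: Q].
Proof.
have [e ei] := absorbing_nat; have [pr pri] := absorbing_pair.
move=> /(card_le_funP (e 0))[f fi] /(card_le_funP (e 0))[g gi].
apply: (fun_card_le (f := fun p => pr (f p.1) (g p.2))).
by move=> [s s'] [t t'] _ _ /pri[/= /fi-> /gi->].
Qed.

Lemma absorbing_countable (T : Type) (A : set T) : countable A -> A #<= [set: Q].
Proof. by move=> cA; apply: card_le_trans cA _; case: Qabs. Qed.

Lemma absorbing_bigcup (I T : Type) (D : set I) (F : I -> set T) :
  D #<= [set: Q] -> (forall i, D i -> F i #<= [set: Q]) ->
  \bigcup_(i in D) F i #<= [set: Q].
Proof.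
have [e ei] := absorbing_nat; have [pr pri] := absorbing_pair.
move=> /(card_le_injP (e 0))[f [_ fi]] Fle.
have /choice[g gP] : forall i, exists g : T -> Q, D i -> forall x y, F i x -> F i y ->
    g x = g y -> x = y.
  move=> i; have [/Fle/(card_le_injP (e 0))[g [_ gi]]|nDi] := pselect (D i).
    by exists g.
  by exists (fun=> e 0).
apply: (card_le_rel (R := fun x q => exists2 i, D i /\ F i x & q = pr (f i) (g i x))).
  by move=> x [i Di Fx]; exists (pr (f i) (g i x)) => //; exists i.
move=> x y z _ _ [i [Di Fx] ->] [j [Dj Fy]] /pri[/(fi _ _ Di Dj) eij].
by subst j => /(gP _ Di); apply.
Qed.

Lemma absorbing_setU (T : Type) (A B : set T) :
  A #<= [set: Q] -> B #<= [set: Q] -> A `|` B #<= [set: Q].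
Proof.
move=> hA hB; have -> : A `|` B = \bigcup_(i in [set: bool]) (if i then A else B).
  by apply/seteqP; split=> [x [h|h]|x [[] _ h]]; [exists true|exists false|left|right].
apply: absorbing_bigcup => [|[] _ //]; apply: absorbing_countable.
exact: countableP.
Qed.

End Absorbing.

(* Ordered forests with nodes labelled in X; they serve as tuples of terms. *)
Inductive forest (X : Type) := FNil | FCons of X & forest X & forest X.
Arguments FNil {X}.

Fixpoint forest_code X (s : forest X) : seq (option X) :=
  if s is FCons x a b then Some x :: forest_code a ++ forest_code b else [:: None].

(** The code is prefix-free; the arbitrary continuations [u] and [v] let the induction pass through
    the concatenation of two subforests. *)
Lemma forest_code_inj X (s t : forest X) u v :
  forest_code s ++ u = forest_code t ++ v -> s = t /\ u = v.
Proof.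
elim: s t u v => [|x a IHa b IHb] [|y c d] u v //= [] //.
by move=> ->; rewrite -!catA => /IHa[-> /IHb[-> ->]].
Qed.

Lemma card_forest (Q X : Type) : absorbing Q -> [set: X] #<= [set: Q] ->
  [set: forest X] #<= [set: Q].
Proof.
move=> Qabs hX; have hs : [set: seq (option X)] #<= [set: Q].
  apply: absorbing_seq => //.
  have hU : [set: unit + X] #<= [set: Q].
    by apply: absorbing_sum => //; apply: absorbing_countable => //; exact: countableP.
  apply: card_le_trans _ hU.
  apply: (fun_card_le (f := fun o => if o is Some x then inr x else inl tt)).
  by move=> [x|] [y|] _ _ // [->].
apply: card_le_trans _ hs; apply: (fun_card_le (f := @forest_code X)) => s t _ _ e.
by have [] := @forest_code_inj X s t [::] [::] (congr1 (cat^~ [::]) e).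
Qed.

(** * The continuum and the height of the tree of types *)

Notation reals := (nat -> bool).

Lemma absorbing_reals : absorbing reals.
Proof.
apply: infinite_absorbing; apply: (fun_card_le (f := fun n => eq_op n)) => m n _ _.
by move=> /(congr1 (fun f : reals => f n)); rewrite eqxx => /eqP.
Qed.

Lemma card_powerset (T : Type) : ~ ([set: set T] #<= [set: T]).
Proof.
move=> h; have [t0] : [set: T] !=set0.
  apply: contrapT => /nonemptyPn T0; move: h; rewrite T0 => /card_le0P.
  by move=> n0; have : [set: set T] set0 by []; rewrite n0.
move=> _; have [f fi] := card_le_funP t0 h.
pose D := [set x | exists2 X, f X = x & ~ X x].
have [Df|nDf] := pselect (D (f D)); last by apply: (nDf); exists D.
by have [X /fi -> nD] := Df; apply: nD.
Qed.

(** [W0] is the first initial segment with more than continuum many subsets, or all of [reals] if no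
    proper segment has so many. It has no last element, since one more element merely doubles the
    number of subsets. *)
Lemma branching_height (lt : reals -> reals -> Prop) : well_ordered lt ->
  exists W0 : set reals,
    [/\ forall w, W0 w -> [set X : set reals | X `<=` [set z | lt z w]] #<= [set: reals],
        ~ ([set X : set reals | X `<=` W0] #<= [set: reals]),
        W0 !=set0
      & forall w, W0 w -> exists2 v, W0 v & lt w v].
Proof.
move=> wo; have [irr tr mn] := wo.
pose small_seg w := [set X : set reals | X `<=` [set z | lt z w]] #<= [set: reals].
have [W0 [h1 h2]] : exists W0 : set reals, (forall w, W0 w -> small_seg w) /\
   ~ ([set X : set reals | X `<=` W0] #<= [set: reals]).
  have [all_small|] := pselect (forall w, small_seg w).
    exists setT; split=> // h; apply: (@card_powerset reals).
    by apply: card_le_trans h; exact: subset_card_le.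
  move=> /existsNP[w0 nw0]; have [|w nw wmin] := mn [set w | ~ small_seg w]; first by exists w0.
  exists [set z | lt z w]; split=> // z zw.
  apply: contrapT => /wmin[wz|wz]; first by apply: (irr w); apply: tr zw.
  by apply: (irr w); rewrite {1}wz.
exists W0; split=> //.
  apply/set0P/negP => /eqP W00; apply: h2; rewrite W00.
  apply: absorbing_countable; first exact: absorbing_reals.
  apply: sub_countable (countable1 (@set0 reals)); apply: subset_card_le => X /=.
  by rewrite subset0.
move=> w Ww; apply: contrapT => nw; apply: h2.
have W0E z : W0 z -> lt z w \/ z = w.
  move=> Wz; have [|->|wz] := wo_total wo z w; [by left|by right|].
  by case: nw; exists z.
have hp : [set: bool] `*` [set X : set reals | X `<=` [set z | lt z w]] #<= [set: reals].
  apply: card_le_trans (proj2 absorbing_reals); rewrite -setXTT; apply: card_leX => //.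
    by apply: absorbing_countable (countableP _); exact: absorbing_reals.
  exact: h1.
apply: card_le_trans _ hp.
apply: (card_le_rel (R := fun X p => X = p.2 `|` (if p.1 then [set w] else set0))).
  move=> X XW; exists (`[< X w >], X `\ w).
    by split=> // z [/XW/W0E [] // -> /=].
  apply/seteqP; split=> [z Xz|z [[]//|]] /=; last by case: asboolP => // Xw ->.
  have [zw|zw] := pselect (z = w); last by left.
  by right; rewrite -zw; case: asboolP.
by move=> x y z _ _ -> ->.
Qed.

(** ** Renaming of variables and definability *)

Lemma vcons0 X n (x : X) (v : 'I_n -> X) : vcons x v ord0 = x.
Proof. by rewrite /vcons unlift_none. Qed.

Lemma vconsS X n (x : X) (v : 'I_n -> X) i : vcons x v (lift ord0 i) = v i.
Proof. by rewrite /vcons liftK. Qed.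

Lemma vcatl X m k (x : 'I_m -> X) (y : 'I_k -> X) i : vcat x y (lshift k i) = x i.
Proof. by rewrite /vcat (unsplitK (inl i)). Qed.

Lemma vcatr X m k (x : 'I_m -> X) (y : 'I_k -> X) i : vcat x y (rshift m i) = y i.
Proof. by rewrite /vcat (unsplitK (inr i)). Qed.

Lemma vcat_comp X Y m k (x : 'I_m -> X) (y : 'I_k -> X) (h : X -> Y) :
  h \o vcat x y = vcat (h \o x) (h \o y).
Proof. by apply: funext => i; rewrite /vcat /=; case: fintype.split. Qed.

Lemma vcat_split X m k (v : 'I_(m + k) -> X) :
  v = vcat (v \o @lshift m k) (v \o @rshift m k).
Proof. by apply: funext => i; rewrite /vcat -{1}(splitK i); case: fintype.split. Qed.

Lemma vcons_comp X Y n (x : X) (v : 'I_n -> X) (h : X -> Y) :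
  h \o vcons x v = vcons (h x) (h \o v).
Proof. by apply: funext => i; rewrite /vcons /=; case: unlift. Qed.

Lemma vcons_eta X n (v : 'I_n.+1 -> X) : v = vcons (v ord0) (v \o lift ord0).
Proof. by apply: funext => i; case: (unliftP ord0 i) => [j|] ->; [rewrite vconsS|rewrite vcons0]. Qed.

Definition lift_ren n m (r : 'I_n -> 'I_m) : 'I_n.+1 -> 'I_m.+1 :=
  vcons ord0 (lift ord0 \o r).

Fixpoint ren L n (f : formula L n) : forall m, ('I_n -> 'I_m) -> formula L m :=
  match f in formula _ n return forall m, ('I_n -> 'I_m) -> formula L m with
  | fEq _ i j => fun m r => fEq L (r i) (r j)
  | fRel _ R w => fun m r => fRel (r \o w)
  | fBot _ => fun m r => fBot L m
  | fImp _ g h => fun m r => fImp (ren g r) (ren h r)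
  | fAll _ g => fun m r => fAll (ren g (lift_ren r))
  end.

Lemma vcons_lift_ren X n m (r : 'I_n -> 'I_m) (x : X) (v : 'I_m -> X) :
  vcons x v \o lift_ren r = vcons x (v \o r).
Proof.
apply: funext => i; case: (unliftP ord0 i) => [j|] -> /=.
  rewrite [RHS]vconsS; rewrite /lift_ren vconsS /=; exact: vconsS.
by rewrite [RHS]vcons0 /lift_ren vcons0; exact: vcons0.
Qed.

(* Satisfaction with quantifiers relativized to D; structures induced on subsets
   of a fixed set X are compared through it. *)
Fixpoint satr L (X : Type) (J : forall R : symb L, ('I_(arity R) -> X) -> Prop)
    (D : set X) n (f : formula L n) : ('I_n -> X) -> Prop :=
  match f in formula _ n return ('I_n -> X) -> Prop with
  | fEq _ i j => fun v => v i = v j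
  | fRel _ R w => fun v => J R (fun i => v (w i))
  | fBot _ => fun=> False
  | fImp _ g h => fun v => satr J D g v -> satr J D h v
  | fAll _ g => fun v => forall x, D x -> satr J D g (vcons x v)
  end.

Section Relativized.
Variables (L : vocabulary) (X : Type).
Implicit Types (J : forall R : symb L, ('I_(arity R) -> X) -> Prop) (D : set X).

Lemma satr_ren J D n (f : formula L n) m (r : 'I_n -> 'I_m) (v : 'I_m -> X) :
  satr J D (ren f r) v <-> satr J D f (v \o r).
Proof.
elim: f m r v => [{}n i j|{}n R w|{}n|{}n g IHg h IHh|{}n g IHg] m r v //=.
  by split=> H /IHg/H/IHh.
by split=> H x Dx; have := H x Dx; rewrite IHg vcons_lift_ren.
Qed.

Lemma sat_satr (S : structure L) J D (h : S -> X) :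
  injective h -> (forall s, D (h s)) -> (forall x, D x -> exists s, h s = x) ->
  (forall R (v : 'I_(arity R) -> S), interp v <-> J R (h \o v)) ->
  forall n (f : formula L n) (v : 'I_n -> S), sat f v <-> satr J D f (h \o v).
Proof.
move=> hi hD Dh hJ n f; elim: f => [{}n i j|{}n R w|{}n|{}n g IHg h' IHh|{}n g IHg] v //=.
- by split=> [->|/hi].
- by split=> H /IHg/H/IHh.
- split=> H x; first by move=> /Dh[s <-]; rewrite -vcons_comp -IHg.
  by apply/IHg; rewrite vcons_comp; apply: H.
Qed.

(** With [fAll] as the only quantifier, the test asks for counterexamples rather than witnesses. *)
Lemma tarski_vaught J D D' : D' `<=` D ->
  (forall n (f : formula L n.+1) (v : 'I_n -> X), (forall i, D' (v i)) ->
    (exists x, D x /\ ~ satr J D f (vcons x v)) ->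
    exists x, D' x /\ ~ satr J D f (vcons x v)) ->
  forall n (f : formula L n) (v : 'I_n -> X), (forall i, D' (v i)) ->
    (satr J D' f v <-> satr J D f v).
Proof.
move=> DD' cl n f; elim: f => [{}n i j|{}n R w|{}n|{}n g IHg h IHh|{}n g IHg] v D'v //=.
  by split=> H /(IHg _ D'v)/H/(IHh _ D'v).
have D'c x : D' x -> forall i, D' (vcons x v i).
  by move=> D'x i; rewrite /vcons; case: unlift.
split=> H x; last by move=> D'x; apply/IHg; [exact: D'c|apply: H; exact: DD'].
apply: contraPP => nH Dx; have [] := cl _ g v D'v; first by exists x.
by move=> y [D'y]; apply; apply/IHg; [exact: D'c|exact: H].
Qed.

End Relativized.

Lemma satr_setT L (C : structure L) n (f : formula L n) (v : 'I_n -> C) :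
  satr (@interp L C) setT f v <-> sat f v.
Proof. by rewrite (@sat_satr L C C (@interp L C) setT id) // => x _; exists x. Qed.

Lemma sat_ren L (C : structure L) n (f : formula L n) m (r : 'I_n -> 'I_m) (v : 'I_m -> C) :
  sat (ren f r) v <-> sat f (v \o r).
Proof. by rewrite -!satr_setT satr_ren. Qed.

Lemma sat_induced L (C : structure L) (D : set C) n (f : formula L n) (v : 'I_n -> induced D) :
  sat f v <-> satr (@interp L C) D f (fun i => val (v i)).
Proof.
apply: (@sat_satr L _ (induced D) (@interp L C) D val) => //.
- by move=> s; exact: (@set_valP _ D s).
- by move=> x Dx; exists (SigSub (mem_set Dx)).
Qed.

Fixpoint fAlls L n p : formula L (p + n) -> formula L n :=
  if p is p'.+1 then fun f : formula L (p'.+1 + n) => fAlls (fAll (f : formula L (p' + n).+1))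
  else fun f => f.

Lemma sat_fAlls L (C : structure L) n p (f : formula L (p + n)) (v : 'I_n -> C) :
  sat (fAlls f) v <-> forall x : 'I_p -> C, sat f (vcat x v).
Proof.
elim: p f => [|p IH] f /=.
  have vE (x : 'I_0 -> C) : vcat x v = v.
    apply: funext => i; rewrite -[in RHS](vcatr x v i); congr (vcat x v _).
    exact: val_inj.
  by split=> [H x|/(_ (fun i : 'I_0 => match notF (ltn_ord i) with end))]; rewrite vE.
have vE x (y : 'I_p -> C) : vcat (vcons x y) v = vcons x (vcat y v) :> ('I_(p.+1 + n) -> C).
  apply: funext => i; rewrite -(splitK i); case: (fintype.split i) => j; rewrite /unsplit.
    rewrite vcatl; case: (unliftP ord0 j) => [j'|] ->.
      rewrite vconsS; have -> : lshift n (lift ord0 j') = lift ord0 (lshift n j') by exact: val_inj.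
      by rewrite vconsS vcatl.
    rewrite vcons0; have -> : lshift n (@ord0 p) = ord0 by exact: val_inj.
    by rewrite vcons0.
  rewrite vcatr; have -> : rshift p.+1 j = lift ord0 (rshift p j) by exact: val_inj.
  by rewrite vconsS vcatr.
rewrite IH /=; split=> H x; last by move=> y; rewrite -vE; exact: H.
by rewrite (vcons_eta x) vE; exact: H.
Qed.

Definition sumv X V V' (x : V -> X) (y : V' -> X) : V + V' -> X :=
  fun z => match z with inl i => x i | inr j => y j end.

(* Definability of a relation on V -> C by a formula whose variables are named by
   an arbitrary type V, so that renaming is composition. *)
Definition dfn L (C : structure L) (V : Type) (R : (V -> C) -> Prop) :=
  exists n (f : formula L n) (r : 'I_n -> V), forall v, R v <-> sat f (v \o r).

Section Definability.
Variables (L : vocabulary) (C : structure L).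

Lemma dfn_ext V (R R' : (V -> C) -> Prop) : (forall v, R v <-> R' v) -> dfn R -> dfn R'.
Proof. by move=> RR' [n [f [r h]]]; exists n, f, r => v; rewrite -RR'. Qed.

Lemma dfn_sat n (f : formula L n) : @dfn L C 'I_n (fun v => sat f v).
Proof. by exists n, f, id. Qed.

Lemma dfn_ren V V' (h : V -> V') (R : (V -> C) -> Prop) :
  dfn R -> dfn (fun v : V' -> C => R (v \o h)).
Proof. by move=> [n [f [r H]]]; exists n, f, (h \o r) => v; exact: H. Qed.

Lemma dfn_bot V : @dfn L C V (fun=> False).
Proof. by exists 0, (fBot L 0), (fun i : 'I_0 => match notF (ltn_ord i) with end). Qed.

Lemma dfn_imp V (R S : (V -> C) -> Prop) : dfn R -> dfn S -> dfn (fun v => R v -> S v).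
Proof.
move=> [n [f [r Rf]]] [m [g [s Sg]]].
exists (n + m), (fImp (ren f (@lshift n m)) (ren g (@rshift n m))), (vcat r s) => v.
rewrite /= !sat_ren Rf Sg vcat_comp.
have -> : vcat (v \o r) (v \o s) \o @lshift n m = v \o r by apply: funext => i; exact: vcatl.
by have -> : vcat (v \o r) (v \o s) \o @rshift n m = v \o s by apply: funext => i; exact: vcatr.
Qed.

Lemma dfn_not V (R : (V -> C) -> Prop) : dfn R -> dfn (fun v => ~ R v).
Proof. by move=> h; apply: dfn_imp => //; exact: dfn_bot. Qed.

Lemma dfn_and V (R S : (V -> C) -> Prop) : dfn R -> dfn S -> dfn (fun v => R v /\ S v).
Proof.
move=> hR hS; apply: dfn_ext (dfn_not (dfn_imp hR (dfn_not hS))) => v.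
by split=> [/not_implyP[? /contrapT]|[? ?]] //; apply.
Qed.

Lemma dfn_all V p (R : ('I_p + V -> C) -> Prop) :
  dfn R -> dfn (fun v : V -> C => forall x : 'I_p -> C, R (sumv x v)).
Proof.
(* Indices captured by the quantifier still need a value under [r1]. A default exists when [V] is
   inhabited; otherwise every index is captured. *)
move=> [n [f [r Rf]]]; have [[v0 _]|nV] := pselect (exists v : V, True).
  pose r0 i : 'I_(p + n) := match r i with inl j => lshift n j | inr _ => rshift p i end.
  pose r1 i := match r i with inl _ => v0 | inr w => w end.
  exists n, (fAlls (ren f r0)), r1 => v; rewrite sat_fAlls.
  have E x : vcat x (v \o r1) \o r0 = sumv x v \o r.
    by apply: funext => i /=; rewrite /r0; case e: (r i) => [j|w]; rewrite (vcatl, vcatr) //= /r1 e.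
  by split=> H x; have := H x; rewrite sat_ren E Rf.
have rE i : exists j, r i = inl j by case: (r i) => [j|w]; [exists j|case: nV; exists w].
have [r0 r0E] := choice rE; pose r1 (i : 'I_0) : V := match notF (ltn_ord i) with end.
exists 0, (fAlls (ren f (fun i => lshift 0 (r0 i)))), r1 => v; rewrite sat_fAlls.
have E x : vcat x (v \o r1) \o (fun i => lshift 0 (r0 i)) = sumv x v \o r.
  by apply: funext => i /=; rewrite vcatl r0E.
by split=> H x; have := H x; rewrite sat_ren E Rf.
Qed.

Lemma dfn_ex V p (R : ('I_p + V -> C) -> Prop) :
  dfn R -> dfn (fun v : V -> C => exists x : 'I_p -> C, R (sumv x v)).
Proof.
move=> hR; apply: dfn_ext (dfn_not (dfn_all (dfn_not hR))) => v.
by split=> [/existsNP[x /contrapT Rx]|[x Rx] /(_ x)//]; exists x.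
Qed.

Lemma dfn_forall_fin V m (R : 'I_m -> (V -> C) -> Prop) :
  (forall i, dfn (R i)) -> dfn (fun v => forall i, R i v).
Proof.
elim: m R => [|m IH] R hR.
  apply: dfn_ext (dfn_not (dfn_bot V)) => v.
  by split=> _ [].
apply: dfn_ext (dfn_and (hR ord0) (IH _ (fun i => hR (lift ord0 i)))) => v.
split=> [[R0 RS] i|H]; last by split.
by case: (unliftP ord0 i) => [j|] ->.
Qed.

Implicit Types D : set C.

(** Definability with parameters in which each element of [D] is its own variable, so that parameter
    tuples never have to be chosen or merged. [dovP] recovers formulas with a finite tuple of
    parameters. *)
Definition dov (D : set C) (V : Type) (X : (V -> C) -> Prop) :=
  exists2 R, @dfn L C (V + D) R & forall x, X x <-> R (sumv x (fun d : D => val d)).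

Lemma dov_ext D V (X Y : (V -> C) -> Prop) : (forall v, X v <-> Y v) -> dov D X -> dov D Y.
Proof. by move=> XY [R dR h]; exists R => // x; rewrite -XY. Qed.

Lemma dov_dfn D V (X : (V -> C) -> Prop) : dfn X -> dov D X.
Proof. by move=> h; exists (fun v => X (v \o inl)) => //; exact: dfn_ren. Qed.

Lemma dov_sub D D' V (X : (V -> C) -> Prop) : D `<=` D' -> dov D X -> dov D' X.
Proof.
move=> DD' [R dR h].
pose i (d : D) : D' := SigSub (mem_set (DD' _ (set_valP d))).
pose j (z : V + D) := match z with inl v => inl v | inr d => inr (i d) end.
exists (fun v => R (v \o j)); first exact: dfn_ren.
move=> x; rewrite h; suff -> : sumv x (fun d : D => val d) = sumv x (fun d : D' => val d) \o j by [].
by apply: funext => -[].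
Qed.

Lemma dov_ren D V V' (h : V -> V') (X : (V -> C) -> Prop) :
  dov D X -> dov D (fun v : V' -> C => X (v \o h)).
Proof.
move=> [R dR H]; pose j (z : V + D) := match z with inl v => inl (h v) | inr d => inr d end.
exists (fun v => R (v \o j)); first exact: dfn_ren.
move=> x; rewrite H; suff -> : sumv (x \o h) (fun d : D => val d) = sumv x (fun d : D => val d) \o j by [].
by apply: funext => -[].
Qed.

Lemma dov_imp D V (X Y : (V -> C) -> Prop) : dov D X -> dov D Y -> dov D (fun v => X v -> Y v).
Proof.
move=> [R dR hR] [S dS hS]; exists (fun v => R v -> S v); first exact: dfn_imp.
by move=> x; rewrite hR hS.
Qed.

Lemma dov_not D V (X : (V -> C) -> Prop) : dov D X -> dov D (fun v => ~ X v).
Proof. by move=> h; apply: dov_imp => //; apply: dov_dfn; exact: dfn_bot. Qed.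

Lemma dov_and D V (X Y : (V -> C) -> Prop) : dov D X -> dov D Y -> dov D (fun v => X v /\ Y v).
Proof.
move=> [R dR hR] [S dS hS]; exists (fun v => R v /\ S v); first exact: dfn_and.
by move=> x; rewrite hR hS.
Qed.

Lemma dov_ex D V p (X : ('I_p + V -> C) -> Prop) :
  dov D X -> dov D (fun v => exists x : 'I_p -> C, X (sumv x v)).
Proof.
move=> [R dR hR].
pose j (z : ('I_p + V) + D) : 'I_p + (V + D) := match z with
  inl (inl i) => inl i | inl (inr v) => inr (inl v) | inr d => inr (inr d) end.
exists (fun v => exists x : 'I_p -> C, R (sumv x v \o j)).
  by apply: (@dfn_ex _ _ (fun v => R (v \o j))); exact: dfn_ren.
move=> x; have E y : sumv (sumv y x) (fun d : D => val d) = sumv y (sumv x (fun d : D => val d)) \o j.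
  by apply: funext => -[[]|].
by split=> -[y]; [rewrite hR E => h|rewrite -E -hR => h]; exists y.
Qed.

Lemma dov_par D V V' (X : (V + V' -> C) -> Prop) (a : V' -> C) :
  (forall i, D (a i)) -> dov D X -> dov D (fun x => X (sumv x a)).
Proof.
move=> Da [R dR hR].
pose j (z : (V + V') + D) : V + D := match z with
  inl (inl i) => inl i | inl (inr v) => inr (SigSub (mem_set (Da v))) | inr d => inr d end.
exists (fun v => R (v \o j)); first exact: dfn_ren.
move=> x; rewrite hR.
suff -> : sumv (sumv x a) (fun d : D => val d) = sumv x (fun d : D => val d) \o j by [].
by apply: funext => -[[]|].
Qed.

Lemma dov_sat D V n (f : formula L n) (r : 'I_n -> V + D) :
  dov D (fun x : V -> C => sat f (sumv x (fun d : D => val d) \o r)).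
Proof. by exists (fun v => sat f (v \o r)) => //; apply: dfn_ren; exact: dfn_sat. Qed.

Lemma dov_vcat D m k (f : formula L (m + k)) (b : 'I_k -> C) : (forall i, D (b i)) ->
  dov D (fun x : 'I_m -> C => sat f (vcat x b)).
Proof.
move=> Db; pose j (z : 'I_(m + k)) : 'I_m + D :=
  match fintype.split z with inl i => inl i | inr i => inr (SigSub (mem_set (Db i))) end.
apply: dov_ext (dov_sat f j) => x.
have <- // : sumv x (fun d : D => val d) \o j = vcat x b.
by apply: funext => i /=; rewrite /j /vcat; case: fintype.split.
Qed.

Lemma dovP D m (X : ('I_m -> C) -> Prop) : dov D X <->
  exists k (f : formula L (m + k)) (b : 'I_k -> C),
    (forall i, D (b i)) /\ forall x, X x <-> sat f (vcat x b).
Proof.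
split=> [[R [n [f [r Rf]]] XR]|[k [f [b [Db XE]]]]]; last first.
  by apply: dov_ext (dov_vcat f Db) => x; rewrite XE.
have [[d0 Dd0]|nD] := pselect (exists d, D d).
  pose r0 i : 'I_(m + n) := match r i with inl j => lshift n j | inr _ => rshift m i end.
  pose b i := match r i with inl _ => d0 | inr d => val d end.
  exists n, (ren f r0), b; split=> [i|x].
    by rewrite /b; case: (r i) => // d; exact: set_valP.
  rewrite XR Rf sat_ren; suff -> : vcat x b \o r0 = sumv x (fun d : D => val d) \o r by [].
  by apply: funext => i /=; rewrite /r0; case e: (r i) => [j|w]; rewrite (vcatl, vcatr) //= /b e.
have rE i : exists j, r i = inl j.
  by case: (r i) => [j|w]; [exists j|case: nD; exists (val w); exact: set_valP].
have [r0 r0E] := choice rE; pose b (i : 'I_0) : C := match notF (ltn_ord i) with end.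
exists 0, (ren f (fun i => lshift 0 (r0 i))), b; split=> [i|x]; first by case: (notF (ltn_ord i)).
rewrite XR Rf sat_ren; suff -> : vcat x b \o (fun i => lshift 0 (r0 i)) = sumv x (fun d : D => val d) \o r by [].
by apply: funext => i /=; rewrite vcatl r0E.
Qed.

End Definability.

(** * Countability of vocabularies and formulas *)

Lemma absorbing_natT : absorbing nat.
Proof. exact: infinite_absorbing. Qed.

Lemma countable_inj (T U : Type) (A : set T) (f : T -> U) :
  countable [set: U] -> (forall x y, A x -> A y -> f x = f y -> x = y) -> countable A.
Proof. by move=> cU fi; apply: sub_countable cU; exact: fun_card_le fi. Qed.

Lemma countable_range (T U : Type) (f : T -> U) :
  countable [set: T] -> countable (range f).
Proof. by move=> cT; apply: sub_countable cT; exact: card_image_le. Qed.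

Fixpoint formula_code L (c : symb L -> nat) n (f : formula L n) : forest (nat * seq nat) :=
  match f with
  | fEq _ i j => FCons (0, [:: val i; val j]) FNil FNil
  | fRel n R w => FCons (1, c R :: [seq val (w i) | i <- enum 'I_(arity R)]) FNil FNil
  | fBot _ => FNil
  | fImp _ g h => FCons (2, [::]) (formula_code c g) (formula_code c h)
  | fAll _ g => FCons (3, [::]) (formula_code c g) FNil
  end.

Lemma formula_code_inj L (c : symb L -> nat) : injective c ->
  forall n, injective (@formula_code L c n).
Proof.
move=> ci n f; elim: f => [{}n i j|{}n R w|{}n|{}n g IHg h IHh|{}n g IHg] f'.
- move: i j; case: n / f' => //= n i j i' j' [] e e'.
  by rewrite (val_inj e) (val_inj e').
- move: w; case: n / f' => //= n R' w w' [] /ci e; subst R' => /eq_in_map H.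
  congr fRel; apply: funext => i; apply: val_inj; apply: H; exact: mem_enum.
- by case: n / f'.
- move: g IHg h IHh; case: n / f' => //= n g' h' g IHg h IHh [] e e'.
  by rewrite (IHg _ e) (IHh _ e').
- move: g IHg; case: n / f' => //= n g' g IHg [] e.
  by rewrite (IHg _ e).
Qed.

Lemma countable_formula L n : countable [set: symb L] -> countable [set: formula L n].
Proof.
move=> /(card_le_funP 0)[c ci].
have cF : countable [set: forest (nat * seq nat)].
  by apply: card_forest; [exact: absorbing_natT|exact: countableP].
apply: (countable_inj (f := @formula_code L c n)) cF _ => x y _ _.
exact: formula_code_inj.
Qed.

(** A complete theory contains every valid sentence. The one built from [R] by implication from
    falsity is valid, and [R] can be read off from it. *)
Lemma countable_voc L (T : set (sentence L)) :
  complete_theory T -> countable T -> countable [set: symb L].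
Proof.
move=> [[M MT] Tdec] /(card_le_injP 0)[c [_ ci]].
pose s (R : symb L) : sentence L :=
  @fAlls L 0 (arity R) (fImp (fBot L _) (fRel (fun i => lshift 0 i))).
have Ts R : T (s R).
  case: (Tdec (s R)) => // /MT H; case: (H (fun i : 'I_0 => match notF (ltn_ord i) with end)).
  by apply/(@sat_fAlls L M 0 (arity R)) => x [].
have si : injective s.
  pose hd := fix hd n (f : formula L n) : option (symb L) := match f with
    | fRel _ R _ => Some R | fImp _ _ g => hd _ g | fAll _ g => hd _ g | _ => None end.
  have hdE p m (f : formula L (p + m)) : hd m (fAlls f) = hd _ f.
    by elim: p f => //= p IH f; rewrite IH.
  by move=> R R' /(congr1 (hd 0)); rewrite !hdE => -[].
apply: (fun_card_le (f := c \o s)) => R R' _ _ /= e; apply: si; exact: ci.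
Qed.

(** Valid sentences of unbounded depth all belong to [T]. With [T] small, this makes every countable
    set small. *)
Lemma infinite_theory L (T : set (sentence L)) : complete_theory T -> [set: nat] #<= T.
Proof.
move=> [[M MT] Tdec]; pose s k : sentence L := iter k (fun f => fImp f f) (fImp (fBot L 0) (fBot L 0)).
have Ms k v : @sat L M 0 (s k) v by elim: k => //= k IH.
have Ts k : T (s k).
  case: (Tdec (s k)) => // /MT H; case: (H (fun i : 'I_0 => match notF (ltn_ord i) with end)).
  exact: Ms.
apply: (@card_le_inj _ _ _ _ s) => // j k _ _.
pose dp := fix dp n (f : formula L n) : nat :=
  match f with fImp _ g _ => (dp _ g).+1 | _ => 0 end.
have sE i : dp _ (s i) = i.+1 by elim: i => //= i ->.
by move=> /(congr1 (dp 0)); rewrite !sE => -[].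
Qed.

(** * Elementary inclusions of induced structures and of systems *)

(** Both structures restrict relations on the common set [X], so that an elementary inclusion
    becomes agreement of two relativized truth values. Induced substructures and systems are both of
    this form. *)
Lemma elem_incl_satr L X (J1 J2 : forall R : symb L, ('I_(arity R) -> X) -> Prop)
    (D1 D2 : set X) :
  @elem_incl L X (Structure (fun R v => J1 R (fun i => val (v i) : X)) : structure L)
    (@Structure L D2 (fun R v => J2 R (fun i => val (v i)))) (fun x : D1 => val x) (fun x : D2 => val x) <->
  D1 `<=` D2 /\ forall n (f : formula L n) (v : 'I_n -> X), (forall i, D1 (v i)) ->
    (satr J1 D1 f v <-> satr J2 D2 f v).
Proof.
have satE J (D : set X) n (f : formula L n) (v : 'I_n -> D) :
    @sat L (@Structure L D (fun R v => J R (fun i => val (v i)))) n f v <->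
    satr J D f (fun i => val (v i)).
  apply: (@sat_satr L X (@Structure L D (fun R v => J R (fun i => val (v i)))) J D val) => //.
  - by move=> s; exact: (@set_valP _ D s).
  - by move=> x Dx; exists (SigSub (mem_set Dx)).
split=> [[h [hv hE]]|[D12 H]].
  split=> [x D1x|n f v D1v].
    by rewrite -[x]/(val (SigSub (mem_set D1x) : D1)) -hv; exact: set_valP.
  have := hE n f (fun i => SigSub (mem_set (D1v i))); rewrite !satE.
  suff -> : (fun i => val ((h \o (fun i => SigSub (mem_set (D1v i)))) i)) = v by [].
  by apply: funext => i /=; rewrite hv.
exists (fun x : D1 => SigSub (mem_set (D12 _ (set_valP x))) : D2); split=> // n f v.
rewrite !satE; apply: H => i; exact: set_valP.
Qed.

Lemma elem_subP L (C : structure L) (A : set C) : elem_sub A <->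
  forall n (f : formula L n) (v : 'I_n -> C), (forall i, A (v i)) ->
    (satr (@interp L C) A f v <-> sat f v).
Proof.
split=> [H n f v Av|H n f v].
  by have := H n f (fun i => SigSub (mem_set (Av i))); rewrite sat_induced.
rewrite sat_induced; apply: H => i; exact: set_valP.
Qed.

Lemma elem_sub_tv L (C : structure L) (A : set C) :
  (forall n (f : formula L n.+1) (v : 'I_n -> C), (forall i, A (v i)) ->
    (exists x, sat f (vcons x v)) -> exists x, A x /\ sat f (vcons x v)) -> elem_sub A.
Proof.
move=> H; apply/elem_subP => n f v Av; rewrite -satr_setT.
apply: (@tarski_vaught L C (@interp L C) setT A) => // {}n g {Av f}v Av [x [_ nx]].
have [|y [Ay sy]] := H n (fNot g) v Av; first by exists x; move: nx; rewrite satr_setT.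
by exists y; split=> //; rewrite satr_setT.
Qed.

Lemma elem_sub_witness L (C : structure L) (A : set C) n (f : formula L n.+1) (v : 'I_n -> C) :
  elem_sub A -> (forall i, A (v i)) ->
  (exists x, sat f (vcons x v)) -> exists x, A x /\ sat f (vcons x v).
Proof.
move=> /elem_subP hA Av [x sx]; apply: contrapT => nx.
have : sat (fAll (fNot f)) v.
  apply/(hA _ (fAll (fNot f))) => //= y Ay /hA sy; apply: nx; exists y; split => //; apply: sy => i.
  by rewrite /vcons; case: unlift.
by move=> /(_ x sx).
Qed.

Lemma elem_equivP L (C : structure L) (A B : set C) :
  elem_equiv (induced A) (induced B) <->
  forall (f : sentence L) (v : 'I_0 -> C),
    satr (@interp L C) A f v <-> satr (@interp L C) B f v.
Proof.
have hP (D : set C) (f : sentence L) v : holds (induced D) f <-> satr (@interp L C) D f v.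
  have vE (w : 'I_0 -> C) : w = v by apply: funext => -[].
  split=> [/(_ (fun i : 'I_0 => match notF (ltn_ord i) with end))|H w].
    by rewrite sat_induced (vE (fun i => _)).
  by rewrite sat_induced (vE (fun i => _)).
by split=> H f; [move=> v|pose v (i : 'I_0) : C := match notF (ltn_ord i) with end];
   have := H f; [rewrite !(hP _ _ v)|rewrite !(hP _ _ v); apply].
Qed.

Definition system_interp L (C : structure L) (I : set (set nat)) (A : set nat -> set C)
    (R : symb (system_voc L I)) : ('I_(arity R) -> C) -> Prop :=
  match R return ('I_(@arity (system_voc L I) R) -> C) -> Prop with
  | inl R0 => fun v => @interp L C R0 v
  | inr s => fun v => A (val s) (v ord0)
  end.

Lemma system_structE L (C : structure L) (I : set (set nat)) (A : set nat -> set C) :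
  @interp _ (system_struct I A) = (fun R v => system_interp A (fun i => val (v i))).
Proof. by apply: functional_extensionality_dep => -[]. Qed.

Definition system_incl L (C : structure L) (I : set (set nat)) (A1 A2 : set nat -> set C) :=
  @elem_incl _ C (system_struct I A1) (system_struct I A2) val val.

Lemma system_inclP L (C : structure L) (I : set (set nat)) (A1 A2 : set nat -> set C) :
  system_incl I A1 A2 <->
  \bigcup_(s in I) A1 s `<=` \bigcup_(s in I) A2 s /\
  forall n (f : formula (system_voc L I) n) (v : 'I_n -> C),
    (forall i, (\bigcup_(s in I) A1 s) (v i)) ->
    (satr (@system_interp L C I A1) (\bigcup_(s in I) A1 s) f v <->
     satr (@system_interp L C I A2) (\bigcup_(s in I) A2 s) f v).
Proof.
rewrite -elem_incl_satr /system_incl /system_struct.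
(* The interpretations occur inside dependent types; turning them into variables allows
   [system_structE] to be substituted. *)
suff main i1 i2 : i1 = @interp _ (system_struct I A1) -> i2 = @interp _ (system_struct I A2) ->
    forall Q, (@elem_incl _ C (@Structure (system_voc L I) (\bigcup_(s in I) A1 s)
        (fun R v => system_interp A1 (fun i => val (v i))))
      (@Structure (system_voc L I) (\bigcup_(s in I) A2 s)
        (fun R v => system_interp A2 (fun i => val (v i)))) val val <-> Q) ->
    (@elem_incl _ C (@Structure (system_voc L I) (\bigcup_(s in I) A1 s) i1)
      (@Structure (system_voc L I) (\bigcup_(s in I) A2 s) i2) val val <-> Q).
  exact: (main _ _ erefl erefl).
by move=> -> ->; rewrite !system_structE.
Qed.

(** * Reducts of systems to fewer index sets *)

Section Reduct.
Variables (L : vocabulary) (C : structure L) (I I' : set (set nat)) (g : set nat -> set nat).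
Hypothesis gI : forall s, I' s -> I (g s).
Variable ss : seq (set nat).
Hypothesis ssP : forall s, I' s <-> s \in ss.

Let U (A : set nat -> set C) := \bigcup_(s in I) A s.
Let U' (A : set nat -> set C) := \bigcup_(s in I') A (g s).

(** A finite disjunction of the predicates for the sets [A (g s)]; the list [ss] makes it finite. *)
Lemma universe_formula n (i : 'I_n) : exists d : formula (system_voc L I) n,
  forall (A : set nat -> set C) v,
    satr (@system_interp L C I A) (U A) d v <-> U' A (v i).
Proof.
suff H (l : seq (set nat)) : (forall s, s \in l -> I' s) ->
    exists d : formula (system_voc L I) n, forall (A : set nat -> set C) v,
      satr (@system_interp L C I A) (U A) d v <-> exists2 s, s \in l & A (g s) (v i).
  have [|d dE] := H ss; first by move=> s /ssP.
  exists d => A v; rewrite dE; split=> [[s /ssP]|[s /ssP]]; by exists s.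
elim: l => [|s l IH] hl; first by exists (fBot _ n) => A v; split=> [|[]].
have [d dE] := IH (fun t tl => hl t (mem_behead (s := s :: l) tl)).
have I's : I (g s) by apply: gI; apply: hl; exact: mem_head.
pose R : symb (system_voc L I) := inr (SigSub (mem_set I's)).
exists (fImp (fNot (@fRel (system_voc L I) n R (fun _ => i))) d) => A v /=.
rewrite dE; split=> [H|[t]].
  have [As|nAs] := pselect (A (g s) (v i)); first by exists s => //; exact: mem_head.
  by have [t tl At] := H nAs; exists t => //; rewrite inE tl orbT.
by rewrite inE => /predU1P[-> As /(_ As)//|tl At _]; exists t.
Qed.

Lemma reduct_formula n (f : formula (system_voc L I') n) :
  exists f' : formula (system_voc L I) n, forall (A : set nat -> set C) v,
    (forall i, U' A (v i)) ->
    (satr (@system_interp L C I' (A \o g)) (U' A) f v <->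
     satr (@system_interp L C I A) (U A) f' v).
Proof.
elim: f => [{}n i j|{}n R w|{}n|{}n f [f' fE] h [h' hE]|{}n f [f' fE]].
- by exists (fEq _ i j).
- case: R w => [R|s] w; first by exists (@fRel (system_voc L I) n (inl R) w).
  pose R : symb (system_voc L I) := inr (SigSub (mem_set (gI (set_valP s)))).
  by exists (@fRel (system_voc L I) n R w).
- by exists (fBot _ n).
- by exists (fImp f' h') => A v Uv /=; rewrite fE // hE.
- have [d dE] := universe_formula (@ord0 n).
  exists (fAll (fImp d f')) => A v Uv /=.
  have Uc x : U' A x -> forall i, U' A (vcons x v i).
    by move=> Ux i; rewrite /vcons; case: unlift.
  split=> H x; first by move=> _ /dE; rewrite vcons0 => Ux; apply/fE; [exact: Uc|exact: H].
  move=> Ux; apply/fE; first exact: Uc.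
  apply: H; last by apply/dE; rewrite vcons0.
  by have [s I's As] := Ux; exists (g s) => //; exact: gI.
Qed.

(** Quantifying over the smaller system is quantifying over the larger one relativized to a
    definable set, by a formula that is the same for [A1] and [A2]. Hence elementarity descends. *)
Lemma system_incl_reduct (A1 A2 : set nat -> set C) :
  (forall s, I s -> A1 s `<=` A2 s) ->
  system_incl I A1 A2 -> system_incl I' (A1 \o g) (A2 \o g).
Proof.
move=> A12 /system_inclP[_ H]; apply/system_inclP; split.
  by move=> x [s I's As]; exists s => //; apply: A12 => //; exact: gI.
move=> n f v Uv; have [f' fE] := reduct_formula f.
rewrite -/(U' A1) -/(U' A2) !fE //; last first.
  by move=> i; have [s I's As] := Uv i; exists s => //; apply: A12 => //; exact: gI.
apply: H => i; have [s I's As] := Uv i; exists (g s) => //; exact: gI.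
Qed.

End Reduct.

(** * Ultrafilters, and embedding small parts of ultrapowers into the monster *)

Definition ultra (I : Type) (U : set (set I)) :=
  [/\ U setT, ~ U set0, forall A B, A `<=` B -> U A -> U B,
      forall A B, U A -> U B -> U (A `&` B) & forall A, U A \/ U (~` A)].

Section Ultra.
Variables (I : Type) (U : set (set I)).
Hypothesis Uu : ultra U.

Lemma ultraN A : U (~` A) <-> ~ U A.
Proof.
have [_ U0 _ UI UN] := Uu; split=> [UnA UA|nA]; last by case: (UN A).
by apply: U0; rewrite -(setICr A); exact: UI.
Qed.

Lemma ultra_imp A B : U [set i | A i -> B i] -> U A -> U B.
Proof.
have [_ _ US UI _] := Uu => h hA; apply: US (UI _ _ h hA) => i [/= H Ai].
exact: H.
Qed.

Lemma ultra_all A : (forall i, A i) -> U A.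
Proof. by have [UT _ US _ _] := Uu => h; apply: US UT => i _; exact: h. Qed.

Lemma ultra_ex A : U A -> exists i, A i.
Proof.
have [_ U0 US _ _] := Uu => UA; apply: contrapT => nA; apply: U0.
by apply: US UA => i Ai; apply: nA; exists i.
Qed.

Lemma ultra_const (Q : Prop) : U [set _ | Q] <-> Q.
Proof. by split=> [/ultra_ex[]//|q]; exact: ultra_all. Qed.

Lemma ultra_forall_fin n (A : 'I_n -> set I) :
  (forall j, U (A j)) -> U [set i | forall j, A j i].
Proof.
elim: n A => [|n IH] A hA; first by apply: ultra_all => i [].
have [_ _ US UI _] := Uu; apply: US (UI _ _ (hA ord0) (IH _ (fun j => hA (lift ord0 j)))).
by move=> i [A0 AS] j; case: (unliftP ord0 j) => [k|] ->.
Qed.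

End Ultra.

Lemma small_le K (X Y : Type) (A : set X) (B : set Y) : A #<= B -> small K B -> small K A.
Proof.
move=> AB /andP[BK nKB]; apply/andP; split; first exact: card_le_trans BK.
by apply: contra nKB => KA; exact: card_le_trans AB.
Qed.

Section Embedding.
Variables (L : vocabulary) (K : Type) (C : structure L) (C_sat : saturated K C).
Variables (I : Type) (U : set (set I)) (Uu : ultra U).
Variables (V : Type) (Vsmall : small K [set: V]) (va : I -> V -> C).

Let good (G : set (V * C)) := forall R : (G -> C) -> Prop, dfn R ->
  (R (fun w => (val w).2) <-> U [set i | R (fun w => va i (val w).1)]).

Let good_chain (F : set (set (V * C))) : F `<=` good -> total_on F subset ->
  good (\bigcup_(X in F) X).
Proof.
move=> Fg Ft R [n [f [r Rf]]].
(* A formula sees finitely many variables, hence a single member of the chain; if it has no variable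
   there may be no member to choose, as [F] can be empty. *)
have [n0|[X FX Xr]] : n = 0 \/ exists2 X, F X & forall i, X (val (r i)).
  clear Rf f; elim: n r => [|n IH] r; first by left.
  right; have [X0 FX0 X0r] : (\bigcup_(X in F) X) (val (r ord0)) by exact: set_valP.
  have [n0|[X1 FX1 X1r]] := IH (r \o lift ord0).
    subst n; exists X0 => // i; suff -> : i = ord0 by []; exact: ord1.
  have [X01|X10] := Ft _ _ FX0 FX1.
    exists X1 => // i; case: (unliftP ord0 i) => [j|] ->; [exact: X1r|exact: X01].
  exists X0 => // i; case: (unliftP ord0 i) => [j|] ->; [apply: X10; exact: X1r|by []].
- subst n; rewrite Rf -(@ultra_const _ _ Uu (sat f _)).
  set S := (X in U X); set S' := (X in _ <-> U X).
  suff -> : S = S' by [].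
  apply/seteqP; split=> i; rewrite /S /S' /= Rf; congr (sat f _); apply: funext => -[] //.
- have := Fg _ FX (fun v => sat f (fun i => v (SigSub (mem_set (Xr i))))).
  move=> /(_ _)[|H1 H2]; first by exists n, f, (fun i => SigSub (mem_set (Xr i))).
  by rewrite Rf; split=> [/H1|H]; [|apply: H2]; [move=> H|];
    have [_ _ US _ _] := Uu; apply: US H => i; rewrite /= Rf.
Qed.

(** This embeds the part of the ultrapower named by [V] into the saturated [C], with the theorem of
    Los as conclusion. A maximal good graph is total: the formulas that hold almost surely of a
    further point are finitely satisfiable over the small range of the graph. *)
Lemma ultra_embedding : exists e : V -> C, forall R : (V -> C) -> Prop, dfn R ->
  (R e <-> U [set i | R (va i)]).
Proof.
have [G [Ggood Gmax]] := Zorn_bigcup good_chain.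
pose W : Type := G.
(* Equality is a definable relation, so a good graph is automatically functional. *)
have Gfun v c c' : G (v, c) -> G (v, c') -> c = c'.
  move=> g g'; pose w := SigSub (mem_set g) : G; pose w' := SigSub (mem_set g') : G.
  have := Ggood (fun x => x w = x w'); case.
    exists 2, (fEq L ord0 (lift ord0 ord0)), (vcons w (fun=> w')) => x /=.
    by rewrite vcons0 vconsS.
  by move=> _; apply; apply: (ultra_all Uu).
have Gtot v0 : exists c, G (v0, c).
  apply: contrapT => nG; pose A := [set c | exists v, G (v, c)].
  have Asmall : small K A.
    apply: small_le Vsmall; apply: (card_le_rel (R := fun c v => G (v, c))) => [c [v]|c c' v _ _].
      by exists v.
    exact: Gfun.
  pose at_ i : 'I_1 + W -> C := sumv (fun _ => va i v0) (fun w => va i (val w).1).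
  pose cur x : 'I_1 + W -> C := sumv x (fun w : W => (val w).2).
  (* The type that a value at [v0] must realize over the values already assigned. *)
  pose p := [set th : pformula C 1 | params th `<=` A /\ exists X : ('I_1 + W -> C) -> Prop,
    [/\ dfn X, U [set i | X (at_ i)] & forall x, psat th x <-> X (cur x)]].
  have pX X : dfn X -> U [set i | X (at_ i)] -> exists2 th, p th & forall x, psat th x <-> X (cur x).
    move=> dX UX; have : dov A (fun x : 'I_1 -> C => X (cur x)).
      apply: dov_par; last exact: dov_dfn.
      by move=> w; exists (val w).1; rewrite -surjective_pairing; exact: set_valP.
    move=> /dovP[k [f [b [Ab fE]]]]; exists (PFormula f b); last by move=> x; rewrite fE.
    by split=> [c [i _ <-]//|]; exists X; split=> // x; rewrite fE.
  have [x xp] : exists x, forall th, p th -> psat th x.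
    apply: (C_sat Asmall) => [th []//|q qfin qp].
    have [X [dX UX XE]] : exists X : ('I_1 + W -> C) -> Prop,
      [/\ dfn X, U [set i | X (at_ i)] & forall x, X (cur x) -> forall th, q th -> psat th x].
      have /(@finite_seqP {classic (pformula C 1)})[s qE] := qfin.
      move: qp; rewrite qE {qE qfin q}; elim: s => [|th s IH] sp.
        exists (fun _ => ~ False); split=> //; first by apply: dfn_not; exact: dfn_bot.
        by apply: (ultra_all Uu) => i [].
      have [|X [dX UX XE]] := IH; first by move=> t /= ts; apply: sp; rewrite /= inE ts orbT.
      have [_ [Y [dY UY YE]]] := sp th (mem_head _ _).
      exists (fun v => X v /\ Y v); split; [exact: dfn_and|by have [_ _ _ UI _] := Uu; exact: UI|].
      move=> x [Xx Yx] t /=; rewrite inE => /predU1P[->|]; first exact/YE.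
      exact: XE.
    have := Ggood _ (dfn_ex dX); case=> _ /(_ _)[|x Xx]; last by exists x; exact: XE.
    have [_ _ US _ _] := Uu; apply: US UX => i /= Xi; by exists (fun=> va i v0).
  pose G' := G `|` [set (v0, x ord0)].
  apply: (Gmax G'); first by split; [left|move=> /(_ (v0, x ord0))]; [
    |move=> h; apply: nG; exists (x ord0); apply: h; right].
  move=> R [n [f [r Rf]]].
  have /choice[r' r'P] : forall i, exists z : 'I_1 + W, match z with
      inl _ => val (r i) = (v0, x ord0) | inr w => val w = val (r i) end.
    move=> i; have [Gi|Ei] : G' (val (r i)) by exact: set_valP.
      by exists (inr (SigSub (mem_set Gi))).
    by exists (inl ord0).
  pose X (v : 'I_1 + W -> C) := sat f (v \o r').
  have dX : @dfn L C _ X by apply: dfn_ren; exact: dfn_sat.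
  have XE1 : R (fun w => (val w).2) <-> X (cur x).
    rewrite Rf /X; suff -> : (fun w : G' => (val w).2) \o r = cur x \o r' by [].
    apply: funext => i /=; have := r'P i; case: (r' i) => [j|w] /= ->//.
    by rewrite (ord1 j).
  have XE2 : [set i | R (fun w => va i (val w).1)] = [set i | X (at_ i)].
    apply/seteqP; split=> i /=; rewrite Rf /X;
      suff -> : (fun w : G' => va i (val w).1) \o r = at_ i \o r' by [];
      by apply: funext => j /=; have := r'P j; case: (r' j) => [k|w] /= ->.
  rewrite XE1 XE2; split=> [Xx|UX].
    apply: contrapT => /(ultraN Uu) nUX.
    have [th pth thE] := pX _ (dfn_not dX) nUX.
    by have /thE := xp _ pth.
  by have [th pth thE] := pX _ dX UX; apply/thE; exact: xp.
have [e eP] := choice Gtot; exists e => R dR.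
have := Ggood (fun x => R (fun v => x (SigSub (mem_set (eP v))))); apply.
exact: dfn_ren dR.
Qed.

End Embedding.

Lemma card_sub_le (X : Type) (A : set X) : [set: A] #<= A.
Proof.
by apply: (@card_le_inj _ _ _ _ val) => [x _|x y _ _ /val_inj//]; exact: set_valP.
Qed.

(** The ultrafilter of a compactness argument: any given requirement is on almost every finite
    list. *)
Lemma ultra_of_cones (R : eqType) : exists U : set (set (seq R)),
  ultra U /\ forall r : R, U [set i | r \in i].
Proof.
pose cone (l : seq R) := [set i : seq R | {subset l <= i}].
pose F := [set A | exists l, cone l `<=` A].
have FF : filter.ProperFilter F.
  apply: filter.Build_ProperFilter_ex.
    by move=> A [l lA]; exists l; apply: lA.
  split; first by exists [::].
    move=> A B [l lA] [l' lB]; exists (l ++ l') => i li; split.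
      by apply: lA => x xl; apply: li; rewrite mem_cat xl.
    by apply: lB => x xl; apply: li; rewrite mem_cat xl orbT.
  by move=> A B AB [l lA]; exists l; apply: subset_trans AB.
have [U [UU FU]] := filter.ultraFilterLemma FF; exists U; split; last first.
  by move=> r; apply: FU; exists [:: r] => i; apply; exact: mem_head.
split; [exact: filter.filterT|exact: filter.filter_not_empty| | |].
- by move=> A B; exact: filter.filterS.
- by move=> A B; exact: filter.filterI.
- by move=> A; exact: filter.in_ultra_setVsetC.
Qed.

Lemma ultra_exists_fin (I : Type) (U : set (set I)) n (A : 'I_n -> set I) : ultra U ->
  U [set i | exists j, A j i] -> exists j, U (A j).
Proof.
move=> Uu UA; apply: contrapT => /forallNP nA.
have := ultra_forall_fin Uu (fun j => proj2 (ultraN Uu _) (nA j)).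
move=> h; have [_ _ _ UI _] := Uu.
by have [i [[j Aj] /(_ j)]] := ultra_ex Uu (UI _ _ UA h).
Qed.

Lemma max_in_list (W : Type) (lt : W -> W -> Prop) (R : eqType) (f : R -> W)
    (Q : R -> Prop) (l : seq R) : well_ordered lt ->
  (exists2 r, r \in l & Q r) ->
  exists r, [/\ r \in l, Q r & forall s, s \in l -> Q s -> lt (f s) (f r) \/ f s = f r].
Proof.
move=> wo; have [_ tr _] := wo; elim: l => [|x l IH] [r rl Qr]; first by [].
have [h|nh] := pselect (exists2 r, r \in l & Q r); last first.
  exists x; have xE s : s \in x :: l -> Q s -> s = x.
    by rewrite inE => /predU1P[//|sl Qs]; case: nh; exists s.
  split; [exact: mem_head|by rewrite -(xE _ rl Qr)|].
  by move=> s sl /(xE _ sl) ->; right.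
have [y [yl Qy ymax]] := IH h.
have [Qx|nQx] := pselect (Q x); last first.
  exists y; split=> //; first by rewrite inE yl orbT.
  by move=> s; rewrite inE => /predU1P[->//|]; exact: ymax.
have [xy|xy|yx] := wo_total wo (f x) (f y).
- exists y; split=> //; first by rewrite inE yl orbT.
  by move=> s; rewrite inE => /predU1P[->|]; [left|exact: ymax].
- exists y; split=> //; first by rewrite inE yl orbT.
  by move=> s; rewrite inE => /predU1P[->|]; [right|exact: ymax].
- exists x; split=> //; first exact: mem_head.
  move=> s; rewrite inE => /predU1P[->|sl Qs]; first by right.
  by left; have [sy|->] := ymax s sl Qs => //; apply: tr yx.
Qed.

(** * Definable sets over complete sets *)

Lemma dfn_predicate L (P : symb L) (C : structure L) (V : Type) (v : V) :
  @dfn L C V (fun x => predicate P C (x v)).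
Proof. by exists 1, (fRel (fun _ : 'I_(arity P) => ord0)), (fun=> v). Qed.

Lemma complete_dov L (P : symb L) (C : structure L) (A : set C) m (X : ('I_m -> C) -> Prop) :
  complete_set P A -> dov A X ->
  (exists x, (forall i, predicate P C (x i)) /\ X x) ->
  exists a, (forall i, (predicate P C `&` A) (a i)) /\ X a.
Proof.
move=> hA /dovP[k [f [b [Ab fE]]]] [x [Px Xx]].
have [|a [Pa sa]] := hA m k f b Ab; first by exists x; split => //; apply/fE.
by exists a; split => //; apply/fE.
Qed.

(** If some point of [X] has no solution in [P], the points without one form [Y]. Otherwise
    completeness of [E] gives a tuple [y] in [P] and [E] that solves the instance for some point of
    [X], and [Y] consists of the points it serves. Settling all such questions keeps [E] complete
    when a point is added, with no new element of [P]. *)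
Lemma decide_witness L (P : symb L) (C : structure L) (E : set C) m m' l
    (X : ('I_m -> C) -> Prop) (psi : formula L (m' + (m + l))) (a : 'I_l -> C) :
  complete_set P E -> dov E X -> (exists x, X x) -> (forall i, E (a i)) ->
  exists Y, [/\ dov E Y, exists x, Y x, forall x, Y x -> X x &
    (forall x, Y x -> ~ exists y : 'I_m' -> C, (forall i, predicate P C (y i)) /\
       sat psi (vcat y (vcat x a))) \/
    exists y : 'I_m' -> C, (forall i, (predicate P C `&` E) (y i)) /\
      forall x, Y x -> sat psi (vcat y (vcat x a))].
Proof.
move=> E_complete dX [x0 Xx0] Ea; pose PC := predicate P C.
pose psi' (y : 'I_m' -> C) (x : 'I_m -> C) := sat psi (vcat y (vcat x a)).
have dpsi : dov E (fun z : 'I_m' + 'I_m -> C => psi' (z \o inl) (z \o inr)).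
  pose r (z : 'I_(m' + (m + l))) : ('I_m' + 'I_m) + 'I_l :=
    match fintype.split z with inl i => inl (inl i) | inr z' =>
      match fintype.split z' with inl i => inl (inr i) | inr i => inr i end end.
  apply: (@dov_ext _ _ _ _ (fun z => sat psi (sumv z a \o r))).
    move=> z; rewrite /psi'; have <- // : sumv z a \o r =
      vcat (z \o inl) (vcat (z \o inr) a).
    apply: funext => i; rewrite /r /vcat /=.
    by case: (fintype.split i) => // z'; case: (fintype.split z').
  apply: (@dov_par _ _ E _ _ (fun u => sat psi (u \o r))); first by move=> i; exact: Ea.
  by apply: dov_dfn; apply: dfn_ren; exact: dfn_sat.
have dP V n (g : 'I_n -> V) : dov E (fun z : V -> C => forall i, PC (z (g i))).
  by apply: dov_dfn; apply: dfn_forall_fin => i; exact: dfn_predicate.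
pose X1 x := exists y : 'I_m' -> C, (forall i, PC (y i)) /\ psi' y x.
have dX1 : dov E X1.
  apply: (@dov_ex _ _ E _ m' (fun z => (forall i, PC (z (inl i))) /\ psi' (z \o inl) (z \o inr))).
  exact: dov_and.
have [[x [Xx nX1]]|nX] := pselect (exists x, X x /\ ~ X1 x).
  exists (fun x => X x /\ ~ X1 x); split=> [||z []//|]; last by left => z [].
    by apply: dov_and => //; exact: dov_not.
  by exists x.
have [||y [Ey [x [Xx psix]]]] := @complete_dov _ P _ E m' (fun y => exists x, X x /\ psi' y x) E_complete.
- apply: (@dov_ex _ _ E _ m (fun z => X (z \o inl) /\ psi' (z \o inr) (z \o inl))).
  apply: dov_and; first exact: dov_ren.
  pose sw (z : 'I_m' + 'I_m) : 'I_m + 'I_m' := match z with inl i => inr i | inr i => inl i end.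
  exact: (dov_ren sw dpsi).
- have : X1 x0 by apply: contrapT => n1; apply: nX; exists x0.
  by move=> [y [Py py]]; exists y; split=> //; exists x0.
exists (fun x => X x /\ psi' y x); split=> [||z []//|]; last first.
- by right; exists y; split=> // z [].
- by exists x.
apply: dov_and => //; pose sw (z : 'I_m' + 'I_m) : 'I_m + 'I_m' := match z with inl i => inr i | inr i => inl i end.
apply: (@dov_par _ _ E _ _ (fun z => psi' (z \o inr) (z \o inl))); first by move=> i; case: (Ey i).
exact: (dov_ren sw dpsi).
Qed.

(** ** Density of locally isolated types *)

(* Were isolation to fail below [X0], every condition (nonempty set definable over
   E, contained in [X0]) would split along f and could still be extended so as to
   respect completeness.  A tree of conditions of height [W0], where [2 ^ W0]
   exceeds the continuum but [2 ^ w] does not for [w < W0], then lives on a set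
   elementarily equivalent to B, of size at most the continuum, with [2 ^ W0] types
   in [S_star]: stability fails. *)
Section Density.
Variables (L : vocabulary) (P : symb L) (T : set (sentence L)) (K : Type) (C : structure L).
Hypothesis (T_complete : complete_theory T) (T_countable : countable T).
Hypothesis (C_sat : saturated K C) (reals_small : small K [set: set (nat -> bool)]).
Variables (B : set C) (mc : nat) (c : 'I_mc -> C).
Let E := B `|` range c.
Let PC := predicate P C.
Hypothesis (B_stable : stable P T K B) (E_complete : complete_set P E).
Hypothesis PE : PC `&` E `<=` B.
Variables (e0 : C) (Be0 : B e0).
Variables (m : nat) (X0 : ('I_m -> C) -> Prop) (k : nat) (f : formula L (m + k)).

Let cond (X : ('I_m -> C) -> Prop) :=
  [/\ dov E X, exists x, X x & forall x, X x -> X0 x].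
Let half (X : ('I_m -> C) -> Prop) (b : 'I_k -> C) (t : Prop) x :=
  X x /\ (t <-> sat f (vcat x b)).

Hypothesis X0_cond : cond X0.
Variable beta : (('I_m -> C) -> Prop) -> 'I_k -> C.
Hypothesis E_beta : forall X j, E (beta X j).
Hypothesis beta_split : forall X t, cond X -> cond (half X (beta X) t).

Let Ee0 : E e0. Proof. by left. Qed.

(** Formulas psi(y, x, a): [y] is sought in [P], [x] is the point to be added, and [a] consists of
    parameters from [E]. *)
Let Qd := {m' : nat & {l : nat & formula L (m' + (m + l))}}.

(** The sequences [a] and [y] are infinite so that their types do not depend on the query. *)
Let dec (X : ('I_m -> C) -> Prop) (q : Qd) (a : nat -> C) :=
  let: existT m' (existT l psi) := q in
  (forall x, X x -> ~ exists y : 'I_m' -> C, (forall i, PC (y i)) /\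
     sat psi (vcat y (vcat x (fun i : 'I_l => a i)))) \/
  exists y : nat -> C, (forall i, i < m' -> (PC `&` E) (y i)) /\
     forall x, X x -> sat psi (vcat (fun i : 'I_m' => y i) (vcat x (fun i : 'I_l => a i))).

Let dec_sub (X Y : ('I_m -> C) -> Prop) q a : (forall x, Y x -> X x) -> dec X q a -> dec Y q a.
Proof.
case: q => m' [l psi] YX [h|[y [Ey h]]]; first by left => x /YX; exact: h.
by right; exists y; split=> // x /YX; exact: h.
Qed.

Let cond_dec X q a : cond X -> (forall i, E (a i)) ->
  exists Y, [/\ cond Y, forall x, Y x -> X x & dec Y q a].
Proof.
case: q => m' [l psi] [dX neX XX0] Ea.
have [Y [dY neY YX decY]] := @decide_witness _ P _ E m m' l X psi (fun i => a i) E_complete dX neX (fun i => Ea i).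
exists Y; split=> //; first by split=> // x /YX/XX0.
case: decY => [|[y [Ey h]]]; [by left|right].
exists (fun i => if insub i is Some j then y j else e0).
have yE : (fun i : 'I_m' => if insub (val i) is Some j then y j else e0) = y.
  by apply: funext => i; rewrite valK.
by split=> [i im|z]; [rewrite insubT|rewrite yE; exact: h].
Qed.

Let wit_spec (X : ('I_m -> C) -> Prop) (q : Qd) (a : nat -> C) : exists y : nat -> C, (forall i, E (y i)) /\
  (let: existT m' (existT l psi) := q in
   (exists y : nat -> C, (forall i, i < m' -> (PC `&` E) (y i)) /\
     forall x, X x -> sat psi (vcat (fun i : 'I_m' => y i) (vcat x (fun i : 'I_l => a i)))) ->
   (forall i, i < m' -> PC (y i)) /\
     forall x, X x -> sat psi (vcat (fun i : 'I_m' => y i) (vcat x (fun i : 'I_l => a i)))).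
Proof.
case: q => m' [l psi]; match goal with |- exists y, _ /\ (?Q -> _) => have [[y [Ey h]]|n] := pselect Q end.
  exists (fun i => if i < m' then y i else e0); split=> [i|_].
    by case: ifP => // im; case: (Ey _ im).
  split=> [i im|x Xx]; first by rewrite im; case: (Ey _ im).
  have -> : (fun i : 'I_m' => if i < m' then y i else e0) = (fun i : 'I_m' => y i).
    by apply: funext => i; rewrite ltn_ord.
  exact: h.
by exists (fun=> e0); split=> // /n.
Qed.

Let wit (p : (('I_m -> C) -> Prop) * Qd * (nat -> C)) : nat -> C :=
  sval (cid (wit_spec p.1.1 p.1.2 p.2)).

(** Skolem functions of the substructure on [B], in the form of counterexamples. *)
Let skolem_spec (s : {n : nat & formula L n.+1}) (a : nat -> C) : exists x, B x /\
  let: existT n g := s in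
  (exists x, B x /\ ~ satr (@interp L C) B g (vcons x (fun i : 'I_n => a i))) ->
  ~ satr (@interp L C) B g (vcons x (fun i : 'I_n => a i)).
Proof.
case: s => n g; match goal with |- exists y, _ /\ (?Q -> _) => have [[x [Bx h]]|h] := pselect Q end.
  by exists x.
by exists e0; split=> // /h.
Qed.

Let skolem s a : C := sval (cid (skolem_spec s a)).

Variables (lt : (nat -> bool) -> (nat -> bool) -> Prop) (W0 : set (nat -> bool)).
Hypothesis wo : well_ordered lt.
Hypothesis W0_seg : forall w, W0 w ->
  [set X : set (nat -> bool) | X `<=` [set z | lt z w]] #<= [set: nat -> bool].
Hypothesis W0_big : ~ ([set X : set (nat -> bool) | X `<=` W0] #<= [set: nat -> bool]).
Hypothesis W0_limit : forall w, W0 w -> exists2 v, W0 v & lt w v.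
Hypothesis W0_nonempty : W0 !=set0.

Let Lam := nat -> bool.
(** A node is a branch cut off at a level of [W0]: this level and the set of lower levels where the
    branch takes the positive half. *)
Let ND := [set p : Lam * set Lam | W0 p.1 /\ p.2 `<=` [set z | lt z p.1]].
Let Nd : Type := ND.
Let lev (x : Nd) : Lam := (val x).1.
Let anc (x y : Nd) := lt (lev x) (lev y) /\ (val x).2 = (val y).2 `&` [set z | lt z (lev x)].
Let bit (x y : Nd) : Prop := (val y).2 (lev x).
(** Labels of the terms that generate the new set: the constants [c], the Skolem functions of [B],
    and for each node its splitting parameters and the solutions it provides. A term has a value
    once conditions [F] are given at the nodes. *)
Let Lab : Type := (('I_mc + {n : nat & formula L n.+1}) + Nd * ('I_k + Qd * nat))%type.

Let value (F : Nd -> ('I_m -> C) -> Prop) (l : Lab) (a : seq C) : C :=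
  match l with
  | inl (inl j) => c j
  | inl (inr s) => skolem s (nth e0 a)
  | inr (x, inl j) => beta (F x) j
  | inr (x, inr (q, j)) => wit (F x, q, nth e0 a) j
  end.

Let Fixpoint ev (F : Nd -> ('I_m -> C) -> Prop) (s : forest Lab) : seq C :=
  if s is FCons l a b then value F l (ev F a) :: ev F b else [::].

Let tm : Type := (Lab * forest Lab)%type.
Let tval F (t : tm) : C := value F t.1 (ev F t.2).

Let value_E F l a : E (value F l a).
Proof.
case: l => [[j|s]|[x [j|[q j]]]] /=; [by right; exists j| |exact: E_beta|].
  by left; rewrite /skolem; case: cid => z [].
by rewrite /wit; case: cid => z [].
Qed.

Let ev_E F s i : E (nth e0 (ev F s) i).
Proof.
elim: s i => [|l a _ b IH] i; first by rewrite nth_nil.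
by case: i => [|i] /=; [exact: value_E|exact: IH].
Qed.

(** Such a forest can be evaluated before the conditions at level [w] are chosen. *)
Let Fixpoint below (w : Lam) (s : forest Lab) : Prop :=
  if s is FCons l a b then
    [/\ if l is inr (x, _) then lt (lev x) w else True, below w a & below w b]
  else True.

Let ev_ext F G w s : (forall x, lt (lev x) w -> F x = G x) -> below w s -> ev F s = ev G s.
Proof.
move=> FG; elim: s => [|l a IHa b IHb] //= [lw /IHa -> /IHb ->]; congr (_ :: _).
by case: l lw => // -[x [j|[q j]]] /FG /= ->.
Qed.

Let below_up v w s : lt v w -> below v s -> below w s.
Proof.
have [_ tr _] := wo; move=> vw; elim: s => [|l a IHa b IHb] //= [lw /IHa ? /IHb ?].
by split=> //; case: l lw => // -[x _] lx; apply: tr vw.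
Qed.

Let W0_max v w : W0 v -> W0 w -> exists u, [/\ W0 u, lt v u & lt w u].
Proof.
have [_ tr _] := wo => Wv Ww; have [vw|<-|wv] := wo_total wo v w.
- by have [u Wu wu] := W0_limit Ww; exists u; split=> //; apply: tr wu.
- by have [u Wu vu] := W0_limit Wv; exists u.
- by have [u Wu vu] := W0_limit Wv; exists u; split=> //; apply: tr vu.
Qed.

Let below_ex s : exists2 w, W0 w & below w s.
Proof.
elim: s => [|l a [v Wv av] b [w Ww bw]]; first by have [w Ww] := W0_nonempty; exists w.
have [u [Wu vu wu]] := W0_max Wv Ww.
have [x Wx xl] : exists2 x, W0 x & if l is inr (y, _) then lt (lev y) x else True.
  case: l => [_|[y _]]; first by exists u.
  have [Wy _] := set_valP y; exact: W0_limit.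
have [z [Wz uz xz]] := W0_max Wu Wx; have [_ tr _] := wo.
exists z => //=; split; last by apply: below_up bw; apply: tr uz.
  by case: l xl => // -[y _] yx; apply: tr xz.
by apply: below_up av; apply: tr uz.
Qed.

Let tuple_forest n (t : 'I_n -> tm) : exists s, forall F (i : 'I_n), nth e0 (ev F s) i = tval F (t i).
Proof.
elim: n t => [|n IH] t; first by exists FNil => F [].
have [s sE] := IH (t \o lift ord0); exists (FCons (t ord0).1 (t ord0).2 s) => F i.
by case: (unliftP ord0 i) => [j|] -> //; rewrite lift0 /= sE.
Qed.

Let Req : eqType := {classic (Nd * (Qd * forest Lab))%type}.

(** Only nodes on the finite list [i] constrain [Y]. An infinite decreasing sequence of conditions
    need not contain a condition, so limit levels are reached through finite lists and an
    ultrapower. *)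
Let spec (i : seq Req) (prev : Nd -> ('I_m -> C) -> Prop) (x : Nd) (Y : ('I_m -> C) -> Prop) :=
  [/\ cond Y,
      forall r : Req, r \in i -> anc r.1 x ->
        forall z, Y z -> half (prev r.1) (beta (prev r.1)) (bit r.1 x) z
    & forall r : Req, r \in i -> r.1 = x -> dec Y r.2.1 (nth e0 (ev prev r.2.2))].

(** The listed ancestors of [x] form a finite chain. The prescribed half of the condition at the
    highest one lies in the halves prescribed at the others, and finitely many decisions then shrink
    it. *)
Let conditions i : exists F : Nd -> ('I_m -> C) -> Prop, forall x,
  spec i (fun y => if `[< lt (lev y) (lev x) >] then F y else X0) x (F x).
Proof.
have [irr tr _] := wo.
have chs p : exists Y, (exists Y, spec i p.1 p.2 Y) -> spec i p.1 p.2 Y.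
  have [[Y hY]|h] := pselect (exists Y, spec i p.1 p.2 Y); first by exists Y.
  by exists X0 => /h.
have [ch chP] := choice chs.
have [F FE] := wo_recursion wo (fun _ : Nd => X0)
  (fun F w x => ch (fun y => F (lev y) y, x)).
exists (fun x => F (lev x) x) => x0.
suff main w x : lev x = w ->
  spec i (fun y => if `[< lt (lev y) (lev x) >] then F (lev y) y else X0) x (F (lev x) x) by exact: main erefl.
elim/(well_founded_induction (wo_wf wo)): w x => w IH x lx.
set prev := fun y => _.
have -> : F (lev x) x = ch (prev, x).
  rewrite {1}FE; congr (ch (_, x)); apply: funext => y; rewrite /prev.
  by case: asboolP.
have prevE y : lt (lev y) (lev x) -> prev y = F (lev y) y.
  by rewrite /prev; case: asboolP.
apply: (chP (prev, x)) => /=.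
have [Y0 [cY0 hY0]] : exists Y0, cond Y0 /\ forall r : Req, r \in i -> anc r.1 x ->
    forall z, Y0 z -> half (prev r.1) (beta (prev r.1)) (bit r.1 x) z.
  have [h|nh] := pselect (exists2 r : Req, r \in i & anc r.1 x); last first.
    by exists X0; split=> // r ri rx; case: nh; exists r.
  have [r [ri [rx1 rx2] rmax]] := max_in_list (fun r : Req => lev r.1) wo h.
  have [cr hr _] := IH (lev r.1) (eq_ind _ (fun w => lt (lev r.1) w) rx1 _ lx) r.1 erefl.
  exists (half (prev r.1) (beta (prev r.1)) (bit r.1 x)); rewrite prevE //; split.
    exact: beta_split.
  move=> s si sx z zh; have [sr|sr] := rmax s si sx; last first.
    suff -> : s.1 = r.1 by rewrite prevE.
    apply: val_inj; rewrite [LHS]surjective_pairing [RHS]surjective_pairing.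
    by congr pair => //; rewrite rx2 -sr; case: sx.
  have asr : anc s.1 r.1.
    split=> //; case: sx => _ ->; rewrite rx2 -setIA; congr (_ `&` _).
    apply/seteqP; split=> u /= => [us|[]//]; split=> //; exact: tr sr.
  have [zF _] := zh; have := hr s si asr z zF; rewrite /= asboolT // prevE; last by case: sx.
  suff -> : bit s.1 r.1 = bit s.1 x by [].
  by apply/propext; rewrite /bit rx2; split=> [[]|].
pose Q (j : seq Req) := exists Y, [/\ cond Y, forall z, Y z -> Y0 z &
  forall r : Req, r \in j -> r.1 = x -> dec Y r.2.1 (nth e0 (ev prev r.2.2))].
have : Q i.
  elim: (i) => [|r j [Y [cY YY0 hY]]]; first by exists Y0.
  have [Z [cZ ZY dZ]] := cond_dec r.2.1 cY (ev_E prev r.2.2).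
  exists Z; split=> // [z /ZY/YY0//|s]; rewrite inE => /predU1P[-> _ //|sj sx].
  by apply: dec_sub ZY _; exact: hY.
move=> [Y [cY YY0 hY]]; exists Y; split=> // r ri rx z /YY0; exact: hY0.
Qed.

Let no_max_node (X : set Lam) (w : Lam) : W0 w ->
  ND (w, X `&` [set z | lt z w]).
Proof. by move=> Ww; split=> //= z []. Qed.

Let node X w (Ww : W0 w) : Nd := SigSub (mem_set (no_max_node X Ww)).

Let val_node X w (Ww : W0 w) : val (node X Ww) = (w, X `&` [set z | lt z w]).
Proof. by []. Qed.

Let anc_node X v w (Wv : W0 v) (Ww : W0 w) : lt v w -> anc (node X Wv) (node X Ww).
Proof.
have [_ tr _] := wo => vw; split; first by rewrite /lev !val_node.
rewrite !val_node /= -setIA; congr (_ `&` _); apply/seteqP; split=> u /= => [uv|[]//].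
by split=> //; apply: tr vw.
Qed.

Lemma too_many_types : False.
Proof.
have [irr tr _] := wo.
have [U [Uu Ucone]] := ultra_of_cones Req.
have [Fi FiP] := choice conditions.
have Fcond i x : cond (Fi i x) by have [] := FiP i x.
pose q0 : Qd := existT _ 0 (existT _ 0 (fBot L _)).
pose mention x : Req := (x, (q0, FNil)).
have Fanc i x y (r : Req) : anc x y -> r \in i -> r.1 = x ->
    forall z, Fi i y z -> half (Fi i x) (beta (Fi i x)) (bit x y) z.
  move=> xy ri rx z Fz; have [_ /(_ r ri) h _] := FiP i y.
  have := h _ z Fz; rewrite rx => /(_ xy).
  by rewrite asboolT //; case: xy.
have Fdec x q a : below (lev x) a -> U [set i | dec (Fi i x) q (nth e0 (ev (Fi i) a))].
  move=> ba; have [_ _ US _ _] := Uu; apply: US (Ucone (x, (q, a))) => i /= ri.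
  have [_ _ /(_ _ ri erefl) /=] := FiP i x.
  suff -> : ev (fun y => if `[< lt (lev y) (lev x) >] then Fi i y else X0) a = ev (Fi i) a by [].
  by apply: (@ev_ext _ _ (lev x)) => // y yx; rewrite asboolT.
pose Br := [set X : set Lam | X `<=` W0].
(* Along the branch [X], the condition at the highest listed node is contained in those at the lower
   listed nodes. *)
have pt_ex (p : seq Req * set Lam) : exists z, forall w (Ww : W0 w) (r : Req),
    r \in p.1 -> r.1 = node p.2 Ww -> Fi p.1 (node p.2 Ww) z.
  case: p => i X /=; pose Q (r : Req) := exists w (Ww : W0 w), r.1 = node X Ww.
  have [h|nh] := pselect (exists2 r : Req, r \in i & Q r); last first.
    have [_ [z _] _] := X0_cond; exists z => w Ww r ri rx.
    by case: nh; exists r => //; exists w, Ww.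
  have [r [ri [w [Ww rw]] rmax]] := max_in_list (fun r : Req => lev r.1) wo h.
  have [_ [z Fz] _] := Fcond i (node X Ww); exists z => v Wv s si sv.
  have [|vw|vw] := rmax s si; first by exists v, Wv.
    have sr : anc (node X Wv) (node X Ww) by apply: anc_node; move: vw; rewrite sv rw.
    by have [] := Fanc i _ _ s sr si sv z Fz.
  have vw' : v = w by move: vw; rewrite sv rw.
  by subst v; rewrite (Prop_irrelevance Wv Ww).
have [pt ptP] := choice pt_ex.
have Fpt X w (Ww : W0 w) : U [set i | Fi i (node X Ww) (pt (i, X))].
  have [_ _ US _ _] := Uu; apply: US (Ucone (mention (node X Ww))) => i /= ri.
  exact: (ptP (i, X) w Ww _ ri erefl).
(* One variable for each term and an [m]-tuple for each branch; the branches are sets of reals,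
   whence the demand [reals_small]. *)
pose V : Type := (tm + set Lam * 'I_m)%type.
pose va i : V -> C := fun v => match v with inl t => tval (Fi i) t | inr p => pt (i, p.1) p.2 end.
have Lam_abs : absorbing Lam by exact: absorbing_reals.
have cL : countable [set: symb L] by exact: countable_voc T_complete T_countable.
have cF : forall n, countable [set: formula L n] by move=> n; exact: countable_formula.
have card_sig (Y : nat -> Type) (Q : Type) : absorbing Q ->
    (forall n, [set: Y n] #<= [set: Q]) -> [set: {n : nat & Y n}] #<= [set: Q].
  move=> Qa hY; have -> : [set: {n : nat & Y n}] = \bigcup_(n in [set: nat]) range (existT Y n).
    by apply/seteqP; split=> // -[n y] _; exists n => //; exists y.
  apply: absorbing_bigcup => // [|n _]; first by case: Qa.
  by apply: card_le_trans (card_image_le _ _) (hY n).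
have ND_le : [set: Nd] #<= [set: Lam].
  apply: (@card_le_trans _ _ _ ND); first exact: card_sub_le.
  have -> : ND = \bigcup_(w in W0) [set p | p.1 = w /\ p.2 `<=` [set z | lt z w]].
    apply/seteqP; split=> [p [Wp h]|p [w Ww [pw h]]]; first by exists p.1.
    by split; rewrite pw.
  apply: absorbing_bigcup => // [|w Ww]; first exact: card_leT.
  apply: card_le_trans (W0_seg Ww).
  apply: (@card_le_inj _ _ _ _ snd) => [p []//|[a b] [a' b'] [/= -> _] [-> _] -> //].
have Lab_le : [set: Lab] #<= [set: Lam].
  have ctb (X : countType) : [set: X] #<= [set: Lam] by apply: absorbing_countable => //; exact: countableP.
  have cfl n : [set: formula L n] #<= [set: Lam] by apply: absorbing_countable => //; exact: cF.
  do !apply: absorbing_sum => //; [apply: card_sig => //|apply: absorbing_prod => //].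
  apply: absorbing_sum => //; apply: absorbing_prod => //.
  all: try exact: ctb.
  apply: (card_sig (fun m1 => {l : nat & formula L (m1 + (m + l))})) => // m1.
  by apply: (card_sig (fun l => formula L (m1 + (m + l)))).
have tm_le : [set: tm] #<= [set: Lam] by apply: absorbing_prod => //; exact: card_forest.
have pLam_abs : absorbing (set Lam).
  apply: infinite_absorbing; apply: card_le_trans (proj1 Lam_abs) _.
  apply: (fun_card_le (f := fun x => [set x])) => x y _ _ h.
  by have : [set y] x by rewrite -h.
have Lam_small : small K [set: Lam].
  apply: small_le reals_small; apply: (fun_card_le (f := fun x => [set x])) => x y _ _ h.
  by have : [set y] x by rewrite -h.
have V_small : small K [set: V].
  apply: small_le reals_small; apply: absorbing_sum => //.
    apply: card_le_trans tm_le _; apply: (fun_card_le (f := fun x => [set x])) => x y _ _ h.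
    by have : [set y] x by rewrite -h.
  by apply: absorbing_prod => //; apply: absorbing_countable => //; exact: countableP.
have [e eP] := ultra_embedding C_sat Uu V_small va.
have va_E i t : E (va i (inl t)) by exact: value_E.
pose BU t := U [set i | B (va i (inl t))].
(* [B'] collects the terms that lie in [B] almost always. Any other term equals some [c' j], because
   [c] is a finite tuple. *)
pose B' := [set x | exists2 t, BU t & x = e (inl t)].
pose E' := [set x | exists t, x = e (inl t)].
pose c' j : C := e (inl (inl (inl j), FNil)).
pose d (X : set Lam) j : C := e (inr (X, j)).
pose t0 : tm := (inl (inr (existT _ 0 (fBot L 1))), FNil).
have Bt0 : BU t0.
  by apply: (ultra_all Uu) => i; rewrite /= /tval /= /skolem; case: cid => z [].
have B'E' : B' `<=` E' by move=> x [t _ ->]; exists t.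
have E'BU x : E' x -> B' x \/ exists j, x = c' j.
  move=> [t ->]; have [Bt|/(ultraN Uu) nBt] := pselect (BU t); first by left; exists t.
  right; have [|j hj] := @ultra_exists_fin _ U mc (fun j => [set i | va i (inl t) = c j]) Uu.
    have [_ _ US _ _] := Uu; apply: US nBt => i /= nB; case: (va_E i t) => // -[j _ cj].
    by exists j; exact: esym cj.
  exists j; apply/(eP (fun v => v (inl t) = v (inl (inl (inl j), FNil)))).
    by exists 2, (fEq L ord0 (lift ord0 ord0)), (vcons (inl t) (fun=> inl (inl (inl j), FNil)))
      => v /=; rewrite vcons0 vconsS.
  exact: hj.
have PE' x : PC x -> E' x -> B' x.
  move=> + [t xt]; rewrite xt => Px; exists t => //.
  have := proj1 (eP (fun v => PC (v (inl t))) (dfn_predicate _ _ _)) Px.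
  have [_ _ US _ _] := Uu; apply: US => i /= Pi; apply: PE; split=> //; exact: va_E.
(* The theorem of Los for the substructures on [B] and [B']; the Skolem terms supply the
   counterexamples within [B']. *)
have los n (g : formula L n) (t : 'I_n -> tm) : (forall j, BU (t j)) ->
    (satr (@interp L C) B' g (fun j => e (inl (t j))) <->
     U [set i | satr (@interp L C) B g (fun j => va i (inl (t j)))]).
  elim: g t => [{}n i j|{}n R w|{}n|{}n g IHg h IHh|{}n g IHg] t Bt /=.
  - apply: (eP (fun v => v (inl (t i)) = v (inl (t j)))).
    by exists n, (fEq L i j), (fun j => inl (t j)).
  - apply: (eP (fun v => interp (fun i => v (inl (t (w i)))))).
    by exists n, (fRel w), (fun j => inl (t j)).
  - by split=> // /(ultra_ex Uu)[].
  - rewrite (IHg _ Bt) (IHh _ Bt); split; last by move=> hU; exact: ultra_imp hU.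
    move=> H; have [Ug|/(ultraN Uu) nUg] := pselect (U [set i | satr (@interp L C) B g (fun j => va i (inl (t j)))]).
      by have [_ _ US _ _] := Uu; apply: US (H Ug) => i /= Bh _.
    by have [_ _ US _ _] := Uu; apply: US nUg => i /= nBg /nBg.
  - have vE (X : Type) (h : tm -> X) s : vcons (h s) (fun j => h (t j)) = fun j => h (vcons s t j).
      by rewrite -[RHS]/(h \o vcons s t) vcons_comp.
    have Bc s : BU s -> forall j, BU (vcons s t j).
      by move=> Bs j; rewrite /vcons; case: unlift.
    split=> [H|hU x [s Bs ->]]; last first.
      rewrite (vE _ (fun t => e (inl t))); apply/IHg; first exact: Bc.
      have [_ _ US UI _] := Uu; apply: US (UI _ _ hU Bs) => i /= [Hi Bi].
      by have := Hi _ Bi; rewrite (vE _ (fun t => va i (inl t))).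
    apply: contrapT => /(ultraN Uu) nU.
    have [a aE] := tuple_forest t.
    pose s : tm := (inl (inr (existT _ n g)), a).
    have sP i : B (va i (inl s)) /\ ((exists x, B x /\ ~ satr (@interp L C) B g (vcons x (fun j => va i (inl (t j))))) ->
        ~ satr (@interp L C) B g (vcons (va i (inl s)) (fun j => va i (inl (t j))))).
      have E1 : (fun j => va i (inl (t j))) = (fun j : 'I_n => nth e0 (ev (Fi i) a) j).
        by apply: funext => j; rewrite aE.
      rewrite E1 /= /tval /= /skolem; case: cid => z [Bz hz] /=; split => //.
    have Bs : BU s by apply: (ultra_all Uu) => i; case: (sP i).
    have B's : B' (e (inl s)) by exists s.
    have := H _ B's; rewrite (vE _ (fun t => e (inl t))) => /(IHg _ (Bc _ Bs)) Us.
    have [_ _ _ UI _] := Uu; have [i [/= Hs nH]] := ultra_ex Uu (UI _ _ Us nU).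
    have [_ hs] := sP i; apply: hs; last by rewrite (vE _ (fun t => va i (inl t))).
    by move/existsNP: nH => [x /not_implyP[Bx nx]]; exists x.
have B'_equiv : elem_equiv (induced B') (induced B).
  apply/elem_equivP => g v.
  have vE (w w' : 'I_0 -> C) : w = w' by apply: funext => -[].
  have t1 (j : 'I_0) : tm by case: j.
  rewrite (vE v (fun j => e (inl (t1 j)))) los; last by case.
  rewrite -(ultra_const Uu (satr (@interp L C) B g _)).
  set S := (X in U X); set S' := (X in _ <-> U X); suff -> : S = S' by [].
  by apply/seteqP; split=> i; rewrite /S /S' /=; [|];
    rewrite (vE (fun j => va i (inl (t1 j))) (fun j => e (inl (t1 j)))).
have B'_le : B' #<= [set: Lam].
  apply: card_le_trans tm_le; apply: (card_le_rel (R := fun x t => x = e (inl t))).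
    by move=> x [t _ ->]; exists t.
  by move=> x y t _ _ -> ->.
have B'_small : small K B' by exact: small_le Lam_small.
pose D X := E' `|` range (d X).
(* As [W0] has no last element, some level [w] lies above all nodes occurring in the parameters. The
   decision taken at the node of [X] at level [w] yields a solution made of terms. *)
have D_witness X m' l (psi : formula L (m' + l)) (b : 'I_l -> C) : X `<=` W0 ->
    (forall j, D X (b j)) ->
    (exists y : 'I_m' -> C, (forall i, PC (y i)) /\ sat psi (vcat y b)) ->
    exists y : 'I_m' -> C, (forall i, PC (y i) /\ E' (y i)) /\ sat psi (vcat y b).
  move=> XW Db hy.
  have /choice[z zP] : forall j, exists z : tm + 'I_m, b j = match z with inl t => e (inl t) | inr i => d X i end.
    move=> j; case: (Db j) => [[t ->]|[i _ <-]]; first by exists (inl t).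
    by exists (inr i).
  pose zV j : V := match z j with inl t => inl t | inr i => inr (X, i) end.
  have bE : b = e \o zV.
    by apply: funext => j; rewrite zP /= /zV; case: (z j).
  (* Entries of [b] taken from [d X] become variables of the added point; [t0] fills their places
     among the parameters. *)
  pose t j := if z j is inl t then t else t0.
  have [a aE] := tuple_forest t.
  have [w Ww bw] := below_ex a.
  pose r (x : 'I_(m' + l)) : 'I_(m' + (m + l)) := match fintype.split x with
    | inl j => lshift (m + l) j
    | inr j => rshift m' (if z j is inr i then lshift l i else rshift m j) end.
  pose q : Qd := existT _ m' (existT _ l (ren psi r)).
  have rE i (y : 'I_m' -> C) : vcat y (vcat (pt (i, X)) (fun j : 'I_l => nth e0 (ev (Fi i) a) j)) \o r
      = vcat y (va i \o zV).
    apply: funext => x /=; rewrite [RHS]/vcat /r /zV /=.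
    case: (fintype.split x) => j; first by rewrite vcatl.
    rewrite vcatr /=; have := aE (Fi i) j; rewrite /t.
    by case: (z j) => [s|i'] h; rewrite (vcatr, vcatl) // h.
  have [_ _ US UI _] := Uu.
  have dq := Fdec (node X Ww) q a bw.
  pose s (j : 'I_m') : tm := (inr (node X Ww, inr (q, val j)), a).
  have hU : U [set i | exists y : 'I_m' -> C, (forall j, PC (y j)) /\ sat psi (vcat y (va i \o zV))].
    apply/(eP (fun v => exists y : 'I_m' -> C, (forall j, PC (y j)) /\ sat psi (vcat y (v \o zV)))).
      apply: (@dfn_ex _ _ V m' (fun u => (forall j, PC (u (inl j))) /\ sat psi (vcat (u \o inl) (u \o inr \o zV)))).
      apply: dfn_and; first by apply: dfn_forall_fin => j; exact: dfn_predicate.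
      exists (m' + l), psi, (vcat inl (inr \o zV)) => u.
      by rewrite vcat_comp.
    by rewrite -bE.
  have sU : U [set i | (forall j, PC (va i (inl (s j)))) /\
      sat psi (vcat (fun j => va i (inl (s j))) (va i \o zV))].
    apply: US (UI _ _ (UI _ _ dq (Fpt X w Ww)) hU) => i /= [[di pi] [y [Py sy]]].
    have yes : exists y : nat -> C, (forall i0, i0 < m' -> (PC `&` E) (y i0)) /\
     forall x, Fi i (node X Ww) x -> sat (ren psi r) (vcat (fun i : 'I_m' => y i)
       (vcat x (fun j : 'I_l => nth e0 (ev (Fi i) a) j))).
      case: di => // /(_ _ pi) []; exists y; split=> //.
      by rewrite sat_ren rE.
    rewrite /tval /= /wit; case: cid => y' [Ey' /(_ yes) [Py' sy']] /=.
    split=> [j|]; first exact: Py'.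
    by have := sy' _ pi; rewrite sat_ren rE.
  exists (fun j => e (inl (s j))).
  have := proj2 (eP (fun v => (forall j, PC (v (inl (s j)))) /\
      sat psi (vcat (fun j => v (inl (s j))) (v \o zV))) _) sU.
  case=> [|Ps sats].
    apply: dfn_and; first by apply: dfn_forall_fin => j; exact: dfn_predicate.
    exists (m' + l), psi, (vcat (fun j => inl (s j)) zV) => u.
    by rewrite vcat_comp.
  split=> [j|]; last by rewrite bE.
  by split; [exact: Ps|exists (s j)].
(* The tuple includes [c'], since members of [S_star] are types over [B'] and not over [E']. *)
pose u X := vcat c' (d X).
have uD X : B' `|` range (u X) = D X.
  apply/seteqP; split=> x.
    case=> [/B'E'|[j _ <-]]; first by left.
    rewrite /u /vcat; case: (fintype.split j) => i; last by right; exists i.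
    by left; exists (inl (inl i), FNil).
  case=> [/E'BU[|[j ->]]|[j _ <-]]; first by left.
    by right; exists (lshift m j) => //; exact: vcatl.
  by right; exists (rshift mc j) => //; exact: vcatr.
have S_star_u X : X `<=` W0 -> S_star P B' (existT _ (mc + m) (tp (u X) B')).
  move=> XW; exists (mc + m), (u X); split=> //; rewrite uD; last first.
    move=> m' l psi b Db /(D_witness X m' l psi b XW Db) [y [Ey sy]].
    exists y; split=> // j; split; [exact: (Ey j).1|left; exact: (Ey j).2].
  apply/seteqP; split=> x [Px Dx]; split=> //; last by left; exact: B'E'.
  apply: PE' => //.
  have [||y [Ey sy]] := @D_witness X 1 1 (fEq L (lshift 1 ord0) (rshift 1 ord0)) (fun=> x) XW.
  - by [].
  - by exists (fun=> x); split=> //=; rewrite vcatl vcatr.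
  - by move: sy => /=; rewrite vcatl vcatr => <-; exact: (Ey ord0).2.
(* The node at a higher level [v] records the choice made at [w], and [d X] satisfies the condition
   at that node. *)
have branch X w (Ww : W0 w) : X `<=` W0 ->
    (X w <-> sat f (vcat (d X) (fun j => e (inl (inr (node X Ww, inl j), FNil))))).
  move=> XW; have [v Wv wv] := W0_limit Ww.
  have hU : U [set i | X w <-> sat f (vcat (fun j => va i (inr (X, j))) (fun j => va i (inl (inr (node X Ww, inl j), FNil))))].
    have [_ _ US UI _] := Uu; apply: US (UI _ _ (Fpt X v Wv) (Ucone (mention (node X Ww)))) => i /= [Fv ri].
    have [_] := Fanc i _ _ _ (anc_node X Ww Wv wv) ri erefl _ Fv.
    rewrite /bit /lev !val_node /= => <-; split=> [Xw|[]//].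
    by split.
  have dS : @dfn L C V (fun x => sat f (vcat (fun j => x (inr (X, j))) (fun j => x (inl (inr (node X Ww, inl j), FNil))))).
    exists (m + k), f, (vcat (fun j => inr (X, j)) (fun j => inl (inr (node X Ww, inl j), FNil))) => x.
    by rewrite vcat_comp.
  rewrite (eP _ dS) -(ultra_const Uu (X w)).
  by have [_ _ US UI _] := Uu; split=> h; apply: US (UI _ _ h hU) => i /= [h1 h2]; apply/h2.
(* At the first level where two branches differ they share a node, hence its splitting parameters,
   and [f] separates them there. *)
have u_inj X Y : X `<=` W0 -> Y `<=` W0 -> tp (u X) B' = tp (u Y) B' -> X = Y.
  move=> XW YW uXY; apply: contrapT => nXY.
  have [w [wXY wmin]] : exists w, ~ (X w <-> Y w) /\ forall v, lt v w -> (X v <-> Y v).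
    have [_ _ mn] := wo; have [|w hw wm] := mn [set w | ~ (X w <-> Y w)].
      apply: contrapT => /forallNP h; apply: nXY; apply/seteqP.
      by split=> x; have /contrapT := h x => -[].
    exists w; split=> // v vw; apply: contrapT => nv.
    by have [wv|wv] := wm _ nv; [apply: (irr v); apply: tr wv|apply: (irr v); rewrite -{2}wv].
  have Ww : W0 w.
    apply: contrapT => nW; apply: wXY; split=> h; exfalso; apply: nW; [exact: XW|exact: YW].
  have nE : node X Ww = node Y Ww.
    apply: val_inj; rewrite !val_node; congr (_, _); apply/seteqP.
    by split=> v [h vw]; split=> //; apply/wmin.
  apply: wXY; rewrite (branch X w Ww XW) (branch Y w Ww YW) -nE.
  pose b j := e (inl (inr (node X Ww, inl j), FNil)).
  have Eb j : E' (b j) by exists (inr (node X Ww, inl j), FNil).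
  have /choice[bz bzP] : forall j, exists z : 'I_mc + B', b j = match z with inl i => c' i | inr x => val x end.
    move=> j; have [Bb|[i bi]] := E'BU _ (Eb j); last by exists (inl i).
    by exists (inr (SigSub (mem_set Bb))).
  pose r (x : 'I_(m + k)) : 'I_(mc + m) + B' := match fintype.split x with
    | inl j => inl (rshift mc j)
    | inr j => match bz j with inl i => inl (lshift m i) | inr y => inr y end end.
  have /dovP[k' [g [b' [Bb' gE]]]] := @dov_sat L C B' 'I_(mc + m) (m + k) f r.
  have ruE Z : sumv (u Z) (fun x : B' => val x) \o r = vcat (d Z) b.
    apply: funext => x; rewrite [RHS]/vcat /= /r; case: (fintype.split x) => j /=.
      exact: vcatr.
    by rewrite bzP; case: (bz j) => //= i; exact: vcatl.
  have thP Z : tp (u Z) B' (PFormula g b') <-> sat f (vcat (d Z) b).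
    rewrite -ruE gE; split=> [[]//|h]; split=> // x [i _ <-]; exact: Bb'.
  by rewrite -/b -!thP uXY.
have [_ /(_ B' B'_small B'_equiv) S_le] := B_stable.
apply: W0_big; have S_ge : [set X : set Lam | X `<=` W0] #<= S_star P B'.
  apply: (@card_le_inj _ _ _ _ (fun X => existT _ (mc + m) (tp (u X) B'))) => [X|X Y XW YW].
    exact: S_star_u.
  by move=> h; apply: u_inj => //; exact: existT_inj h.
apply: card_le_trans S_ge _; apply: card_le_trans S_le _.
have B'T : [set: B'] #<= [set: Lam] by apply: card_le_trans B'_le; exact: card_sub_le.
have [g gi] := card_le_funP (fun=> false) B'T.
have Tn : [set: T] #<= [set: nat] by apply: card_le_trans T_countable; exact: card_sub_le.
have [h hi] := card_le_funP 0 Tn.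
(* The power of [B'] to [T] has at most the size of the continuum: a sequence of reals indexed by
   the countable [T] is coded by one real. *)
pose code (F : T -> B') : Lam := fun n => `[< exists t (j : nat), n = pickle (h t, j) /\ g (F t) j >].
apply: (fun_card_le (f := code)) => F G _ _ FG; apply: funext => t; apply: gi; apply: funext => j.
have key (F' : T -> B') : code F' (pickle (h t, j)) = g (F' t) j.
  apply/asboolP/idP => [[t' [j' [/(pcan_inj pickleK) [/hi <- <-]]]]//|gt].
  by exists t, j.
by rewrite -!key FG.
Qed.

End Density.

(** * Smallness of power sets and the density theorem *)

Lemma small_powerset K (Y : Type) : strong_limit K -> small K [set: Y] -> small K [set: set Y].
Proof.
move=> SL Ys; have [K0|/set0P[k0 _]] := eqVneq [set: K] set0.
  by case/andP: Ys => _ /negP []; rewrite K0; exact: card_ge0.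
have [g [_ gi]] : exists g : Y -> K, (forall x, [set: Y] x -> [set: K] (g x)) /\
    (forall x y, [set: Y] x -> [set: Y] y -> g x = g y -> x = y).
  by apply: (card_le_injP k0); case/andP: Ys.
have rs : small K (range g).
  by apply: small_le Ys; exact: card_image_le.
apply: small_le (SL _ rs).
apply: (fun_card_le (f := fun S : set Y => [set x : range g | exists2 y, S y & g y = val x])).
move=> S S' _ _ e; apply/seteqP.
have gr y : range g (g y) by exists y.
split=> y Sy.
  have : [set x : range g | exists2 y, S y & g y = val x] (SigSub (mem_set (gr y))) by exists y.
  by rewrite e => -[y' Sy' /gi <-].
have : [set x : range g | exists2 y, S' y & g y = val x] (SigSub (mem_set (gr y))) by exists y.
by rewrite -e => -[y' Sy' /gi <-].
Qed.

Lemma small_reals K L (T : set (sentence L)) : complete_theory T -> strong_limit K -> small K T ->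
  small K [set: set (nat -> bool)].
Proof.
move=> Tc SL Ts; apply: small_powerset => //.
have ns : small K [set: nat] by apply: small_le Ts; exact: infinite_theory.
apply: small_le (small_powerset SL ns).
apply: (fun_card_le (f := fun f : nat -> bool => [set n | f n])) => f g _ _ e.
apply: funext => n; apply/idP/idP => h.
  by have : [set n | g n] n by rewrite -e.
by have : [set n | f n] n by rewrite e.
Qed.

(** If no such [X] existed, every condition would be split by some parameter tuple from [E];
    choosing one gives the [beta] that leads to too many types. *)
Lemma isolation_dense L (P : symb L) (T : set (sentence L)) K (C : structure L)
    (B : set C) mc (c : 'I_mc -> C) m (X0 : ('I_m -> C) -> Prop) k (f : formula L (m + k)) :
  complete_theory T -> countable T -> strong_limit K -> small K T -> saturated K C ->
  stable P T K B -> complete_set P (B `|` range c) -> predicate P C `&` (B `|` range c) `<=` B ->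
  (exists b, B b) -> dov (B `|` range c) X0 -> (exists x, X0 x) ->
  exists X, [/\ dov (B `|` range c) X, exists x, X x, forall x, X x -> X0 x &
    forall b : 'I_k -> C, (forall i, (B `|` range c) (b i)) ->
      (forall x, X x -> sat f (vcat x b)) \/ (forall x, X x -> ~ sat f (vcat x b))].
Proof.
move=> Tc Tcount SL Ts Csat Bst Ec PE [e0 Be0] dX0 neX0; apply: contrapT => nX.
pose E := B `|` range c; pose cond (X : ('I_m -> C) -> Prop) :=
  [/\ dov E X, exists x, X x & forall x, X x -> X0 x].
have /choice[beta betaP] : forall X, exists b : 'I_k -> C, (forall j, E (b j)) /\
    (cond X -> (exists x, X x /\ ~ sat f (vcat x b)) /\ (exists x, X x /\ ~ ~ sat f (vcat x b))).
  move=> X; have [[dX neX XX0]|nc] := pselect (cond X); last first.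
    by exists (fun=> e0); split=> [j|//]; left.
  apply: contrapT => /forallNP nb; apply: nX; exists X; split=> // b Eb.
  apply: contrapT => /not_orP[n1 n2]; apply: (nb b); split=> // _.
  by split; [move/existsNP: n1|move/existsNP: n2] => -[x /not_implyP[Xx nx]]; exists x.
have [lt wo] := well_ordering (nat -> bool).
have [W0 [h1 h2 h3 h4]] := branching_height wo.
apply: (@too_many_types L P T K C Tc Tcount Csat (small_reals Tc SL Ts) B mc c Bst Ec PE e0 Be0
  m X0 k f _ beta _ _ lt W0 wo h1 h2 h4 h3) => [|X j|X t cX].
- by split.
- by have [h _] := betaP X; exact: h.
- have [Eb /(_ cX)[[x [Xx nx]] [y [Xy /contrapT sy]]]] := betaP X.
  have [dX _ XX0] := cX; have df := dov_vcat f Eb.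
  have [tt|nt] := pselect t.
    split; [|by exists y; split|by move=> z [/XX0]].
    apply: dov_ext (dov_and dX df) => z; by split=> -[Xz fz]; split=> //; tauto.
  split; [|by exists x; split|by move=> z [/XX0]].
  by apply: dov_ext (dov_and dX (dov_not df)) => z; split=> -[Xz fz]; split=> //; tauto.
Qed.

(** ** Local isolation *)

Definition decided L (C : structure L) m (X : ('I_m -> C) -> Prop) k (f : formula L (m + k))
    (b : 'I_k -> C) :=
  (forall z, X z -> sat f (vcat z b)) \/ (forall z, X z -> ~ sat f (vcat z b)).

(** The isolating parameters from [E0] are kept apart from the decided ones from [E], so that
    isolation can be moved between bases. *)
Definition isolated_over L (C : structure L) (E E0 : set C) m (x : 'I_m -> C) :=
  forall k (f : formula L (m + k)), exists X, [/\ dov E0 X, X x &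
    forall b : 'I_k -> C, (forall i, E (b i)) -> decided X f b].

Lemma locally_isolatedP L (C : structure L) (D : set C) m (x : 'I_m -> C) :
  locally_isolated (tp x D) <-> isolated_over D D x.
Proof.
split=> H k f.
  have [th [Dth thx] thP] := H k f; exists (psat th); split=> //.
    by apply/dovP; exists (projT1 th), (projT2 th).1, (projT2 th).2; split=> // i; apply: Dth; exists i.
  move=> b Db; have [h1 h2] := thP b.
  have Dp g : params (PFormula (m := m) (k := k) g b) `<=` D by move=> _ [i _ <-]; exact: Db.
  have [s|ns] := pselect (sat f (vcat x b)); [left|right].
    by apply: h1; split=> //; exact: Dp.
  by apply: h2; split=> //; exact: Dp.
have [X [/dovP[k' [g [a [Da gE]]]] Xx dec]] := H k f.
exists (PFormula g a); first by split; [move=> _ [i _ <-]; exact: Da|apply/gE].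
move=> b; split=> -[Db hb]; have Db' i : D (b i) by apply: Db; exists i.
  by move=> z /gE Xz; have [h|h] := dec b Db'; [exact: h|case: (h x Xx)].
by move=> z /gE Xz; have [h|h] := dec b Db'; [case: (hb); exact: h|exact: h].
Qed.

Lemma isolated_over_sub L (C : structure L) (E E' E0 E0' : set C) m (x : 'I_m -> C) :
  E' `<=` E -> E0 `<=` E0' -> isolated_over E E0 x -> isolated_over E' E0' x.
Proof.
move=> EE E00 H k f; have [X [dX Xx dec]] := H k f; exists X; split=> //; first exact: dov_sub dX.
by move=> b Eb; apply: dec => i; apply: EE.
Qed.

Lemma countable_sigT (I : Type) (Y : I -> Type) : countable [set: I] ->
  (forall i, countable [set: Y i]) -> countable [set: {i : I & Y i}].
Proof.
move=> cI cY; have -> : [set: {i : I & Y i}] = \bigcup_(i in [set: I]) range (existT Y i).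
  by apply/seteqP; split=> // -[n y] _; exists n => //; exists y.
by apply: bigcup_countable => // i _; exact: countable_range.
Qed.

Lemma countable_prodT (S T : Type) : countable [set: S] -> countable [set: T] ->
  countable [set: S * T].
Proof. by move=> cS cT; rewrite -setXTT; exact: countableX. Qed.

Lemma countable_sumT (S T : Type) : countable [set: S] -> countable [set: T] ->
  countable [set: S + T].
Proof. by move=> cS cT; apply: absorbing_sum => //; exact: absorbing_natT. Qed.

Lemma countable_enum (T : Type) (A : set T) (a0 : T) : A a0 -> countable A ->
  exists e : nat -> T, (forall n, A (e n)) /\ forall x, A x -> exists n, e n = x.
Proof.
move=> Aa0 /(card_le_injP 0)[h [_ hi]].
pose e n := if pselect (exists2 x, A x & h x = n) is left p then s2val (cid2 p) else a0.
exists e; split=> [n|x Ax].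
  by rewrite /e; case: pselect => // p; exact: (s2valP (cid2 p)).
exists (h x); rewrite /e; case: pselect => [p|[]]; last by exists x.
by apply: hi => //; [exact: (s2valP (cid2 p))|exact: (s2valP' (cid2 p))].
Qed.

(** ** The countable case *)

Section Countable.
Variables (L : vocabulary) (P : symb L) (T : set (sentence L)) (K : Type) (C : structure L).
Hypotheses (T_complete : complete_theory T) (T_countable : countable T).
Hypotheses (SL : strong_limit K) (T_small : small K T) (C_sat : saturated K C).
Variables (B : set C) (B_stable : stable P T K B) (B_countable : countable B).
Variables (e0 : C) (Be0 : B e0).

Let PC := predicate P C.

Let cL n : countable [set: formula L n].
Proof. by apply: countable_formula; exact: countable_voc T_countable. Qed.

Lemma countable_small (X : Type) (A : set X) : countable A -> small K A.
Proof.
move=> cA; apply: small_le T_small; apply: card_le_trans cA _; exact: infinite_theory.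
Qed.

(** A decreasing sequence of conditions carries out countably many tasks: decide each [f] for all
    parameters at once, and settle each question about solutions in [P]. No single condition need do
    everything, so saturation is used to find a point in all of them. *)
Lemma isolated_extension mc (c : 'I_mc -> C) (X0 : ('I_1 -> C) -> Prop) :
  let E := B `|` range c in
  complete_set P E -> PC `&` E `<=` B -> dov E X0 -> (exists x, X0 x) ->
  exists d : C, [/\ X0 (fun=> d), isolated_over E E (fun _ : 'I_1 => d),
    complete_set P (E `|` [set d]) & PC `&` (E `|` [set d]) `<=` B].
Proof.
move=> E Ec PE dX0 neX0.
have Ee0 : E e0 by left.
have cE : countable E.
  by apply: absorbing_setU; [exact: absorbing_natT| |apply: countable_range; exact: countableP].
have [en [enE enP]] := countable_enum Ee0 cE.
pose Tk := ({k : nat & formula L (1 + k)} +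
  {m' : nat & {l : nat & formula L (m' + (1 + l))}} * seq nat)%type.
have cTk : countable [set: Tk].
  apply: countable_sumT; first by apply: countable_sigT => // k; exact: cL.
  apply: countable_prodT; last exact: countableP.
  by do 2!apply: countable_sigT => // ?; exact: cL.
have [h hi] := card_le_funP 0 cTk.
pose cond (X : ('I_1 -> C) -> Prop) := dov E X /\ exists x, X x.
pose par (s : seq nat) l (i : 'I_l) := en (nth 0 s i).
pose good (t : Tk) (X : ('I_1 -> C) -> Prop) := match t with
  | inl (existT k f) => forall b : 'I_k -> C, (forall i, E (b i)) -> decided X f b
  | inr (existT m' (existT l psi), s) =>
     (forall x, X x -> ~ exists y : 'I_m' -> C, (forall i, PC (y i)) /\ sat psi (vcat y (vcat x (@par s l)))) \/
     exists y : 'I_m' -> C, (forall i, (PC `&` E) (y i)) /\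
      forall x, X x -> sat psi (vcat y (vcat x (@par s l))) end.
have /choice[nx nxP] : forall p : nat * (('I_1 -> C) -> Prop), exists Y, cond p.2 ->
    [/\ cond Y, forall x, Y x -> p.2 x & forall t, h t = p.1 -> good t Y].
  move=> [n X] /=; have [[dX neX]|] := pselect (cond X); last by exists X.
  have [[t ht]|nt] := pselect (exists t, h t = n); last first.
    by exists X => _; split=> // t ht; case: nt; exists t.
  suff [Y [cY YX gY]] : exists Y, [/\ cond Y, forall x, Y x -> X x & good t Y].
    by exists Y => _; split=> // t' ht'; rewrite (hi t' t) // ht' ht.
  case: t {ht} => [[k f]|[[m' [l psi]] s]] /=.
    have [Y [dY neY YX dec]] := @isolation_dense L P T K C B mc c 1 X k f T_complete T_countable
      SL T_small C_sat B_stable Ec PE (ex_intro _ e0 Be0) dX neX.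
    by exists Y.
  have [Y [dY neY YX dec]] := @decide_witness L P C E 1 m' l X psi (@par s l) Ec dX neX (fun i => enE _).
  by exists Y.
pose X n := nat_rect (fun _ => ('I_1 -> C) -> Prop) X0 (fun n X => nx (n, X)) n.
have cX n : cond (X n) by elim: n => [|n IH] //; have [] := nxP (n, X n) IH.
have XS n x : X n.+1 x -> X n x by have [_ h' _] := nxP (n, X n) (cX n); exact: h'.
have Xmono n k x : X (n + k) x -> X n x.
  by elim: k => [|k IH]; [rewrite addn0|rewrite addnS => /XS].
have gX t : good t (X (h t).+1) by have [_ _ h'] := nxP (h t, X (h t)) (cX (h t)); exact: h'.
have /choice[th thP] : forall n, exists th : pformula C 1, params th `<=` E /\ forall x, psat th x <-> X n x.
  move=> n; have [/dovP[k [f [b [Eb fE]]]] _] := cX n.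
  by exists (PFormula f b); split=> [_ [i _ <-]//|x]; rewrite fE.
have [x xX] : exists x, forall q, range th q -> psat q x.
  apply: (C_sat (countable_small cE)) => [_ [n _ <-]|q /(@finite_seqP {classic (pformula C 1)})[s ->] sth].
    by have [] := thP n.
  have [N NP] : exists N, forall x, X N x -> forall t, t \in s -> psat t x.
    elim: s sth => [|t s IH] sth; first by exists 0.
    have [|N NP] := IH; first by move=> t' /= t's; apply: sth; rewrite /= inE t's orbT.
    have [n _ tn] := sth t (mem_head _ _).
    exists (N + n) => z zX t'; rewrite inE => /predU1P[->|t's].
      by rewrite -tn; apply/(thP n).2; apply: (Xmono n N); rewrite addnC.
    by apply: NP t's; exact: Xmono zX.
  by have [_ [x Xx]] := cX N; exists x; exact: NP.
pose d := x ord0.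
have xE : x = (fun=> d) by apply: funext => i; rewrite (ord1 i).
have Xd n : X n (fun=> d) by rewrite -xE; apply/(thP n).2; apply: xX; exists n.
(* Parameters equal to [d] become the variable of the condition; the others are named by the
   enumeration [en]. *)
have wit m' l (f : formula L (m' + l)) (b : 'I_l -> C) : (forall i, (E `|` [set d]) (b i)) ->
    (exists y : 'I_m' -> C, (forall i, PC (y i)) /\ sat f (vcat y b)) ->
    exists y : 'I_m' -> C, (forall i, (PC `&` E) (y i)) /\ sat f (vcat y b).
  move=> Eb hy.
  have /choice[z zP] : forall j, exists z : option nat, b j = if z is Some n then en n else d.
    by move=> j; case: (Eb j) => [/enP[n <-]|->]; [exists (Some n)|exists None].
  pose s := [seq odflt 0 (z j) | j <- enum 'I_l].
  pose r (u : 'I_(m' + l)) : 'I_(m' + (1 + l)) := match fintype.split u with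
    | inl j => lshift (1 + l) j
    | inr j => rshift m' (if z j is Some _ then rshift 1 j else lshift l ord0) end.
  have rE (y : 'I_m' -> C) : vcat y (vcat (fun _ : 'I_1 => d) (@par s l)) \o r = vcat y b.
    apply: funext => u /=; rewrite /r [RHS]/vcat; case: (fintype.split u) => j; first by rewrite vcatl.
    rewrite vcatr zP; case zj : (z j) => [n|]; last by rewrite vcatl.
    by rewrite vcatr /par /s (nth_map j) ?size_enum_ord // nth_ord_enum zj.
  have := gX (inr (existT _ m' (existT _ l (ren f r)), s)).
  case=> [/(_ _ (Xd _))[]|[y [Ey sy]]].
    by have [y [Py sy]] := hy; exists y; split=> //; rewrite sat_ren rE.
  by exists y; split=> //; have := sy _ (Xd _); rewrite sat_ren rE.
exists d; split.
- exact: (Xd 0).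
- by move=> k f; exists (X (h (inl (existT _ k f))).+1); split; [exact: (cX _).1|exact: Xd|exact: (gX (inl (existT _ k f)))].
- move=> m' l f b Eb hy; have [y [Ey sy]] := wit _ _ _ _ Eb hy.
  by exists y; split=> // i; have [Py ?] := Ey i; split=> //; left.
- move=> z [Pz [Ez|zd]]; first exact: PE.
  (* Applied to an equation, [wit] shows that an element of [P] in the extension already lies in
     [E]. *)
  have [||y [Ey sy]] := wit 1 1 (fEq L (lshift 1 ord0) (rshift 1 ord0)) (fun=> z).
  + by right.
  + by exists (fun=> z); split=> //=; rewrite vcatl vcatr.
  + by apply: PE; move: sy => /=; rewrite vcatl vcatr => <-; exact: Ey.
Qed.

Lemma range_extend mc (c : 'I_mc -> C) (ds : seq C) : exists n (c' : 'I_n -> C),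
  range c' = range c `|` [set x | List.In x ds].
Proof.
elim: ds => [|d ds [n [c' c'E]]].
  by exists mc, c; apply/seteqP; split=> [x|x []//]; left.
exists n.+1, (vcons d c'); apply/seteqP; split=> x.
  move=> [i _ <-]; case: (unliftP ord0 i) => [j|] ->; last by rewrite vcons0; right; left.
  rewrite vconsS; have : range c' (c' j) by exists j.
  by rewrite c'E => -[h|h]; [left|right; right].
have sub : range c' `<=` range (vcons d c') by move=> _ [j _ <-]; exists (lift ord0 j) => //; rewrite vconsS.
by case=> [cx|/= [<-|dx]]; [apply: sub; rewrite c'E; left|exists ord0; rewrite ?vcons0|apply: sub; rewrite c'E; right].
Qed.

Lemma wo_nat : well_ordered (fun x y : nat => x < y).
Proof.
split=> [x|x y z|S [n Sn]]; [by rewrite ltnn|exact: ltn_trans|].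
have [m /asboolP Sm mmin] := ex_minnP (ex_intro (fun n => `[< S n >]) n (introT (asboolP _) Sn)).
exists m => // z Sz; have := mmin z (introT (asboolP _) Sz).
by rewrite leq_eqVlt => /predU1P[->|]; [right|left].
Qed.

Lemma constructible_countable mc (c : 'I_mc -> C) :
  let E := B `|` range c in
  complete_set P E -> PC `&` E `<=` B ->
  exists M, locally_constructible P K M E /\ countable M.
Proof.
move=> E Ec PE; have Ee0 : E e0 by left.
have cE : countable E.
  by apply: absorbing_setU; [exact: absorbing_natT| |apply: countable_range; exact: countableP].
have [en [enE enP]] := countable_enum Ee0 cE.
(* The last component is a dummy that repeats each task infinitely often, hence also after all its
   parameters have been constructed. *)
pose Tk := ({n : nat & formula L n.+1} * seq nat * nat)%type.
have cTk : countable [set: Tk].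
  apply: countable_prodT; last exact: countableP.
  by apply: countable_prodT; [apply: countable_sigT => // n; exact: cL|exact: countableP].
have [h hi] := card_le_funP 0 cTk.
pose Eof (ds : seq C) := E `|` [set x | List.In x ds].
(* Even codes name elements of [E], odd codes the elements constructed so far. *)
pose val_ ds k := if odd k then nth e0 ds k./2 else en k./2.
pose inv ds := complete_set P (Eof ds) /\ PC `&` Eof ds `<=` B.
have Eval ds k : Eof ds (val_ ds k).
  rewrite /val_; case: ifP => _; last by left; exact: enE.
  elim: ds k./2 => [|d ds IH] [|j] /=; rewrite ?nth_nil; [by left|by left|by right; left|].
  by case: (IH j); [left|right; right].
have /choice[nx nxP] : forall p : nat * seq C, exists d, inv p.2 ->
    [/\ inv (rcons p.2 d), isolated_over (Eof p.2) (Eof p.2) (fun _ : 'I_1 => d) &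
      forall n f s r, h (existT _ n f, s, r) = p.1 ->
        (exists x, sat f (vcons x (fun i : 'I_n => val_ p.2 (nth 0 s i)))) ->
        sat f (vcons d (fun i : 'I_n => val_ p.2 (nth 0 s i)))].
  move=> [i ds] /=; have [[dsc Pds]|] := pselect (inv ds); last by exists e0.
  have [X [dX neX XP]] : exists X : ('I_1 -> C) -> Prop, [/\ dov (Eof ds) X, exists x, X x &
     forall d, X (fun=> d) -> forall n f s r, h (existT _ n f, s, r) = i ->
        (exists x, sat f (vcons x (fun i : 'I_n => val_ ds (nth 0 s i)))) ->
        sat f (vcons d (fun i : 'I_n => val_ ds (nth 0 s i)))].
    have [[[[n f] s] [r [hr [x sx]]]]|no] := pselect (exists t : {n : nat & formula L n.+1} * seq nat,
        exists r, h (t, r) = i /\ exists x, sat (projT2 t.1) (vcons x (fun i : 'I_(projT1 t.1) => val_ ds (nth 0 t.2 i)))); last first.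
      exists (fun=> ~ False); split; [by apply: dov_not; apply: dov_dfn; exact: dfn_bot|by exists (fun=> e0)|].
      move=> d _ n f s r hr ex; case: no.
      by exists (existT (fun n => formula L n.+1) n f, s), r.
    exists (fun z => sat f (vcons (z ord0) (fun i : 'I_n => val_ ds (nth 0 s i)))); split.
    - apply: (@dov_par _ _ (Eof ds) 'I_1 'I_n (fun u => sat f (vcons (u (inl ord0)) (u \o inr)))).
        by move=> j; exact: Eval.
      by apply: dov_dfn; exists n.+1, f, (vcons (inl ord0) inr) => u; rewrite vcons_comp.
    - by exists (fun=> x).
    - move=> d sd n' f' s' r' hr' _; have := hi _ _ (etrans hr' (esym hr)).
      move=> e; have ef : existT (fun n => formula L n.+1) n' f' = existT _ n f := congr1 (fun t : Tk => t.1.1) e.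
      have es : s' = s := congr1 (fun t : Tk => t.1.2) e.
      have en' : n' = n := congr1 (@projT1 _ _) ef.
      by subst n'; rewrite (existT_inj ef) es.
  (* The points added so far are appended to [c], so that stability of the fixed set [B] can be used
     at every stage. *)
  have [n [c' c'E]] := range_extend c ds.
  have EE : B `|` range c' = Eof ds by rewrite c'E setUA.
  have [||||d [Xd iso dc Pd]] := @isolated_extension n c' X; rewrite ?EE //.
  exists d => _; have rE : Eof (rcons ds d) = Eof ds `|` [set d].
    rewrite /Eof -setUA; congr (_ `|` _); apply/seteqP; split=> y /=; rewrite -cats1 List.in_app_iff /=.
      by case=> [|[<-|//]]; [left|right].
    by case=> [|->]; [left|right; left].
  move: iso dc Pd; rewrite EE => iso dc Pd; split=> //; first by rewrite /inv rE.
  exact: XP.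
pose D i := nat_rect (fun _ => seq C) [::] (fun i ds => rcons ds (nx (i, ds))) i.
pose d i := nx (i, D i).
have DS i : D i.+1 = rcons (D i) (d i) by [].
have invD i : inv (D i).
  elim: i => [|i IH]; last by have [] := nxP (i, D i) IH.
  rewrite /inv; have -> : Eof (D 0) = E by apply/seteqP; split=> [y []//|y]; left.
  by split.
have sD i : size (D i) = i by elim: i => // i IH; rewrite DS size_rcons IH.
have nD i j : j < i -> nth e0 (D i) j = d j.
  elim: i => // i IH; rewrite DS nth_rcons sD ltnS leq_eqVlt => /predU1P[->|ji].
    by rewrite ltnn eqxx.
  by rewrite ji IH.
have inD i y : List.In y (D i) <-> exists2 j, j < i & y = d j.
  elim: i y => [|i IH] y; first by split=> [[]|[]].
  rewrite DS -cats1 List.in_app_iff IH /=; split.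
    case=> [[j ji ->]|[<-|//]]; last by exists i.
    by exists j => //; exact: ltnW.
  move=> [j]; rewrite ltnS leq_eqVlt => /predU1P[->|ji] ->; first by right; left.
  by left; exists j.
pose M := E `|` range d.
have cM : countable M.
  by apply: absorbing_setU; [exact: absorbing_natT| |exact: countable_range].
have bound n (k : 'I_n -> nat) : exists N, forall i, k i < N.
  exists (\max_i k i).+1 => i; rewrite ltnS; exact: (leq_bigmax_cond i).
have Mmodel : elem_sub M.
  apply: elem_sub_tv => n f v Mv [x sx].
  have /choice[k kP] : forall i, exists k, v i = if odd k then d k./2 else en k./2.
    move=> i; case: (Mv i) => [/enP[j <-]|[j _ <-]]; [exists j.*2|exists j.*2.+1].
      by rewrite odd_double doubleK.
    by rewrite /= odd_double /= uphalf_double.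
  have [N NP] := bound n k.
  pose s := [seq k i | i <- enum 'I_n].
  have [r rN] : exists r, N < h (existT _ n f, s, r).
    by apply: (@injective_gtn (fun r => h (existT _ n f, s, r))) => r r' /hi [].
  set i := h _ in rN.
  have vE : (fun j : 'I_n => val_ (D i) (nth 0 s j)) = v.
    apply: funext => j; rewrite /val_ /s (nth_map j) ?size_enum_ord // nth_ord_enum kP.
    case: ifP => // ok; rewrite nD //; apply: leq_ltn_trans rN.
    by apply: leq_trans (ltnW (NP j)); rewrite -{2}(odd_double_half (k j)) -addnn addnCA leq_addr.
  have [_ _ nP] := nxP (i, D i) (invD i).
  exists (d i); split; first by right; exists i.
  have := nP n f s r erefl; rewrite vE; apply; by exists x.
exists M; split=> //; split.
- by split=> //; exact: countable_small.
- move=> y [Py [Ey|[i _ yi]]] //; left; have [_ PD] := invD i.+1; apply: PD; split=> //.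
  by right; apply/inD; exists i.
- by move=> y; left.
- exists nat, (fun x y => `[< x < y \/ x = y >]), d; split=> //.
    exact: (well_order_of wo_nat).
  move=> i; apply/locally_isolatedP.
  have [_ iso _] := nxP (i, D i) (invD i).
  have -> // : E `|` d @` [set j | `[< j < i \/ j = i >] /\ j <> i] = Eof (D i).
  congr (_ `|` _); apply/seteqP; split=> y /=.
    by move=> [j [/asboolP[ji|//] _] <-]; apply/inD; exists j.
  move/inD => [j ji ->]; exists j => //; split; first by apply/asboolP; left.
  by move=> e; rewrite e ltnn in ji.
Qed.

End Countable.

(** ** Good systems, non-recursively *)

Ltac set_tauto := apply/seteqP; split=> ? /=; rewrite /setU /setI /setD /setC /mkset /=; tauto.

Lemma powset_enum_of l (Z : set nat) : Z `<=` `I_l ->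
  exists ss : seq (set nat), forall s, powset Z s <-> s \in ss.
Proof.
move=> Zl; pose F (Q : {ffun 'I_l -> bool}) : set nat := [set j | Z j /\ exists2 i : 'I_l, Q i & val i = j].
exists [seq F Q | Q <- enum {ffun 'I_l -> bool}] => s; split=> [sl|/mapP[Q _ ->] j []//].
apply/mapP; exists [ffun i : 'I_l => `[< s (val i) >]]; first exact: mem_enum.
apply/seteqP; split=> j.
  move=> sj; have jl := Zl _ (sl _ sj); split; first exact: sl.
  by exists (Ordinal jl) => //; rewrite ffunE; apply/asboolP.
by move=> [_ [i]]; rewrite ffunE => /asboolP si <-.
Qed.

Lemma powset_enum l : exists ss : seq (set nat), forall s, powset [set j | 0 < j < l] s <-> s \in ss.
Proof. by apply: (@powset_enum_of l) => j /andP[]. Qed.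

Lemma system_incl_eq L (C : structure L) (J : set (set nat)) (A1 A2 A1' A2' : set nat -> set C) :
  (forall s, J s -> A1 s = A1' s) -> (forall s, J s -> A2 s = A2' s) ->
  system_incl J A1 A2 -> system_incl J A1' A2'.
Proof.
move=> e1 e2 /system_inclP H; apply/system_inclP.
have iE (A A' : set nat -> set C) : (forall s, J s -> A s = A' s) ->
    @system_interp L C J A = @system_interp L C J A'.
  move=> e; apply: functional_extensionality_dep => -[R//|s].
  by apply: funext => v; rewrite /system_interp e //; exact: set_valP.
by rewrite -(iE _ _ e1) -(iE _ _ e2) -(eq_bigcupr e1) -(eq_bigcupr e2).
Qed.

Lemma nice_proper n : 0 < n -> nice n (proper_powset `I_n).
Proof.
move=> n0; split; [split|].
- by move=> s [].
- move=> s sn; split; first by move=> j /sn/andP[].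
  by move=> /(_ 0 n0)/sn.
- move=> s t [tn nt] st; split; first exact: subset_trans tn.
  by move=> ns; apply: nt; apply: subset_trans ns st.
- move=> s t [tn nt] sn [k [tk nsk _]]; split=> // ns; apply: nsk; apply: ns; exact: tn.
Qed.

Section Flat.
Variables (L : vocabulary) (P : symb L) (T : set (sentence L)) (K : Type) (C : structure L).
Let PC := predicate P C.
Local Notation good := (good_system P T K).
Implicit Types (A : set nat -> set C) (I : set (set nat)) (s t u : set nat).

(* The clauses of [good_system] for the systems reached by fixing the indices
   [u] above l to belong to all index sets. *)
Record flat n I A : Prop := Flat {
  flat_nice : nice n I;
  flat_small : forall s, I s -> small K (A s);
  flat_inter : forall s t, I s -> I t -> A s `&` A t = A (s `&` t);
  flat_model : forall s, I s ->
    (~ s 0 -> @elem_incl L C (induced (A s)) (induced PC) val val) /\ (s 0 -> elem_sub (A s));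
  flat_pred : forall s, I s -> A s `&` PC = A (s `\ 0);
  flat_stable : forall l u s, l <= n -> u `<=` [set j | l <= j < n] -> s `<=` `I_l -> s 0 ->
    I (s `|` u) -> stable P T K (\bigcup_(t in proper_powset s) A (t `|` u));
  flat_incl : forall l u, 0 < l < n -> u `<=` [set j | l < j < n] ->
    system_incl (powset [set j | 0 < j < l]) (fun s => A (s `|` u)) (fun s => A (s `|` [set l] `|` u));
  flat_pull : forall l u, 0 < l < n -> u `<=` [set j | l < j < n] ->
    pulls_back l [set s | s `<=` `I_l.+1 /\ I (s `|` u)] (fun s => A (s `|` u)) }.

Lemma flat_mono n I A s t : flat n I A -> I t -> s `<=` t -> A s `<=` A t.
Proof.
move=> FA It st; have [_ _ down] := (flat_nice FA).1; have Is := down _ _ It st.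
have := flat_inter FA Is It; have -> : s `&` t = s by apply/seteqP; split=> x; [case|move=> sx; split=> //; exact: st].
by move=> <-; exact: subIsetr.
Qed.

Lemma pulls_back_sub l I I' A : I' `<=` I -> pulls_back l I A -> pulls_back l I' A.
Proof. by move=> II H m f t b h; apply: H => i; case: (h i) => /II ? ?; split. Qed.

(** Indices outside the range of [e] are dropped. As [e] is increasing and fixes 0, the clauses at
    level [l] come from those at level [e l], and the special role of 0 is preserved. *)
Lemma flat_reindex n k I I' A (e : nat -> nat) :
  (forall i j, i < j -> e i < e j) -> e 0 = 0 -> (forall i, i < k -> e i < n) -> k <= n ->
  nice k I' -> (forall t, I' t -> I (e @` t)) -> flat n I A ->
  flat k I' (fun t => A (e @` t)).
Proof.
move=> emono e0 ek kn I'nice I'I FA; have [[I'k I'sub I'down] _] := I'nice.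
have einj : injective e.
  by move=> i j eij; case: (ltngtP i j) => // /emono; rewrite eij ltnn.
have imI (X Y : set nat) : e @` (X `&` Y) = e @` X `&` e @` Y.
  apply/seteqP; split=> [_ [x [Xx Yx] <-]|_ [[x Xx <-] [y Yy /einj e1]]]; first by split; exists x.
  by exists x => //; split=> //; rewrite -e1.
have imD1 (X : set nat) i : e @` (X `\ i) = e @` X `\ e i.
  apply/seteqP; split=> [_ [x [Xx xi] <-]|_ [[x Xx <-] xi]].
    by split; [exists x|move=> /einj].
  by exists x => //; split=> // xe; apply: xi; rewrite xe.
have imu l u : l < k -> u `<=` [set j | l < j < k] -> e @` u `<=` [set j | e l < j < n].
  by move=> lk ul _ [x /ul/andP[lx xk] <-]; rewrite /mkset emono // ek.
have low l s : powset [set j | 0 < j < l] s -> powset [set j | 0 < j < e l] (e @` s).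
  by move=> sl _ [x /sl/andP[x0 xl] <-]; rewrite /mkset -e0 !emono.
split=> //.
- by move=> s /I'I h; exact: (flat_small FA h).
- by move=> s t Is It; rewrite imI; apply: (flat_inter FA); exact: I'I.
- move=> s Is; have [h1 h2] := flat_model FA (I'I _ Is); split=> s0.
    by apply: h1 => -[x sx]; rewrite -e0 => /einj x0; apply: s0; rewrite -x0.
  by apply: h2; exists 0.
- by move=> s Is; rewrite (flat_pred FA (I'I _ Is)) imD1 e0.
- move=> l u s lk ul sl s0 Isu.
  have -> : \bigcup_(t in proper_powset s) A (e @` (t `|` u)) =
      \bigcup_(t in proper_powset (e @` s)) A (t `|` e @` u).
    apply/seteqP; split=> x.
      move=> [t [ts nst]]; rewrite image_setU => Ax; exists (e @` t) => //; split.
        by move=> _ [y ty <-]; exists y => //; exact: ts.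
      by move=> h; apply: nst => y sy; have [|z tz /einj <-] := h (e y); first by exists y.
    move=> [t [ts nst] Ax]; exists [set y | s y /\ t (e y)].
      split=> [y []//|h]; apply: nst => _ [y sy <-]; by have [] := h y sy.
    rewrite image_setU; have -> : e @` [set y | s y /\ t (e y)] = t; last by [].
    apply/seteqP; split=> [_ [y [sy ty] <-]//|y ty].
    by have [z sz ez] := ts _ ty; exists z => //; split=> //; rewrite ez.
  (* For [l = k] the value [e k] may exceed [n], so [n] is taken as the level. *)
  apply: (flat_stable FA (l := if l < k then e l else n)).
  + by case: ifP => // lk'; apply: ltnW; exact: ek.
  + move=> _ [y /ul /andP[ly yk] <-]; rewrite /mkset ek // andbT.
    case: ifP => [lk'|]; last by rewrite (leq_ltn_trans ly yk).
    by move: ly; rewrite leq_eqVlt => /predU1P[->|/emono/ltnW].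
  + move=> _ [y sy <-]; have yl : y < l := sl _ sy; rewrite /mkset; case: ifP => _; first exact: emono.
    by apply: ek; exact: leq_trans lk.
  + by exists 0.
  + by rewrite -image_setU; exact: I'I.
- move=> l u /andP[l0 lk] ul.
  have := flat_incl FA (l := e l) (u := e @` u); rewrite -{1}e0 emono // ek // => /(_ isT (imu _ _ lk ul)) h.
  have [ss ssP] := powset_enum l.
  have := system_incl_reduct (g := fun s => e @` s) (low l) ssP _ h.
  case=> [s sl x|].
    apply: (flat_mono FA); last by move=> y [?|?]; [left; left|right].
    have [[_ sub _] _] := flat_nice FA; apply: sub => y [[/sl/andP[y0 yl]|->]|/(imu _ _ lk ul)/andP[ly yn]].
    - by rewrite /mkset y0 (ltn_trans yl) // ek.
    - by rewrite /mkset -{1}e0 emono // ek.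
    - by rewrite /mkset yn andbT; apply: leq_ltn_trans ly.
  move=> h' [h1 h2]; apply: (system_incl_eq _ _ (ex_intro _ h' (conj h1 h2))) => s _ /=.
    by rewrite image_setU.
  by rewrite !image_setU image_set1.
- move=> l u /andP[l0 lk] ul m f t b tb sb.
  have := flat_pull FA (l := e l) (u := e @` u); rewrite -{1}e0 emono // ek // => /(_ isT (imu _ _ lk ul)).
  case/(_ m f (fun i => e @` (t i)) b _ sb) => [i|b' [h1 h2 h3]].
    have [[tl It] Ab] := tb i.
    split; last by rewrite -image_setU.
    split; last by rewrite -image_setU; exact: I'I.
    by move=> _ [y /tl yl <-]; move: yl; rewrite /mkset !ltnS leq_eqVlt => /predU1P[->//|/emono/ltnW].
  exists b'; split=> // i; first by rewrite image_setU imD1.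
  by move=> tl; apply: h2 => -[x tx /einj xl]; apply: tl; rewrite -xl.
Qed.

Lemma flat_weaken n I I' A : nice n I' -> I' `<=` I -> flat n I A -> flat n I' A.
Proof.
move=> nI' II FA.
have := @flat_reindex n n I I' A id (fun _ _ h => h) erefl (fun _ h => h) (leqnn n) nI' _ FA.
have -> : (fun t => A (id @` t)) = A by apply: funext => t; rewrite image_id.
by apply=> t; rewrite image_id; exact: II.
Qed.

(** The face where every index set contains [u]; its clauses for [u'] are those of the whole system
    for the union of [u'] and [u]. *)
Lemma flat_sub n I A l u : 0 < l <= n -> u `<=` [set j | l <= j < n] -> flat n I A ->
  flat l [set s | s `<=` `I_l /\ I (s `|` u)] (fun s => A (s `|` u)).
Proof.
move=> /andP[l0 ln] ul FA; have [[In Isub Idown] Iinit] := flat_nice FA.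
have ul0 x : u x -> (0 < x) * (l <= x) * (x < n).
  by move=> /ul/andP[lx xn]; rewrite lx xn (leq_trans l0 lx).
split.
- split; [split=> [s []//|s sl|s t [tl It] st]|].
  + split; first by move=> x /sl/andP[].
    apply: Isub => x [/sl/andP[x0 xl]|/ul0 h]; last by rewrite /mkset !h.
    by rewrite /mkset x0 (leq_trans xl).
  + split; first exact: subset_trans tl.
    by apply: Idown It _ => x [/st|]; [left|right].
  + move=> s t [tl It] sl [k [tk nsk h]]; split=> //; apply: (Iinit _ _ It).
      by move=> x [/sl xl|/ul0 h']; [exact: leq_trans xl ln|rewrite /mkset h'].
    exists k; split; [by left|move=> [//|/ul0 h']; have := tl _ tk; rewrite /mkset ltnNge h'//|].
    by move=> j jk; have := h j jk; rewrite /setU /mkset; tauto.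
- by move=> s [_ Is]; exact: (flat_small FA Is).
- move=> s t [_ Is] [_ It]; rewrite (flat_inter FA Is It); congr A.
  by rewrite -setUIl.
- move=> s [_ Is]; have [h1 h2] := flat_model FA Is; split=> s0.
    by apply: h1 => -[//|/ul0 h]; move: h; rewrite ltnn => -[[]].
  by apply: h2; left.
- move=> s [_ Is]; rewrite (flat_pred FA Is); congr A; apply/seteqP; split=> x /=.
    by move=> [[sx|ux] x0]; [left|right].
  by move=> [[sx x0]|ux]; split=> //; [left|right|move=> x0; have := ul0 _ ux; rewrite x0 ltnn => -[[]]].
- move=> l' u' s l'l u'l sl' s0 [_ Is].
  have -> : \bigcup_(t in proper_powset s) A (t `|` u' `|` u) =
      \bigcup_(t in proper_powset s) A (t `|` (u' `|` u)).
    by apply: eq_bigcupr => t _; rewrite setUA.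
  apply: (flat_stable FA (l := l')) => //; [exact: leq_trans ln| |by rewrite setUA].
  move=> x [/u'l/andP[lx xl]|/ul0 h]; rewrite /mkset; last by rewrite h (leq_trans l'l) // h.
  by rewrite lx (leq_trans xl).
- move=> l' u' /andP[l'0 l'l] u'l.
  have := flat_incl FA (l := l') (u := u' `|` u); rewrite l'0 (leq_trans l'l ln) => /(_ isT) [].
    move=> x [/u'l/andP[lx xl]|/ul0 h]; rewrite /mkset; last by rewrite h (leq_trans l'l) // h.
    by rewrite lx (leq_trans xl).
  move=> h [h1 h2]; apply: (system_incl_eq _ _ (ex_intro _ h (conj h1 h2))) => s _; first by rewrite setUA.
  by congr A; set_tauto.
- move=> l' u' /andP[l'0 l'l] u'l.
  have := flat_pull FA (l := l') (u := u' `|` u); rewrite l'0 (leq_trans l'l ln) => /(_ isT) H.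
  have {}H := H _; move=> m f t b tb sb; case: (H _ m f t b _ sb).
  + move=> x [/u'l/andP[lx xl]|/ul0 h]; rewrite /mkset; last by rewrite h (leq_trans l'l) // h.
    by rewrite lx (leq_trans xl).
  + move=> i; have [[tl [_ It]] Ab] := tb i; rewrite setUA; split=> //; split=> //.
    by rewrite /mkset setUA.
  + move=> b' [h1 h2 h3]; exists b'; split=> // i; by rewrite -setUA.
Qed.

Lemma nice_low n : 0 < n -> nice n (powset [set j | 0 < j < n]).
Proof.
move=> n0; split; [split=> // [s sl x /sl/andP[]//|s t tl st]|].
  exact: subset_trans tl.
move=> s t tl sn [k [tk nsk h]] x sx; have xn : x < n := sn _ sx.
rewrite /mkset xn andbT lt0n; apply/eqP => x0; subst x.
have /andP[k0 _] := tl _ tk; by have := h 0 k0 => -[/(_ sx)/tl].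
Qed.

(** Putting the top index into all index sets, or into none, gives the two systems that the
    recursive clauses require to be good; both are instances of [flat_sub]. *)
Lemma flat_good n I A : flat n I A -> good n I A.
Proof.
elim: n I A => [|l IH] I A FA.
  split; first by split; [exact: (flat_nice FA)|exact: (flat_small FA)|exact: (flat_inter FA)|exact: (flat_model FA)|exact: (flat_pred FA)].
  split=> // s Is s0; have [[In _ _] _] := flat_nice FA.
  by have := In _ Is 0 s0.
have [[In Isub Idown] Iinit] := flat_nice FA.
have setU0f (u : set nat) : u = set0 -> (fun s : set nat => A (s `|` u)) = A.
  by move=> ->; apply: funext => s; rewrite setU0.
split; first by split; [exact: (flat_nice FA)|exact: (flat_small FA)|exact: (flat_inter FA)|exact: (flat_model FA)|exact: (flat_pred FA)].
split.
  move=> s Is s0; have -> : \bigcup_(t in proper_powset s) A t = \bigcup_(t in proper_powset s) A (t `|` set0).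
    by apply: eq_bigcupr => t _; rewrite setU0.
  by apply: (flat_stable FA (l := l.+1)) => //; [exact: In|rewrite setU0].
move=> l0 J; have l0' : 0 < l < l.+1 by rewrite l0 ltnSn.
have l0'' : 0 < l <= l.+1 by rewrite l0 leqnSn.
have F1 : flat l [set s | ~ s l /\ I (s `|` [set l])] (shift l A).
  have := flat_sub l0'' (u := [set l]) _ FA; have -> : [set s | s `<=` `I_l /\ I (s `|` [set l])] = [set s | ~ s l /\ I (s `|` [set l])].
    apply/seteqP; split=> s [h Is]; split=> //; first by move=> /h; rewrite /mkset ltnn.
    move=> x sx; have := In _ Is x (or_introl sx); rewrite /mkset ltnS leq_eqVlt => /predU1P[xl|//].
    by case: h; rewrite -xl.
  by apply=> x ->; rewrite /mkset leqnn ltnSn.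
have F2 : flat l [set s | I s /\ ~ s l] A.
  have := flat_sub l0'' (u := set0) _ FA; rewrite setU0f //.
  have -> : [set s | s `<=` `I_l /\ I (s `|` set0)] = [set s | I s /\ ~ s l].
    apply/seteqP; split=> s; rewrite /mkset setU0.
      by move=> [h Is]; split=> // /h; rewrite /mkset ltnn.
    move=> [Is h]; split=> // x sx; have := In _ Is x sx; rewrite /mkset ltnS leq_eqVlt => /predU1P[xl|//].
    by case: h; rewrite -xl.
  by apply.
have Jl s : J s -> powset [set j | 0 < j < l.+1] s.
  by move=> Js x /Js/andP[x0 xl]; rewrite /mkset x0 ltnS ltnW.
split.
- have := flat_incl FA l0' (u := set0); rewrite setU0f //.
  have -> : (fun s => A (s `|` [set l] `|` set0)) = shift l A by apply: funext => s; rewrite setU0.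
  by apply.
- split; apply: IH.
    apply: flat_weaken F2; first exact: nice_low.
    move=> s Js; split; first by apply: Isub; exact: Jl.
    by move=> /Js; rewrite /mkset ltnn andbF.
  apply: flat_weaken F1; first exact: nice_low.
  move=> s Js; split; first by move=> /Js; rewrite /mkset ltnn andbF.
  by apply: Isub => x [/(Jl _ Js)//|->]; rewrite /mkset l0 ltnSn.
- have := flat_pull FA l0' (u := set0); rewrite setU0f // => H; apply: pulls_back_sub (H _); last by [].
  by move=> s Is; split; [exact: In|rewrite setU0].
- exact: IH.
- exact: IH.
Qed.

(** A clause for [u] comes from the shifted system if [u] contains the top index and from the
    restricted one otherwise; the outermost clauses of [good_system] give the top level. *)
Lemma good_flat n I A : good n I A -> flat n I A.
Proof.
elim: n I A => [|l IH] I A [[c1 c2 c3 c4 c5] [c6 c7]].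
  split=> // [k u s|k u|k u]; rewrite ?ltn0 ?andbF //.
  by rewrite leqn0 => /eqP -> _ sl s0; have := sl _ s0.
have [[In Isub Idown] Iinit] := c1.
have setU0f (u : set nat) : u = set0 -> (fun s : set nat => A (s `|` u)) = A.
  by move=> ->; apply: funext => s; rewrite setU0.
have su (u : set nat) : u l -> (fun s : set nat => A (s `|` u)) = fun s => shift l A (s `|` (u `\ l)).
  move=> ul; apply: funext => s; rewrite /shift; congr A; apply/seteqP; split=> x /=.
    move=> [sx|ux]; first by left; left.
    by have [->|xl] := pselect (x = l); [right|left; right].
  by move=> [[sx|[ux _]]|->]; [left|right|right].
have uE k (u : set nat) : k <= l -> u `<=` [set j | k <= j < l.+1] -> ~ u l -> u `<=` [set j | k <= j < l].
  move=> kl uk nul x ux; have /andP[kx] := uk _ ux; rewrite /mkset kx ltnS leq_eqVlt => /predU1P[xl|//].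
  by case: nul; rewrite -xl.
have uD k (u : set nat) : u `<=` [set j | k <= j < l.+1] -> u `\ l `<=` [set j | k <= j < l].
  move=> uk x [ux /eqP xl]; have /andP[kx] := uk _ ux; rewrite /mkset kx ltnS leq_eqVlt.
  by rewrite (negbTE xl).
have u0 (u : set nat) : u `<=` [set j | l < j < l.+1] -> u = set0.
  by move=> ul; rewrite -subset0 => x /ul /andP[lx]; rewrite ltnS leqNgt lx.
split=> //.
- move=> k u s kl uk sk s0 Isu.
  have [ul|nul] := pselect (u l).
    have kl' : k <= l by have /andP[] := uk _ ul.
    have l0 : 0 < l by apply: leq_trans kl'; exact: leq_ltn_trans (sk _ s0).
    have [_ _ _ /IH F1 _] := c7 l0.
    have -> : \bigcup_(t in proper_powset s) A (t `|` u) = \bigcup_(t in proper_powset s) shift l A (t `|` (u `\ l)).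
      by apply: eq_bigcupr => t _; rewrite -[LHS]/((fun t => A (t `|` u)) t) su.
    apply: (flat_stable F1 (l := k)) => //; first exact: uD.
    split; first by move=> [/sk|[_ []//]]; rewrite /mkset ltnNge kl'.
    suff -> : s `|` (u `\ l) `|` [set l] = s `|` u by [].
    apply/seteqP; split=> x /=; first by move=> [[sx|[ux _]]|->]; [left|right|right].
    move=> [sx|ux]; first by left; left.
    by have [->|xl] := pselect (x = l); [right|left; right].
  move: kl; rewrite leq_eqVlt => /predU1P[kl|]; last rewrite ltnS => kl.
    have u0' : u = set0 by rewrite -subset0 => x /uk; rewrite kl /mkset => /andP[h1 h2]; move: h2; rewrite ltnNge h1.
    move: Isu; rewrite u0' setU0 => Is.
    have -> : \bigcup_(t in proper_powset s) A (t `|` set0) = \bigcup_(t in proper_powset s) A t.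
      by apply: eq_bigcupr => t _; rewrite setU0.
    exact: c6.
  have l0 : 0 < l by apply: leq_trans kl; exact: leq_ltn_trans (sk _ s0).
  have [_ _ _ _ /IH F2] := c7 l0.
  apply: (flat_stable F2 (l := k)) => //; first exact: uE.
  by split=> // -[/sk|//]; rewrite /mkset ltnNge kl.
- move=> k u /andP[k0]; rewrite ltnS leq_eqVlt => /predU1P[kl|kl] uk.
    subst k; have [c _ _ _ _] := c7 k0; rewrite (u0 u uk) setU0f //.
    by have -> : (fun s => A (s `|` [set l] `|` set0)) = shift l A by apply: funext => s; rewrite setU0.
  have l0 : 0 < l by exact: ltn_trans kl.
  have [_ _ _ /IH F1 /IH F2] := c7 l0.
  have [ul|nul] := pselect (u l).
    rewrite su //; have -> : (fun s => A (s `|` [set k] `|` u)) = fun s => shift l A (s `|` [set k] `|` (u `\ l)).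
      by apply: funext => s; rewrite -[LHS]/((fun s => A (s `|` u)) _) su.
    by apply: (flat_incl F1); [rewrite k0|exact: uD].
  by apply: (flat_incl F2); [rewrite k0|exact: uE].
- move=> k u /andP[k0]; rewrite ltnS leq_eqVlt => /predU1P[kl|kl] uk.
    subst k; have [_ _ c _ _] := c7 k0; rewrite (u0 u uk) setU0f //.
    by apply: pulls_back_sub c => s [_]; rewrite setU0.
  have l0 : 0 < l by exact: ltn_trans kl.
  have [_ _ _ /IH F1 /IH F2] := c7 l0.
  have [ul|nul] := pselect (u l).
    rewrite su //; have := flat_pull F1 (l := k) (u := u `\ l); rewrite k0 kl => /(_ isT (uD _ _ uk)).
    apply: pulls_back_sub => s [sk Is]; split=> //; split.
      by move=> [/sk|[_ []//]]; rewrite /mkset ltnS leqNgt kl.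
    suff -> : s `|` (u `\ l) `|` [set l] = s `|` u by [].
    apply/seteqP; split=> x /=; first by move=> [[sx|[ux _]]|->]; [left|right|right].
    move=> [sx|ux]; first by left; left.
    by have [->|xl] := pselect (x = l); [right|left; right].
  have := flat_pull F2 (l := k) (u := u); rewrite k0 kl => /(_ isT (uE _ _ kl uk nul)).
  apply: pulls_back_sub => s [sk Is]; split=> //; split=> // -[/sk|//].
  by rewrite /mkset ltnS leqNgt kl.
Qed.

End Flat.

(** ** Amalgamating two systems and a model *)

Lemma elem_sub_exists L (C : structure L) (A : set C) m (X : ('I_m -> C) -> Prop) :
  elem_sub A -> dov A X -> (exists x, X x) -> exists x, (forall i, A (x i)) /\ X x.
Proof.
move=> hA; elim: m X => [|m IH] X dX [x Xx]; first by exists x; split=> // -[].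
have dX1 : dov A (fun y : 'I_1 -> C => exists z : 'I_m -> C, X (vcons (y ord0) z)).
  apply: (@dov_ex _ _ A _ m (fun u => X (vcons (u (inr ord0)) (u \o inl)))).
  have := dov_ren (vcons (inr ord0 : 'I_m + 'I_1) inl) dX; apply: dov_ext => u.
  by rewrite vcons_comp.
have /dovP[k [f [b [Ab fE]]]] := dX1.
have vE y : vcat (fun _ : 'I_1 => y) b = vcons y b :> ('I_k.+1 -> C).
  apply: funext => i; case: (unliftP (ord0 : 'I_k.+1) i) => [j|] ->.
    rewrite vconsS; have -> : lift ord0 j = rshift 1 j by exact: val_inj.
    exact: vcatr.
  rewrite vcons0; have -> : ord0 = lshift k (@ord0 0) by exact: val_inj.
  exact: vcatl.
have [|x0 [Ax0 /=]] := @elem_sub_witness L C A k f b hA Ab.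
  exists (x ord0); rewrite -vE; apply/fE; exists (x \o lift ord0); by rewrite -vcons_eta.
rewrite -vE -fE => hz; have [||z [Az Xz]] := IH (fun z => X (vcons x0 z)).
- apply: (@dov_par _ _ A 'I_m 'I_1 (fun u => X (vcons (u (inr ord0)) (u \o inl))) (fun=> x0)) => //.
  have := dov_ren (vcons (inr ord0 : 'I_m + 'I_1) inl) dX; apply: dov_ext => u.
  by rewrite vcons_comp.
- exact: hz.
exists (vcons x0 z); split=> // i; case: (unliftP ord0 i) => [j|] ->; rewrite ?vcons0 // vconsS; exact: Az.
Qed.

Lemma increasing_enum n (s : set nat) : s `<=` `I_n -> s 0 ->
  exists k (e : nat -> nat), [/\ 0 < k <= n, forall i j, i < j -> e i < e j, e 0 = 0,
    e @` `I_k = s & (~ `I_n `<=` s) -> k < n].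
Proof.
move=> sn s0; pose q := [seq i <- iota 0 n | `[< s i >]].
have qP x : x \in q <-> s x.
  rewrite mem_filter mem_iota /=; split; first by move=> /andP[/asboolP].
  by move=> sx; apply/andP; split; [exact/asboolP|exact: sn].
have qs : sorted ltn q.
  by apply: sorted_filter; [exact: ltn_trans|exact: iota_ltn_sorted].
have qn i : i < size q -> nth 0 q i < n.
  by move=> iq; apply: sn; apply/qP; exact: mem_nth.
have kn : size q <= n by rewrite size_filter (leq_trans (count_size _ _)) // size_iota.
(* Beyond the elements of [s] the enumeration continues above [n], so as to be increasing
   everywhere. *)
pose e i := if i < size q then nth 0 q i else n + i.
have k0 : 0 < size q by have := proj2 (qP 0) s0; case: (q).
have emono i j : i < j -> e i < e j.
  move=> ij; rewrite /e; case: ifP => iq; case: ifP => jq.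
  - by rewrite (sorted_ltn_nth ltn_trans 0 qs).
  - by apply: leq_trans (qn _ iq) _; exact: leq_addr.
  - by rewrite (ltn_trans ij jq) in iq.
  - by rewrite ltn_add2l.
exists (size q), e; split=> //; first by rewrite k0.
- have /(nthP 0)[i iq qi] := proj2 (qP 0) s0.
  case: i iq qi => [|i] iq qi; first by rewrite /e iq.
  by have := emono 0 i.+1 isT; rewrite /e iq qi ltn0.
- apply/seteqP; split=> x.
    by move=> [i iq <-]; apply/qP; rewrite /e iq; exact: mem_nth.
  by move=> /qP/(nthP 0)[i iq <-]; exists i => //; rewrite /e iq.
- move=> ns; rewrite ltn_neqAle kn andbT; apply/eqP => kE; apply: ns => x xn.
  have : all (fun i => `[< s i >]) (iota 0 n) by rewrite all_count size_iota -size_filter kE.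
  by move=> /allP/(_ x); rewrite mem_iota => /(_ xn)/asboolP.
Qed.

Section Amalgam.
Variables (L : vocabulary) (P : symb L) (T : set (sentence L)) (K : Type) (C : structure L).
Let PC := predicate P C.
Hypothesis PC_nonempty : exists x, PC x.
Hypothesis T_k_stable : forall k, k_stable P T K C k.
Local Notation flat := (flat P T K).
Implicit Types (A : set nat -> set C) (I : set (set nat)) (s t u : set nat).
Local Notation PP n := (proper_powset `I_n).

Lemma flat_stable_union n A : flat n (PP n) A -> stable P T K (\bigcup_(s in PP n) A s).
Proof. by move=> FA; apply: T_k_stable; exact: flat_good. Qed.

(** What it takes to glue [A0], [A1] and [M] into a system of dimension [n + 1], with [M] at the
    index [I_n]. The last two fields become its clauses for the new top index. *)
Record amalgam_problem n A0 A1 (M : set C) : Prop := AmalgamProblem {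
  ap_pos : 0 < n;
  ap_flat0 : flat n (PP n) A0;
  ap_flat1 : flat n (PP n) A1;
  ap_model : model K M;
  ap_inter : forall s, PP n s -> A0 s = A1 s `&` M;
  ap_pred : M `&` PC `<=` A0 [set j | 0 < j < n];
  ap_incl : system_incl (powset [set j | 0 < j < n]) A0 A1;
  ap_pull : forall m (f : formula L m) (t : 'I_m -> option (set nat)) (b : 'I_m -> C),
    (forall i, if t i is Some s then PP n s /\ A1 s (b i) else M (b i)) -> sat f b ->
    exists b' : 'I_m -> C, (forall i, if t i is Some s then A0 s (b' i) else b' i = b i) /\ sat f b' }.

Definition amalgam n A0 A1 (M : set C) s : set C :=
  if `[< s n >] then A1 (s `\ n) else if `[< s = `I_n >] then M else A0 s.

Section Fixed.
Variables (n : nat) (A0 A1 : set nat -> set C) (M : set C).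
Hypothesis ap : amalgam_problem n A0 A1 M.
Let Am := amalgam n A0 A1 M.

Let n0 : 0 < n. Proof. exact: (ap_pos ap). Qed.

Let low_proper s : powset [set j | 0 < j < n] s -> PP n s.
Proof. by case: (nice_proper n0) => -[_ h _] _; exact: h. Qed.

Lemma amalgam_top s : s n -> Am s = A1 (s `\ n).
Proof. by move=> sn; rewrite /Am /amalgam asboolT. Qed.

Lemma amalgam_model : Am `I_n = M.
Proof. by rewrite /Am /amalgam asboolF ?asboolT // /mkset ltnn. Qed.

Lemma amalgam_bottom s : PP n s -> Am s = A0 s.
Proof.
move=> [sn ns]; rewrite /Am /amalgam asboolF; last by move=> /sn; rewrite /mkset ltnn.
by rewrite asboolF // => sE; apply: ns; rewrite sE.
Qed.

Lemma proper_cases s : PP n.+1 s -> [\/ s n /\ PP n (s `\ n), s = `I_n | PP n s].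
Proof.
move=> [sn ns]; have [hn|hn] := pselect (s n).
  apply: Or31; split=> //; split.
    by move=> x [/sn + /eqP xn]; rewrite /mkset ltnS leq_eqVlt (negbTE xn).
  move=> h; apply: ns => x; rewrite /mkset ltnS leq_eqVlt => /predU1P[->//|/h[]//].
have sn' : s `<=` `I_n.
  move=> x sx; have := sn _ sx; rewrite /mkset ltnS leq_eqVlt => /predU1P[xn|//].
  by case: hn; rewrite -xn.
have [h|h] := pselect (`I_n `<=` s); [apply: Or32; exact/seteqP|exact: Or33].
Qed.

Lemma A0_sub_M s : PP n s -> A0 s `<=` M.
Proof. by move=> Is; rewrite (ap_inter ap Is) => x []. Qed.

Lemma A0_sub_A1 s : PP n s -> A0 s `<=` A1 s.
Proof. by move=> Is; rewrite (ap_inter ap Is) => x []. Qed.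

Let PPI s t : PP n s -> PP n (s `&` t).
Proof. by case: (nice_proper n0) => -[_ _ h] _ Is; apply: h Is _ => x []. Qed.

Let PPD s : PP n s -> PP n (s `\ 0).
Proof. by case: (nice_proper n0) => -[_ _ h] _ Is; apply: h Is _ => x []. Qed.

(** Stability at the mixed faces, those whose index is [s] with [n] added. It is assumed here and
    obtained by induction on the dimension in [amalgam_stable_union]. *)
Hypothesis face_stable : forall s, PP n s -> s 0 ->
  stable P T K (\bigcup_(t in proper_powset s) A1 t `|` A0 s).

Lemma amalgam_inter_model s : PP n.+1 s -> M `&` Am s = Am (`I_n `&` s).
Proof.
move=> /proper_cases[[sn Is]|->|Is].
- have -> : `I_n `&` s = s `\ n.
    apply/seteqP; split=> x [h1 h2]; split=> //; first by move=> xn; rewrite xn /mkset ltnn in h1.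
    by case: Is => h _; apply: h.
  by rewrite (amalgam_top sn) (amalgam_bottom Is) (ap_inter ap Is) setIC.
- by rewrite setIid amalgam_model setIid.
- have -> : `I_n `&` s = s by case: Is => h _; apply/seteqP; split=> x; [case|move=> sx; split=> //; exact: h].
  by rewrite (amalgam_bottom Is); apply/seteqP; split=> x; [case|move=> h; split=> //; exact: A0_sub_M h].
Qed.

Lemma amalgam_inter s t : PP n.+1 s -> PP n.+1 t -> Am s `&` Am t = Am (s `&` t).
Proof.
have F0 := ap_flat0 ap; have F1 := ap_flat1 ap.
have mix u v : PP n u -> v n -> PP n (v `\ n) -> Am u `&` Am v = Am (u `&` v).
  move=> Iu vn Iv; rewrite (amalgam_top vn) (amalgam_bottom Iu).
  have -> : u `&` v = u `&` (v `\ n).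
    apply/seteqP; split=> x [ux]; last by case.
    by move=> vx; split=> //; split=> // xn; case: Iu => h _; have := h _ ux; rewrite xn /mkset ltnn.
  rewrite (amalgam_bottom (PPI _ Iu)) (ap_inter ap (PPI _ Iu)) -(flat_inter F1 Iu Iv) (ap_inter ap Iu).
  by rewrite -!setIA; congr (_ `&` _); rewrite setIC.
move=> Is It; case: (proper_cases Is) => [[sn Is']|sE|Is'].
- case: (proper_cases It) => [[tn It']|tE|It'].
  + rewrite (amalgam_top sn) (amalgam_top tn) (flat_inter F1 Is' It').
    rewrite (@amalgam_top (s `&` t)) //; congr A1; set_tauto.
  + by rewrite tE amalgam_model setIC (amalgam_inter_model Is) setIC.
  + by rewrite setIC [s `&` t]setIC; exact: mix.
- by rewrite sE amalgam_model (amalgam_inter_model It).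
- case: (proper_cases It) => [[tn It']|tE|It'].
  + exact: mix.
  + by rewrite tE amalgam_model setIC (amalgam_inter_model Is) setIC.
  + by rewrite !amalgam_bottom ?(flat_inter F0) //; exact: PPI.
Qed.

Lemma amalgam_pred s : PP n.+1 s -> Am s `&` PC = Am (s `\ 0).
Proof.
have F0 := ap_flat0 ap; have F1 := ap_flat1 ap.
move=> /proper_cases[[sn Is]|->|Is].
- rewrite (amalgam_top sn) (flat_pred F1 Is) (@amalgam_top (s `\ 0)).
    by congr A1; set_tauto.
  by split=> // n_0; move: n0; rewrite n_0 ltnn.
- rewrite amalgam_model; have lowE : `I_n `\ 0 = [set j | 0 < j < n].
    apply/seteqP; split=> x /=; first by move=> [-> /eqP]; rewrite lt0n => ->.
    by move=> /andP[x0 ->]; split=> // xE; rewrite xE in x0.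
  have Il : PP n [set j | 0 < j < n] by exact: low_proper.
  rewrite lowE (amalgam_bottom Il); apply/seteqP; split; first exact: (ap_pred ap).
  move=> x Ax; split; first exact: A0_sub_M Ax.
  have := flat_pred F0 Il; have -> : [set j | 0 < j < n] `\ 0 = [set j | 0 < j < n].
    by apply/seteqP; split=> y; [case|move=> yl; split=> // y0; rewrite y0 in yl].
  by move=> e; rewrite -e in Ax; case: Ax.
- by rewrite (amalgam_bottom Is) (flat_pred F0 Is) (amalgam_bottom (PPD Is)).
Qed.

Lemma amalgam_is_model s : PP n.+1 s ->
  (~ s 0 -> @elem_incl L C (induced (Am s)) (induced PC) val val) /\ (s 0 -> elem_sub (Am s)).
Proof.
have F0 := ap_flat0 ap; have F1 := ap_flat1 ap.
move=> /proper_cases[[sn Is]|->|Is].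
- rewrite (amalgam_top sn); have [h1 h2] := flat_model F1 Is; split=> s0.
    by apply: h1 => -[].
  by apply: h2; split=> // n_0; move: n0; rewrite -n_0 ltnn.
- by rewrite amalgam_model; split=> // _; case: (ap_model ap).
- by rewrite (amalgam_bottom Is); exact: (flat_model F0 Is).
Qed.

Lemma amalgam_small s : PP n.+1 s -> small K (Am s).
Proof.
move=> /proper_cases[[sn Is]|->|Is].
- by rewrite (amalgam_top sn); exact: (flat_small (ap_flat1 ap) Is).
- by rewrite amalgam_model; case: (ap_model ap).
- by rewrite (amalgam_bottom Is); exact: (flat_small (ap_flat0 ap) Is).
Qed.

Let drop_top u l : u `<=` [set j | l <= j < n.+1] -> u `\ n `<=` [set j | l <= j < n].
Proof.
move=> uk x [ux /eqP xl]; have /andP[kx] := uk _ ux; rewrite /mkset kx ltnS leq_eqVlt.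
by rewrite (negbTE xl).
Qed.

Let no_top u l : u `<=` [set j | l <= j < n.+1] -> ~ u n -> u `<=` [set j | l <= j < n].
Proof.
move=> uk nun x ux; have /andP[kx] := uk _ ux; rewrite /mkset kx ltnS leq_eqVlt => /predU1P[xn|//].
by case: nun; rewrite -xn.
Qed.

Let top_minus s u l : s `<=` `I_l -> l <= n -> u n -> (s `|` u) `\ n = s `|` (u `\ n).
Proof.
move=> sl ln un; apply/seteqP; split=> x /=; first by move=> [[sx|ux] xn]; [left|right].
move=> [sx|[ux xn]]; split=> //; [by left| |by right].
by move=> xn; have := sl _ sx; rewrite xn /mkset ltnNge ln.
Qed.

Let proper_minus s u l : s `<=` `I_l -> l <= n -> u n -> PP n.+1 (s `|` u) -> PP n (s `|` (u `\ n)).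
Proof.
move=> sl ln un /proper_cases[[_]|sE|[h _]]; first by rewrite (top_minus sl ln un).
  have : (s `|` u) n by right.
  by rewrite sE /mkset ltnn.
by have := h n (or_intror un); rewrite /mkset ltnn.
Qed.

Lemma amalgam_stable l u s : l <= n.+1 -> u `<=` [set j | l <= j < n.+1] -> s `<=` `I_l -> s 0 ->
  PP n.+1 (s `|` u) -> stable P T K (\bigcup_(t in proper_powset s) Am (t `|` u)).
Proof.
have F0 := ap_flat0 ap; have F1 := ap_flat1 ap.
move=> ln ul sl s0 Isu; have [un|nun] := pselect (u n).
  have ln' : l <= n by case/andP: (ul _ un).
  have -> : \bigcup_(t in proper_powset s) Am (t `|` u) = \bigcup_(t in proper_powset s) A1 (t `|` (u `\ n)).
    apply: eq_bigcupr => t [ts _]; rewrite amalgam_top; last by right.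
    by rewrite (top_minus (l := l)) //; exact: subset_trans sl.
  apply: (flat_stable F1 (l := l)) => //; [exact: drop_top|exact: (proper_minus sl)].
have {}ul := no_top ul nun.
have [sn|nsn] := pselect (s n).
  (* If [s] contains [n], no index is left for [u], and the proper subsets of [s] make up a mixed
     face. *)
  have l1 : l = n.+1.
    by apply/eqP; rewrite eqn_leq ln /=; exact: sl.
  have u0 : u = set0.
    rewrite -subset0 => x /ul; rewrite l1 /mkset => /andP[h1 h2].
    by move: (ltn_trans h1 h2); rewrite ltnn.
  move: Isu; rewrite u0 setU0 => /proper_cases[[_ Is]|sE|[h _]]; last 2 first.
  - by move: sn; rewrite sE /mkset ltnn.
  - by have := h _ sn; rewrite /mkset ltnn.
  have -> : \bigcup_(t in proper_powset s) Am (t `|` set0) =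
      \bigcup_(t in proper_powset (s `\ n)) A1 t `|` A0 (s `\ n).
    apply/seteqP; split=> x.
      move=> [t [ts nst]]; rewrite setU0; have [tn|ntn] := pselect (t n).
        rewrite (amalgam_top tn) => Ax; left; exists (t `\ n) => //; split.
          by move=> y [ty yn]; split=> //; exact: ts.
        move=> h; apply: nst => y sy; have [->//|yn] := pselect (y = n).
        by have [] := h y (conj sy yn).
      have tsn : t `<=` s `\ n by move=> y ty; split; [exact: ts|move=> yn; apply: ntn; rewrite -yn].
      have It : PP n t by case: (nice_proper n0) => -[_ _ h] _; exact: h tsn.
      by rewrite (amalgam_bottom It) => Ax; right; exact: (flat_mono F0 Is tsn).
    case=> [[t [ts nst] Ax]|Ax].
      exists (t `|` [set n]).
        split=> [y [/ts[]//|->//]|h]; apply: nst => y [sy yn].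
        by have [|//] := h y sy.
      rewrite setU0 amalgam_top; last by right.
      have -> : (t `|` [set n]) `\ n = t; last by [].
      apply/seteqP; split=> y /=; first by move=> [[]].
      by move=> ty; split; [left|case: (ts _ ty)].
    exists (s `\ n); last by rewrite setU0 (amalgam_bottom Is).
    by split=> [y []//|h]; have [_] := h _ sn; apply.
  by apply: face_stable => //; split=> // n_0; move: n0; rewrite -n_0 ltnn.
have sn : s `<=` `I_n.
  move=> x sx; have := leq_trans (sl _ sx) ln; rewrite /mkset ltnS leq_eqVlt => /predU1P[xn|//].
  by case: nsn; rewrite -xn.
have sun : s `|` u `<=` `I_n by move=> x [/sn//|/ul/andP[]].
have -> : \bigcup_(t in proper_powset s) Am (t `|` u) = \bigcup_(t in proper_powset s) A0 (t `|` u).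
  apply: eq_bigcupr => t [ts nst]; apply: amalgam_bottom; split.
    by move=> x [/ts/sn//|ux]; apply: sun; right.
  move=> h; apply: nst => x sx; have [//|ux] := h _ (sn _ sx).
  by have := sl _ sx; have /andP[lx _] := ul _ ux; rewrite /mkset ltnNge lx.
pose l' := if l <= n then l else n.
have l'n : l' <= n by rewrite /l'; case: ifP.
have sl' : s `<=` `I_l' by rewrite /l'; case: ifP.
have ul' : u `<=` [set j | l' <= j < n].
  move=> x /ul; rewrite /l'; case: ifP => // /negbT; rewrite -ltnNge => nl /andP[h1 h2].
  by rewrite /mkset h2 andbT ltnW // (leq_trans nl).
(* When [s] and [u] exhaust [I_n], their union indexes [M] and not a set of [A0]. Then [s] is
   [I_l'], its proper subsets index a good system of dimension [l'], and [l']-stability applies. *)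
have [h|h] := pselect (`I_n `<=` s `|` u); last exact: (flat_stable F0 (l := l')).
have l'0 : 0 < l' := leq_ltn_trans (leq0n _) (sl' _ s0).
have sE : s = `I_l'.
  apply/seteqP; split=> // x xl; have [//|/ul'/andP[lx _]] := h x (leq_trans xl l'n).
  by move: xl; rewrite /mkset ltnNge lx.
have := flat_sub (l := l') (u := u) _ ul' F0; rewrite l'0 l'n => /(_ isT).
have -> : [set s | s `<=` `I_l' /\ PP n (s `|` u)] = PP l'.
  apply/seteqP; split=> t [tl ht]; split=> //.
    move=> h'; case: ht => _; apply; apply: subset_trans h _ => x [|ux]; last by right.
    by rewrite sE => /h' tx; left.
  split; first by move=> x [/tl xl|/ul'/andP[]//]; exact: leq_trans xl l'n.
  move=> h'; apply: ht => x xl; have [//|/ul'/andP[lx _]] := h' x (leq_trans xl l'n).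
  by move: xl; rewrite /mkset ltnNge lx.
by rewrite sE => /flat_stable_union.
Qed.

Lemma amalgam_incl l u : 0 < l < n.+1 -> u `<=` [set j | l < j < n.+1] ->
  system_incl (powset [set j | 0 < j < l]) (fun s => Am (s `|` u)) (fun s => Am (s `|` [set l] `|` u)).
Proof.
have F0 := ap_flat0 ap; have F1 := ap_flat1 ap.
move=> /andP[l0]; rewrite ltnS leq_eqVlt => /predU1P[ln|ln] ul.
  have u0 : u = set0.
    rewrite -subset0 => x /ul; rewrite ln /mkset => /andP[h1 h2].
    by move: (leq_trans h2 h1); rewrite ltnn.
  rewrite u0 ln; apply: system_incl_eq (ap_incl ap) => s sl; rewrite setU0.
    by rewrite amalgam_bottom //; exact: low_proper.
  rewrite amalgam_top; last by right.
  congr A1; apply/seteqP; split=> x /=; last by move=> [[]].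
  move=> sx; split; first by left.
  by move=> xn; have := sl _ sx; rewrite xn /mkset ltnn andbF.
have lown x s : powset [set j | 0 < j < l] s -> s x -> 0 < x < n.
  by move=> sl /sl/andP[-> xl]; exact: ltn_trans ln.
have [un|nun] := pselect (u n).
  have h := flat_incl F1 (l := l) (u := u `\ n); move: h; rewrite l0 ln => /(_ isT (drop_top ul)).
  apply: system_incl_eq => s sl; rewrite amalgam_top; try by right.
    rewrite (top_minus (l := l)) // 1?ltnW // => x /sl/andP[]//.
  rewrite (top_minus (l := l.+1)) // => x [/sl/andP[_ xl]|->]; rewrite /mkset ?ltnSn //; exact: ltnW.
have {}ul := no_top ul nun.
have ulow x : u x -> 0 < x < n by move=> /ul/andP[lx ->]; rewrite (ltn_trans l0 lx).
have h := flat_incl F0 (l := l) (u := u); move: h; rewrite l0 ln => /(_ isT ul).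
apply: system_incl_eq => s sl; rewrite amalgam_bottom //; apply: low_proper => x.
  by move=> [/(lown _ _ sl)//|/ulow].
by move=> [[/(lown _ _ sl)//|->]|/ulow//]; rewrite /mkset l0.
Qed.

Lemma A0_nonempty : exists x, forall s, PP n s -> A0 s x.
Proof.
have F0 := ap_flat0 ap; have [[_ lowI down] _] := nice_proper n0.
have I0 : PP n set0 by apply: lowI.
have [h _] := flat_model F0 I0; have {}h := h (fun f => f).
have /(elem_incl_satr (@interp L C) (@interp L C))[_ H] := h.
have [x0 Px0] := PC_nonempty.
have : ~ satr (@interp L C) (A0 set0) (fAll (fBot L 1)) (fun i : 'I_0 => match notF (ltn_ord i) with end).
  by move=> /H hP; apply: (hP _ x0 Px0) => -[].
move=> /existsNP[x /not_implyP[Ax _]]; exists x => s Is.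
by apply: (flat_mono F0 Is (s := set0)).
Qed.

(** At [l = n] this is [ap_pull], and if [u] contains [n] it is the clause of [A1]. Otherwise
    coordinates from [M] are quantified away, the rest is pulled back within [A0], and the
    quantifier is witnessed in the model [A0 N], where [N] is [I_n] without [l]; it is a model of
    [T] as [l] is not 0. *)
Lemma amalgam_pull l u : 0 < l < n.+1 -> u `<=` [set j | l < j < n.+1] ->
  pulls_back l [set s | s `<=` `I_l.+1 /\ PP n.+1 (s `|` u)] (fun s => Am (s `|` u)).
Proof.
have F0 := ap_flat0 ap; have F1 := ap_flat1 ap.
move=> /andP[l0]; rewrite ltnS leq_eqVlt => /predU1P[ln|ln] ul m f t b tb sb.
  have u0 : u = set0.
    rewrite -subset0 => x /ul; rewrite ln /mkset => /andP[h1 h2].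
    by move: (leq_trans h2 h1); rewrite ltnn.
  subst l; rewrite u0 in tb *.
  pose t' i := if `[< t i n >] then Some (t i `\ n) else None.
  have [i|b' [h1 h2]] := ap_pull ap (t := t') (b := b) _ sb.
    have [[_ It] Ab] := tb i; rewrite setU0 in It Ab; rewrite /t'.
    case: asboolP => tn; case: (proper_cases It) => [[tn' It']|tE|It'] //.
    - by split=> //; rewrite (amalgam_top tn) in Ab.
    - by move: tn; rewrite tE /mkset ltnn.
    - by case: It' => h _; have := h _ tn; rewrite /mkset ltnn.
    - by move: Ab; rewrite tE amalgam_model.
    - by move: Ab; rewrite (amalgam_bottom It'); exact: A0_sub_M.
  exists b'; split=> // i; last by move=> tn; have := h1 i; rewrite /t' asboolF.
  have [[_ It] Ab] := tb i; rewrite setU0 in It Ab; rewrite setU0; have := h1 i; rewrite /t'.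
  case: asboolP => tn; case: (proper_cases It) => [[tn' It']|tE|It'] //.
  - by rewrite (amalgam_bottom It').
  - by move: tn; rewrite tE /mkset ltnn.
  - by case: It' => h _; have := h _ tn; rewrite /mkset ltnn.
  - by move=> ->; have -> : t i `\ n = t i by apply/seteqP; split=> x; [case|move=> tx; split=> // xn; apply: tn; rewrite -xn].
  - by move=> ->; have -> : t i `\ n = t i by apply/seteqP; split=> x; [case|move=> tx; split=> // xn; apply: tn; rewrite -xn].
have [un|nun] := pselect (u n).
  have := flat_pull F1 (l := l) (u := u `\ n); rewrite l0 ln => /(_ isT (drop_top ul)) H.
  have [i|b' [h1 h2 h3]] := H m f t b _ sb.
    have [[tl It] Ab] := tb i; split; first by split=> //; exact: (proper_minus tl).
    by rewrite amalgam_top in Ab; [rewrite (top_minus tl) in Ab|right].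
  exists b'; split=> // i; rewrite amalgam_top; last by right.
  by have [[tl _] _] := tb i; rewrite (top_minus (l := l.+1)) // => x [/tl].
have {}ul := no_top ul nun.
have nul : ~ u l by move=> /ul; rewrite /mkset ltnn.
pose isM i := t i `|` u = `I_n.
have [a0 Aa0] := A0_nonempty.
have Iu : PP n u by apply: low_proper => x /ul/andP[lx xn]; rewrite /mkset xn (ltn_trans l0 lx).
have Pt i : ~ isM i -> PP n (t i `|` u).
  move=> nM; have [[tl It] _] := tb i; case: (proper_cases It) => [[[tn|un] _]|tE|//] //.
  by have := tl _ tn; rewrite /mkset ltnS leqNgt ln.
pose merge (x y : 'I_m -> C) i := if `[< isM i >] then x i else y i.
have dg : @dfn L C 'I_m (fun y => exists x : 'I_m -> C, sat f (merge x y)).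
  apply: (@dfn_ex _ _ 'I_m m (fun w => sat f (merge (w \o inl) (w \o inr)))).
  exists m, f, (fun i => if `[< isM i >] then inl i else inr i) => w.
  have -> // : merge (w \o inl) (w \o inr) = w \o (fun i => if `[< isM i >] then inl i else inr i).
  by apply: funext => i; rewrite /merge /=; case: asboolP.
(* For the pull-back the coordinates from [M] are dummies, filled by an element common to all sets
   of [A0]. *)
pose t' i := if `[< isM i >] then set0 else t i.
pose b0 i := if `[< isM i >] then a0 else b i.
have [g gE] : exists g : formula L m, forall y, (exists x : 'I_m -> C, sat f (merge x y)) <-> sat g y.
  by have [k [g [r gE]]] := dg; exists (ren g r) => y; rewrite sat_ren gE.
have := flat_pull F0 (l := l) (u := u); rewrite l0 ln => /(_ isT ul) H.
have [i||b' [h1 h2 h3]] := H m g t' b0.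
- rewrite /t' /b0; case: asboolP => Mi; first by split; [split=> //; rewrite set0U|rewrite set0U; exact: Aa0].
  have [[tl It] Ab] := tb i; split; first by split=> //; exact: Pt.
  by rewrite (amalgam_bottom (Pt _ Mi)) in Ab.
- apply/gE; exists b; suff -> : merge b b0 = b by [].
  by apply: funext => i; rewrite /merge /b0; case: asboolP.
pose N := `I_n `\ l.
have PN : PP n N by split=> [x []//|h]; have [_] := h l ln; apply.
have NE : elem_sub (A0 N).
  by have [_] := flat_model F0 PN; apply; split=> // l_0; move: l0; rewrite -l_0 ltnn.
have b'N i : ~ isM i -> A0 N (b' i).
  move=> Mi; have := h1 i; rewrite /t' asboolF //; apply: (flat_mono F0 PN).
  have [h _] := Pt _ Mi.
  move=> x [[tx xl]|ux]; split=> //; [by apply: h; left|by apply: h; right|].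
  by move=> xl; apply: nul; rewrite -xl.
have [|x [Nx sx]] := @elem_sub_exists L C (A0 N) m (fun x => sat f (merge x b')) NE _ (proj2 (gE _) h3).
  pose b1 i := if `[< isM i >] then a0 else b' i.
  apply: (@dov_ext _ _ _ _ (fun x => sat f (merge x b1))).
    move=> x; suff -> : merge x b1 = merge x b' by [].
    by apply: funext => i; rewrite /merge /b1; case: asboolP.
  apply: (@dov_par _ _ (A0 N) 'I_m 'I_m (fun w => sat f (merge (w \o inl) (w \o inr)))).
    by move=> i; rewrite /b1; case: asboolP => // Mi; [exact: Aa0|exact: b'N].
  apply: dov_dfn; exists m, f, (fun i => if `[< isM i >] then inl i else inr i) => w.
  have -> // : merge (w \o inl) (w \o inr) = w \o (fun i => if `[< isM i >] then inl i else inr i).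
  by apply: funext => i; rewrite /merge /=; case: asboolP.
exists (merge x b'); split=> // i; rewrite /merge; case: asboolP => Mi.
- have -> : (t i `\ l) `|` u = N.
    rewrite /N -Mi; apply/seteqP; split=> y /=.
      by move=> [[ty yl]|uy]; split=> //; [left|right|move=> yl; apply: nul; rewrite -yl].
    by move=> [[ty|uy] yl]; [left|right].
  by rewrite (amalgam_bottom PN).
- have It' : PP n ((t i `\ l) `|` u).
    case: (nice_proper n0) => -[_ _ down] _; apply: down (Pt _ Mi) _.
    by move=> y [[ty _]|uy]; [left|right].
  by rewrite (amalgam_bottom It'); have := h1 i; rewrite /t' asboolF.
- move=> tl; have : (t i `|` u) l by rewrite Mi.
  by case.
- by move=> tl; have := h2 i; rewrite /t' /b0 asboolF //; apply.
Qed.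

Lemma amalgam_flat : flat n.+1 (PP n.+1) Am.
Proof.
split; [exact: nice_proper|exact: amalgam_small|exact: amalgam_inter|exact: amalgam_is_model|
  exact: amalgam_pred|exact: amalgam_stable|exact: amalgam_incl|exact: amalgam_pull].
Qed.

Lemma amalgam_union : \bigcup_(s in PP n.+1) Am s = \bigcup_(s in PP n) A1 s `|` M.
Proof.
have nE (s : set nat) : PP n s -> PP n.+1 (s `|` [set n]) /\ (s `|` [set n]) `\ n = s.
  move=> [sn ns]; split; [split|].
  - by move=> x [/sn xn|->]; rewrite /mkset ?ltnSn // ltnS ltnW.
  - move=> h; apply: ns => x xn; have [//|xE] := h x (ltnW xn).
    by move: xn; rewrite xE /mkset ltnn.
  - apply/seteqP; split=> x /=; first by move=> [[]].
    by move=> sx; split; [left|move=> xE; have := sn _ sx; rewrite xE /mkset ltnn].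
apply/seteqP; split=> x.
  move=> [s /proper_cases[[sn Is]|->|Is]].
  - by rewrite (amalgam_top sn) => Ax; left; exists (s `\ n).
  - by rewrite amalgam_model; right.
  - by rewrite (amalgam_bottom Is) => Ax; left; exists s => //; exact: A0_sub_A1.
case=> [[s Is Ax]|Mx].
  have [Is' sE] := nE _ Is; exists (s `|` [set n]) => //.
  by rewrite amalgam_top ?sE //; right.
exists `I_n; last by rewrite amalgam_model.
split; first by move=> y yn; rewrite /mkset ltnS ltnW.
by move=> /(_ n (ltnSn n)); rewrite /mkset ltnn.
Qed.

End Fixed.

(** Induction on [n]. With [s] renumbered along [e], a mixed face is the union of an amalgam of
    dimension [k + 1] whose model is [A0 s], where [k < n]; stability of this union is an instance
    of [k_stable]. *)
Lemma amalgam_stable_union n A0 A1 M : amalgam_problem n A0 A1 M ->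
  flat n.+1 (PP n.+1) (amalgam n A0 A1 M).
Proof.
elim/ltn_ind: n A0 A1 M => n IH A0 A1 M ap; apply: amalgam_flat => // s Is s0.
have F0 := ap_flat0 ap; have F1 := ap_flat1 ap.
have [sn ns] := Is; have [k [e [/andP[k0 kn] emono e0 eE kn']]] := increasing_enum sn s0.
have {}kn' := kn' ns; have einj : injective e.
  by move=> i j eij; case: (ltngtP i j) => // /emono; rewrite eij ltnn.
have esub t : PP k t -> e @` t `<=` s by move=> [tk _]; rewrite -eE; exact: image_subset.
have eI t : PP k t -> PP n (e @` t).
  by case: (nice_proper (ap_pos ap)) => -[_ _ down] _ It; apply: down Is _; exact: esub.
have ek i : i < k -> e i < n.
  by move=> ik; apply: sn; rewrite -eE; exists i.
have re A : flat n (PP n) A -> flat k (PP k) (fun t => A (e @` t)).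
  by move=> FA; apply: (flat_reindex emono e0 ek kn _ eI FA); exact: nice_proper.
have ap' : amalgam_problem k (fun t => A0 (e @` t)) (fun t => A1 (e @` t)) (A0 s).
  split=> //; [exact: re|exact: re| | | | |].
  - by split; [exact: (flat_small F0 Is)|have [_] := flat_model F0 Is; exact].
  - move=> t It; apply/seteqP; split=> x.
      by move=> Ax; split; [exact: (A0_sub_A1 ap (eI _ It))|exact: (flat_mono F0 Is (esub _ It))].
    by move=> [Ax Mx]; rewrite (ap_inter ap (eI _ It)); split=> //; exact: (A0_sub_M ap Is).
  - rewrite (flat_pred F0 Is); have -> // : s `\ 0 = e @` [set j | 0 < j < k].
    rewrite -eE; apply/seteqP; split=> x /=.
      move=> [[i ik <-] ei]; exists i => //; apply/andP; split=> //.
      by case: (posnP i) => // i0; case: ei; rewrite i0.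
    move=> [i /andP[i0 ik] <-]; split; first by exists i.
    by rewrite -e0 => /einj i_0; rewrite i_0 in i0.
  - have [ss ssP] := powset_enum k.
    have low t : powset [set j | 0 < j < k] t -> powset [set j | 0 < j < n] (e @` t).
      by move=> tl _ [x /tl/andP[x0 xl] <-]; rewrite /mkset -{1}e0 emono //= ek.
    have := system_incl_reduct (g := fun s => e @` s) low ssP _ (ap_incl ap); apply.
    move=> t tl; apply: (A0_sub_A1 ap).
    by case: (nice_proper (ap_pos ap)) => -[_ h _] _; exact: h.
  - move=> m f t b tb sb.
    have [i|b' [h1 h2]] := ap_pull ap (t := fun i => omap (fun u => e @` u) (t i)) (b := b) _ sb.
      have := tb i; case: (t i) => [u [Iu Ab]|] /=; first by split=> //; exact: eI.
      exact: (A0_sub_M ap Is).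
    by exists b'; split=> // i; have := h1 i; case: (t i).
have := flat_stable_union (IH k kn' _ _ _ ap'); rewrite (amalgam_union ap').
have -> // : \bigcup_(t in PP k) A1 (e @` t) = \bigcup_(t in proper_powset s) A1 t.
apply/seteqP; split=> x.
  move=> [t [tk nkt] Ax]; exists (e @` t) => //; split; first exact: esub.
  move=> h; apply: nkt => i ik; have [|j tj /einj <-] := h (e i); last by [].
  by rewrite -eE; exists i.
move=> [t [ts nst] Ax]; exists [set i | i < k /\ t (e i)].
  split=> [i []//|h]; apply: nst => y; rewrite -eE => -[i ik <-].
  by have [] := h i ik.
have -> // : e @` [set i | i < k /\ t (e i)] = t.
apply/seteqP; split=> [_ [i [_ ti] <-]//|y ty].
have := ts _ ty; rewrite -eE => -[i ik ei]; exists i => //; split=> //.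
by rewrite ei.
Qed.

End Amalgam.

(** ** Atomicity *)

Section Atomic.
Variables (L : vocabulary) (C : structure L).
Implicit Types (D E X : set C).

Definition atomic_over E E0 X := forall p (x : 'I_p -> C), (forall i, X (x i)) ->
  isolated_over E E0 x.

Lemma dov_forall_fin D V m (R : 'I_m -> (V -> C) -> Prop) :
  (forall i, dov D (R i)) -> dov D (fun v => forall i, R i v).
Proof.
elim: m R => [|m IH] R hR.
  apply: dov_ext (dov_not (dov_dfn D (@dfn_bot L C V))) => v.
  by split=> _ [].
apply: dov_ext (dov_and (hR ord0) (IH _ (fun i => hR (lift ord0 i)))) => v.
split=> [[R0 RS] i|H]; last by split.
by case: (unliftP ord0 i) => [j|] ->.
Qed.

Lemma dov_eq D V (i j : V) : @dov L C D V (fun v => v i = v j).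
Proof.
apply: dov_dfn; exists 2, (fEq L ord0 (lift ord0 ord0)), (vcons i (fun=> j)) => v /=.
by rewrite vcons0 vconsS.
Qed.

Lemma dov_eqc D V (i : V) (d : C) : D d -> @dov L C D V (fun v => v i = d).
Proof.
move=> Dd; apply: (@dov_par _ _ D V 'I_1 (fun u => u (inl i) = u (inr ord0)) (fun=> d)) => //.
exact: dov_eq.
Qed.

Lemma isolated_constant E D p (x : 'I_p -> C) : (forall i, D (x i)) -> isolated_over E D x.
Proof.
move=> Dx k f; exists (fun z => forall i, z i = x i); split=> //.
  by apply: dov_forall_fin => i; exact: dov_eqc.
move=> b _; have zE z : (forall i, z i = x i) -> z = x by move=> h; exact: funext.
by have [s|s] := pselect (sat f (vcat x b)); [left|right] => z /zE ->.
Qed.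

(** Equations tie the coordinates of [y] to those of [x] or to constants; projecting the formula for
    [x] along them isolates [y]. The element [x0] fills the constant places of tied coordinates. *)
Lemma isolated_mix E E0 q p (x : 'I_q -> C) (y : 'I_p -> C) : E0 `<=` E -> E !=set0 ->
  isolated_over E E0 x -> (forall i, E0 (y i) \/ exists j, y i = x j) ->
  isolated_over E E0 y.
Proof.
move=> EE [x0 Ex0] iso yX k f.
have /choice[g gP] : forall i, exists o : option 'I_q, if o is Some j then y i = x j else E0 (y i).
  by move=> i; case: (yX i) => [h|[j h]]; [exists None|exists (Some j)].
pose r (u : 'I_(p + k)) : 'I_(q + (p + k)) := match fintype.split u with
  | inl i => if g i is Some j then lshift (p + k) j else rshift q (lshift k i)
  | inr j => rshift q (rshift p j) end.
have [Z [dZ Zx dec]] := iso _ (ren f r).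
pose y' i := if g i is Some _ then x0 else y i.
pose link (z : 'I_p -> C) (w : 'I_q -> C) i := if g i is Some j then z i = w j else z i = y i.
have rE z w b : (forall i, link z w i) -> vcat w (vcat y' b) \o r = vcat z b.
  move=> h; apply: funext => u /=; rewrite [RHS]/vcat /r; case: (fintype.split u) => i; last by rewrite !vcatr.
  have := h i; rewrite /link; case gi : (g i) => [j|] ->; first by rewrite vcatl.
  by rewrite vcatr vcatl /y' gi.
exists (fun z => exists w : 'I_q -> C, Z w /\ forall i, link z w i); split.
- apply: (@dov_ex _ _ E0 _ q (fun u => Z (u \o inl) /\ forall i, link (u \o inr) (u \o inl) i)).
  apply: dov_and; first exact: dov_ren.
  apply: dov_forall_fin => i; rewrite /link; have := gP i; case: (g i) => [j _|yi]; first exact: dov_eq.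
  exact: dov_eqc.
- by exists x; split=> // i; rewrite /link; have := gP i; case: (g i).
- move=> b Eb; have Eb' i : E (vcat y' b i).
    rewrite /vcat; case: fintype.split => // j; rewrite /y'; have := gP j.
    by case: (g j) => // h; exact: EE.
  by case: (dec _ Eb') => h; [left|right] => z [w [Zw hz]]; have := h w Zw; rewrite sat_ren (rE z).
Qed.

(** If [th(z, e)] isolates [x], then that it implies [f], or the negation of [f], is a formula about
    [e] and the parameters of [f]. Formulas over [E0] true of [e] decide these two; quantifying [e]
    away leaves a formula over [E0] that decides [f]. *)
Lemma isolated_trans E E0 X m (x : 'I_m -> C) :
  atomic_over E E0 X -> isolated_over E X x -> isolated_over E E0 x.
Proof.
move=> atX isox k f; have [Z [dZ Zx dec]] := isox k f.
have /dovP[p [th [e [Xe thE]]]] := dZ.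
have mkf (S : ('I_(p + k) -> C) -> Prop) : dfn S -> exists g : formula L (p + k), forall v, S v <-> sat g v.
  by move=> [n [g [r gE]]]; exists (ren g r) => v; rewrite sat_ren gE.
pose body (u : 'I_m + 'I_(p + k) -> C) (s : Prop) := sat th (vcat (u \o inl) (u \o inr \o @lshift p k)) -> s.
have dbody neg : @dfn L C _ (fun v : 'I_(p + k) -> C => forall z : 'I_m -> C,
    sat th (vcat z (v \o @lshift p k)) ->
      if neg then ~ sat f (vcat z (v \o @rshift p k)) else sat f (vcat z (v \o @rshift p k))).
  apply: (@dfn_all _ _ _ m (fun u => sat th (vcat (u \o inl) (u \o inr \o @lshift p k)) ->
    if neg then ~ sat f (vcat (u \o inl) (u \o inr \o @rshift p k))
    else sat f (vcat (u \o inl) (u \o inr \o @rshift p k)))).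
  apply: dfn_imp.
    by exists (m + p), th, (vcat inl (inr \o @lshift p k)) => v; rewrite vcat_comp.
  have df : @dfn L C ('I_m + 'I_(p + k)) (fun u => sat f (vcat (u \o inl) (u \o inr \o @rshift p k))).
    by exists (m + k), f, (vcat inl (inr \o @rshift p k)) => v; rewrite vcat_comp.
  by case: neg => //; exact: dfn_not.
have [g gE] := mkf _ (dbody false); have [h hE] := mkf _ (dbody true).
have vl (a : 'I_p -> C) (b : 'I_k -> C) : vcat a b \o @lshift p k = a by apply: funext => i; exact: vcatl.
have vr (a : 'I_p -> C) (b : 'I_k -> C) : vcat a b \o @rshift p k = b by apply: funext => i; exact: vcatr.
have [Y [dY Ye Ydec]] := atX _ e Xe _ g.
have [Y' [dY' Ye' Ydec']] := atX _ e Xe _ h.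
exists (fun z => exists e' : 'I_p -> C, (Y e' /\ Y' e') /\ sat th (vcat z e')); split.
- apply: (@dov_ex _ _ E0 _ p (fun u => (Y (u \o inl) /\ Y' (u \o inl)) /\ sat th (vcat (u \o inr) (u \o inl)))).
  apply: dov_and; first by apply: dov_and; exact: dov_ren.
  by apply: dov_dfn; exists (m + p), th, (vcat inr inl) => v; rewrite vcat_comp.
- by exists e; split=> //; apply/thE.
- move=> b Eb; case: (dec b Eb) => hb; [left|right] => z [e' [[Ye1 Ye2] sz]].
    have se : sat g (vcat e b) by apply/gE; rewrite vl vr => w /thE; exact: hb.
    case: (Ydec b Eb) => hY; last by case: (hY e Ye).
    by have /gE := hY e' Ye1; rewrite vl vr; apply.
  have se : sat h (vcat e b) by apply/hE; rewrite vl vr => w /thE; exact: hb.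
  case: (Ydec' b Eb) => hY; last by case: (hY e Ye').
  by have /hE := hY e' Ye2; rewrite vl vr; apply.
Qed.

Lemma atomic_trans E E' E0 X Y : E `<=` E' -> atomic_over E E0 X -> atomic_over E' X Y ->
  atomic_over E E0 Y.
Proof.
move=> EE atX atY p x Yx; apply: (isolated_trans atX).
by apply: isolated_over_sub (atY _ _ Yx).
Qed.

(** A finite tuple lies in [D] and the sequence up to the largest index it uses, so induction along
    the order and [isolated_trans] apply. *)
Lemma atomic_sequence D (W : Type) (lt : W -> W -> Prop) (d : W -> C) :
  well_ordered lt -> D !=set0 ->
  (forall i, isolated_over (D `|` d @` [set j | lt j i]) (D `|` d @` [set j | lt j i]) (fun _ : 'I_1 => d i)) ->
  atomic_over D D (D `|` range d).
Proof.
move=> wo [d0 Dd0] iso.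
have union (S : set W) : (forall j, S j -> atomic_over D D ((D `|` d @` [set i | lt i j]) `|` [set d j])) ->
    atomic_over D D (D `|` d @` S).
  move=> hS p x Sx.
  have [[i ni]|no] := pselect (exists i, ~ D (x i)); last first.
    by apply: isolated_constant => i; apply: contrapT => ni; apply: no; exists i.
  have [w0 _] : exists w : W, True by have [//|[w _ _]] := Sx i; exists w.
  have /choice[g gP] : forall i, exists w, ~ D (x i) -> S w /\ d w = x i.
    move=> i'; have [h|h] := pselect (D (x i')); first by exists w0.
    by have [//|[w Sw dw]] := Sx i'; exists w.
  have [|j [_ nj jmax]] := max_in_list (R := 'I_p) g (Q := fun i => ~ D (x i)) (l := enum 'I_p) wo.
    by exists i => //; exact: mem_enum.
  have [Sgj dgj] := gP j nj; apply: (hS _ Sgj) => i'.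
  have [h|h] := pselect (D (x i')); first by left; left.
  have [Sg dg] := gP i' h; have [ij|ij] := jmax i' (mem_enum _ _) h; last by right; rewrite /= -ij dg.
  by left; right; exists (g i').
have main i : atomic_over D D ((D `|` d @` [set j | lt j i]) `|` [set d i]).
  elim/(well_founded_induction (wo_wf wo)): i => i IH.
  have atXi : atomic_over D D (D `|` d @` [set j | lt j i]) by apply: union => j /IH.
  move=> p x hx; apply: (isolated_trans atXi).
  apply: (@isolated_over_sub L C (D `|` d @` [set j | lt j i]) D _ _ p x _ (fun _ h => h)); first by move=> z; left.
  apply: isolated_mix (iso i) _ => //; first by exists d0; left.
  by move=> j; case: (hx j) => h; [left|right; exists ord0].
by apply: union => j _; exact: main.
Qed.

End Atomic.

Lemma constructible_atomic L (P : symb L) K (C : structure L) (M D : set C) : D !=set0 ->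
  locally_constructible P K M D -> atomic_over D D M.
Proof.
move=> D0 [_ _ _ [W [le [d [wo -> iso]]]]].
apply: (atomic_sequence (well_ordered_of wo) D0) => i.
by have /locally_isolatedP := iso i.
Qed.

(** * Skolem hulls *)

Definition requirement (X : Type) :=
  {k : nat & {p : nat & ('I_k -> X) -> ('I_p -> X) -> Prop}}.
Definition req X k p (R : ('I_k -> X) -> ('I_p -> X) -> Prop) : requirement X :=
  existT _ k (existT _ p R).

Definition closed_for X (E Y : set X) (q : requirement X) :=
  let: existT k (existT p R) := q in
  forall v, (forall i, Y (v i)) -> (exists x, (forall i, E (x i)) /\ R v x) ->
    exists x, (forall i, Y (x i)) /\ R v x.

Lemma tuple_seq X k (v : 'I_k -> X) (x0 : X) :
  (fun i : 'I_k => nth x0 [seq v i | i <- enum 'I_k] i) = v.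
Proof.
by apply: funext => i; rewrite (nth_map i) ?size_enum_ord // nth_ord_enum.
Qed.

Inductive generated X (F : nat * nat -> seq X -> X) (G : set X) : X -> Prop :=
| generated_base x : G x -> generated F G x
| generated_step q s : (forall y, List.In y s -> generated F G y) -> generated F G (F q s).

(** Each generated element is the value of a term over [G], and terms are coded by forests. *)
Lemma card_generated X (F : nat * nat -> seq X -> X) (G : set X) Q : absorbing Q ->
  G #<= [set: Q] -> [set x | generated F G x] #<= [set: Q].
Proof.
move=> Qabs GQ; pose Lab := ((nat * nat) + G)%type.
pose value (l : Lab) (s : seq X) := match l with inl q => F q s | inr x => val x end.
pose ev := fix ev (s : forest Lab) : seq X :=
  if s is FCons l a b then value l (ev a) :: ev b else [::].
have LQ : [set: Lab] #<= [set: Q].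
  apply: absorbing_sum => //; first by apply: absorbing_countable => //; exact: countableP.
  by apply: card_le_trans GQ; exact: card_sub_le.
apply: card_le_trans (card_forest Qabs LQ).
apply: (card_le_rel (R := fun x s => ev s = [:: x])) => [x /= gx|x y s _ _ -> [->] //].
suff [s es] : exists s, ev s = [:: x] by exists s.
elim: gx => [{}x Gx|q s _ IH].
  by exists (FCons (inr (SigSub (mem_set Gx))) FNil FNil).
have [t te] : exists t, ev t = s.
  elim: s IH => [|y s IHs] IH; first by exists FNil.
  have [|t te] := IHs; first by move=> z zs; apply: IH; right.
  have [u ue] := IH y (or_introl erefl).
  case: u ue => [//|l a b] /= [yE _]; exists (FCons l a t) => /=; by rewrite yE te.
by exists (FCons (inl q) t FNil); rewrite /= te.
Qed.

(** The witness functions are chosen once, independently of [G]. This makes the closure monotone, as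
    is required for the hulls to form a chain. *)
Lemma hull X (E : set X) (Rs : set (requirement X)) : E !=set0 -> countable Rs ->
  exists cl : set X -> set X,
    [/\ forall G, G `<=` E -> G `<=` cl G /\ cl G `<=` E,
        forall G G', G `<=` G' -> cl G `<=` cl G',
        forall G, G `<=` E -> forall q, Rs q -> closed_for E (cl G) q
      & forall G Q, absorbing Q -> G #<= [set: Q] -> cl G #<= [set: Q]].
Proof.
move=> [e0 Ee0] cRs.
have [en enP] : exists en : nat -> requirement X, forall q, Rs q -> exists n, en n = q.
  have [->|/set0P[q0 Rq0]] := eqVneq Rs set0.
    by exists (fun=> @req X 0 0 (fun _ _ => True)) => q [].
  by have [en [_ h]] := countable_enum Rq0 cRs; exists en.
have /choice[w wP] : forall a : nat * seq X, exists y : nat -> X, (forall i, E (y i)) /\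
    let: existT k (existT p R) := en a.1 in
    (exists x, (forall i, E (x i)) /\ R (fun i : 'I_k => nth e0 a.2 i) x) ->
    R (fun i : 'I_k => nth e0 a.2 i) (fun i : 'I_p => y i).
  move=> [n s] /=; case: (en n) => k [p R].
  have [[x [Ex Rx]]|no] := pselect (exists x, (forall i, E (x i)) /\ R (fun i : 'I_k => nth e0 s i) x); last first.
    by exists (fun=> e0); split=> // /no.
  exists (fun i => if insub i is Some j then x j else e0); split=> [i|_]; first by case: insubP.
  suff -> : (fun i : 'I_p => if insub (val i) is Some j then x j else e0) = x by [].
  by apply: funext => i; rewrite valK.
pose F (q : nat * nat) (s : seq X) := w (q.1, s) q.2.
exists (fun G => [set x | generated F G x]); split.
- move=> G GE; split=> x; first by constructor.
  by elim=> [y /GE//|q s _ _]; exact: (wP (q.1, s)).1.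
- by move=> G G' GG x /=; elim=> [y /GG ?|q s _ IH]; [left|right].
- move=> G GE q /enP[n qn]; rewrite -qn; case qE : (en n) => [k [p R]] v Gv [x [Ex Rx]].
  pose s := [seq v i | i <- enum 'I_k].
  exists (fun i : 'I_p => F (n, val i) s); split=> [i|].
    apply: generated_step => y /List.in_map_iff[j [<- _]]; exact: Gv.
  have [_] := wP (n, s); rewrite /= qE tuple_seq; apply.
  by exists x.
- by move=> G Q Qa; exact: card_generated.
Qed.

Lemma closed_for_bigcup X (E : set X) (I : Type) (D : set I) (Y : I -> set X) q :
  D !=set0 -> (forall i j, D i -> D j -> Y i `<=` Y j \/ Y j `<=` Y i) ->
  (forall i, D i -> closed_for E (Y i) q) -> closed_for E (\bigcup_(i in D) Y i) q.
Proof.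
move=> [i0 Di0] tot; case: q => k [p R] hY v Dv ex.
have [i Di Yi] : exists2 i, D i & forall j, Y i (v j).
  clear ex; elim: k v {hY R} Dv => [|k IH] v Dv; first by exists i0 => // -[].
  have [i Di Yi] := IH (v \o lift ord0) (fun j => Dv _).
  have [j Dj Yj] := Dv ord0.
  have vP (Z : set X) : Z (v ord0) -> (forall u, Z (v (lift ord0 u))) -> forall u, Z (v u).
    by move=> Z0 ZS u; case: (unliftP ord0 u) => [u'|] ->.
  have [h|h] := tot _ _ Di Dj; [exists j|exists i] => //; apply: vP => //.
    by move=> u; apply: h; exact: Yi.
  exact: h.
have [x [Yx Rx]] := hY i Di v Yi ex.
by exists x; split=> // j; exists i.
Qed.

(** ** Elementary subsystems *)

(** Writing finite index sets as lists makes families of requirements indexed by them visibly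
    countable. *)
Definition seq_set (q : seq nat) : set nat := [set j | j \in q].

Lemma seq_setP n (s : set nat) : s `<=` `I_n -> exists q, seq_set q = s.
Proof.
move=> sn; exists [seq i <- iota 0 n | `[< s i >]]; apply/seteqP; split=> j.
  by rewrite /seq_set /mkset mem_filter => /andP[/asboolP].
move=> sj; rewrite /seq_set /mkset mem_filter mem_iota /=; apply/andP; split; first exact/asboolP.
exact: sn.
Qed.

Lemma countable_bigcupT (I T : Type) (F : I -> set T) : countable [set: I] ->
  (forall i, countable (F i)) -> countable (\bigcup_(i in [set: I]) F i).
Proof. by move=> cI cF; apply: bigcup_countable => // i _. Qed.

Lemma satr_eq L (X : Type) (J J' : forall R : symb L, ('I_(arity R) -> X) -> Prop) (D : set X) :
  (forall R (v : 'I_(arity R) -> X), (forall i, D (v i)) -> (J R v <-> J' R v)) ->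
  forall n (f : formula L n) v, (forall i, D (v i)) -> (satr J D f v <-> satr J' D f v).
Proof.
move=> JJ n f; elim: f => [{}n i j|{}n R w|{}n|{}n g IHg h IHh|{}n g IHg] v Dv //=.
- by apply: JJ => i; exact: Dv.
- by split=> H /(IHg _ Dv)/H/(IHh _ Dv).
- have Dc x : D x -> forall i, D (vcons x v i) by move=> Dx i; rewrite /vcons; case: unlift.
  by split=> H x Dx; apply/(IHg _ (Dc _ Dx)); exact: H.
Qed.

Section Witnesses.
Variables (L : vocabulary) (X : Type) (J : forall R : symb L, ('I_(arity R) -> X) -> Prop) (D : set X).

Definition tarski_vaught_reqs : set (requirement X) :=
  \bigcup_(n in [set: nat]) range (fun f : formula L n.+1 =>
    req (fun (v : 'I_n -> X) (x : 'I_1 -> X) => D (x ord0) /\ ~ satr J D f (vcons (x ord0) v))).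

Lemma countable_tarski_vaught_reqs : countable [set: symb L] -> countable tarski_vaught_reqs.
Proof.
move=> cL; apply: countable_bigcupT => [|n]; first exact: countableP.
by apply: countable_range; exact: countable_formula.
Qed.

Lemma meets_tarski_vaught (E Y : set X) : D `<=` E ->
  (forall q, tarski_vaught_reqs q -> closed_for E Y q) ->
  forall n (f : formula L n) v, (forall i, (D `&` Y) (v i)) ->
    (satr J (D `&` Y) f v <-> satr J D f v).
Proof.
move=> DE hY n f v Dv; apply: (@tarski_vaught L X J D (D `&` Y) _ _ n f v Dv) => [x []//|].
move=> k g w Dw [x [Dx nx]].
have := hY (req (fun (v : 'I_k -> X) (x : 'I_1 -> X) => D (x ord0) /\ ~ satr J D g (vcons (x ord0) v))).
case/(_ _ w) => [|i||y [Yy [Dy ny]]]; [by exists k => //; exists g|by case: (Dw i)| |].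
  by exists (fun=> x); split=> // _; exact: DE.
by exists (y ord0).
Qed.

End Witnesses.

Lemma countable_system_voc L l : countable [set: symb L] ->
  countable [set: symb (system_voc L (powset [set j | 0 < j < l]))].
Proof.
move=> cL; apply: countable_sumT => //.
have [ss ssP] := powset_enum l.
apply: (@countable_inj _ _ _ (fun x : powset [set j | 0 < j < l] => index (val x) ss)).
  exact: countableP.
move=> x y _ _ e; apply: val_inj.
have xs : val x \in ss by apply/ssP; exact: set_valP.
have ys : val y \in ss by apply/ssP; exact: set_valP.
by rewrite -[LHS](nth_index set0 xs) e nth_index.
Qed.

Section Subsystem.
Variables (L : vocabulary) (P : symb L) (T : set (sentence L)) (K : Type) (C : structure L).
Let PC := predicate P C.
Hypothesis cL : countable [set: symb L].
Local Notation flat := (flat P T K).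
Local Notation PP n := (proper_powset `I_n).
Variables (n : nat) (A : set nat -> set C) (E : set C).
Hypothesis A_flat : flat n (PP n) A.
Hypothesis AE : forall s, PP n s -> A s `<=` E.
Hypothesis n0 : 0 < n.

Definition complete_reqs (D : set C) : set (requirement C) :=
  \bigcup_(m in [set: nat]) \bigcup_(k in [set: nat]) range (fun f : formula L (m + k) =>
    req (fun (b : 'I_k -> C) (a : 'I_m -> C) => (forall i, (PC `&` D) (a i)) /\ sat f (vcat a b))).

Definition pull_reqs : set (requirement C) :=
  \bigcup_(m in [set: nat]) \bigcup_(w in [set: seq (seq nat) * nat * seq nat])
    range (fun f : formula L m => req (fun b b' : 'I_m -> C =>
      [/\ forall i : 'I_m, A (seq_set (nth [::] w.1.1 i) `\ w.1.2 `|` seq_set w.2) (b' i),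
          forall i : 'I_m, ~ seq_set (nth [::] w.1.1 i) w.1.2 -> b' i = b i & sat f b'])).

Definition inner_pull_reqs : set (requirement C) :=
  \bigcup_(m in [set: nat]) \bigcup_(k in [set: nat]) \bigcup_(w in [set: seq (seq nat)])
    range (fun f : formula L (m + k) => req (fun (a : 'I_k -> C) (b : 'I_m -> C) =>
      (forall i : 'I_m, A (seq_set (nth [::] w i)) (b i)) /\ sat f (vcat b a))).

Let punion (w : seq nat * seq nat) : set C :=
  \bigcup_(t in proper_powset (seq_set w.1)) A (t `|` seq_set w.2).

(** Closure under these makes the traces a good system that is elementary in the given one:
    completeness of [E], pull-backs, solutions inside prescribed sets, and the Tarski-Vaught test
    for each [A s], for each union in the stability clause (with its completeness), and for each
    subsystem in the inclusion clause. *)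
Definition system_reqs : set (requirement C) :=
  complete_reqs E `|` pull_reqs `|` inner_pull_reqs `|`
  \bigcup_(q in [set: seq nat]) tarski_vaught_reqs (@interp L C) (A (seq_set q)) `|`
  \bigcup_(w in [set: seq nat * seq nat]) (tarski_vaught_reqs (@interp L C) (punion w) `|` complete_reqs (punion w)) `|`
  \bigcup_(w in [set: nat * seq nat]) tarski_vaught_reqs
    (@system_interp L C (powset [set j | 0 < j < w.1]) (fun s => A (s `|` seq_set w.2)))
    (\bigcup_(s in powset [set j | 0 < j < w.1]) A (s `|` seq_set w.2)).

Lemma countable_system_reqs : countable system_reqs.
Proof.
have cN : absorbing nat := absorbing_natT.
have cc D : countable (complete_reqs D).
  do 2!(apply: countable_bigcupT => [|?]; first exact: countableP).
  by apply: countable_range; exact: countable_formula.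
rewrite /system_reqs; apply: (absorbing_setU cN); [apply: (absorbing_setU cN); [apply: (absorbing_setU cN); [apply: (absorbing_setU cN); [apply: (absorbing_setU cN)|]|]|]|].
- exact: cc.
- do 2!(apply: countable_bigcupT => [|?]; first exact: countableP).
  by apply: countable_range; exact: countable_formula.
- do 3!(apply: countable_bigcupT => [|?]; first exact: countableP).
  by apply: countable_range; exact: countable_formula.
- apply: countable_bigcupT => [|?]; first exact: countableP.
  exact: countable_tarski_vaught_reqs.
- apply: countable_bigcupT => [|?]; first exact: countableP.
  by apply: (absorbing_setU cN); [exact: countable_tarski_vaught_reqs|exact: cc].
- apply: countable_bigcupT => [|?]; first exact: countableP.
  by apply: countable_tarski_vaught_reqs; exact: countable_system_voc.
Qed.

Section Subset.
Variable Y : set C.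
Hypothesis YE : Y `<=` E.
Hypothesis hY : forall q, system_reqs q -> closed_for E Y q.

Let down s t : PP n t -> s `<=` t -> PP n s.
Proof. by case: (nice_proper n0) => -[_ _ h] _; exact: h. Qed.

Let low s : powset [set j | 0 < j < n] s -> PP n s.
Proof. by case: (nice_proper n0) => -[_ h _] _; exact: h. Qed.

Lemma meets_complete D : D `<=` E -> complete_set P D ->
  (forall q, complete_reqs D q -> closed_for E Y q) -> complete_set P (D `&` Y).
Proof.
move=> DE hD h m k f b Db ex.
have [|a [Pa sa]] := hD m k f b _ ex; first by move=> i; case: (Db i).
have := h (req (fun (b : 'I_k -> C) (a : 'I_m -> C) => (forall i, (PC `&` D) (a i)) /\ sat f (vcat a b))).
case/(_ _ b) => [|i||x [Yx [Px sx]]].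
- by exists m => //; exists k => //; exists f.
- by case: (Db i).
- by exists a; split=> // i; apply: DE; case: (Pa i).
- by exists x; split=> // i; have [? ?] := Px i; split.
Qed.

Lemma subset_complete : complete_set P E -> complete_set P Y.
Proof.
move=> Ec; have <- : E `&` Y = Y by apply/seteqP; split=> x; [case|move=> Yx; split=> //; exact: YE].
apply: meets_complete => // q hq; apply: hY; do 5!left; exact: hq.
Qed.

Lemma elementary_part s : PP n s -> forall m (f : formula L m) v, (forall i, (A s `&` Y) (v i)) ->
  (satr (@interp L C) (A s `&` Y) f v <-> satr (@interp L C) (A s) f v).
Proof.
move=> Is; have [q qs] := seq_setP (proj1 Is); apply: (@meets_tarski_vaught _ _ _ _ E); first exact: AE.
by move=> r hr; apply: hY; do 2!left; right; exists q => //; rewrite qs.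
Qed.

Lemma system_incl_subset l u : u `<=` [set j | l <= j < n] -> 0 < l <= n ->
  system_incl (powset [set j | 0 < j < l]) (fun s => A (s `|` u) `&` Y) (fun s => A (s `|` u)).
Proof.
move=> ul /andP[l0 ln]; have [q qu] : exists q, seq_set q = u.
  by apply: (@seq_setP n) => x /ul/andP[].
set J := powset _; pose D := \bigcup_(s in J) A (s `|` u).
have UE : \bigcup_(s in J) (A (s `|` u) `&` Y) = D `&` Y.
  by apply/seteqP; split=> [x [s Js [Ax Yx]]|x [[s Js Ax] Yx]]; [split=> //; exists s|exists s].
have DE : D `<=` E.
  move=> x [s Js Ax]; apply: AE Ax; apply: low => y [/Js/andP[y0 yl]|/ul/andP[ly yn]].
    by rewrite /mkset y0 (leq_trans yl ln).
  by rewrite /mkset yn (leq_trans l0 ly).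
apply/system_inclP; rewrite UE; split; first by move=> x [].
move=> m f v Dv; rewrite -/D -(@meets_tarski_vaught _ _ (@system_interp L C J (fun s => A (s `|` u))) D E Y DE _ m f v Dv).
  apply: satr_eq Dv => -[R|s] w Dw //=.
  by split=> [[]//|Aw]; split=> //; case: (Dw ord0).
by move=> r hr; apply: hY; right; exists (l, q) => //=; rewrite qu.
Qed.

(** Stability concerns all sets elementarily equivalent to the given one, so it passes to a complete
    elementary trace. For the inclusion clause, each of the two traces is compared with the system
    it comes from. *)
Lemma flat_subset : flat n (PP n) (fun s => A s `&` Y).
Proof.
split.
- exact: (flat_nice A_flat).
- by move=> s Is; apply: small_le (flat_small A_flat Is); apply: subset_card_le; exact: subIsetl.
- by move=> s t Is It; rewrite -(flat_inter A_flat Is It); set_tauto.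
- move=> s Is; have [h1 h2] := flat_model A_flat Is; split=> s0.
    have /(elem_incl_satr (@interp L C) (@interp L C))[sub h] := h1 s0.
    apply/(elem_incl_satr (@interp L C) (@interp L C)); split; first by move=> x [/sub].
    move=> m f v Av; rewrite -h ?elementary_part // => i; by case: (Av i).
  have /elem_subP h := h2 s0; apply/elem_subP => m f v Av.
  by rewrite elementary_part // h // => i; case: (Av i).
- by move=> s Is; rewrite -(flat_pred A_flat Is) setIAC.
- move=> l u s ln ul sl s0 Isu; have := flat_stable A_flat ln ul sl s0 Isu.
  have [q qs] := seq_setP sl; have [q' qu] : exists q, seq_set q = u.
    by apply: (@seq_setP n) => x /ul/andP[].
  have UE : \bigcup_(t in proper_powset s) (A (t `|` u) `&` Y) = (\bigcup_(t in proper_powset s) A (t `|` u)) `&` Y.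
    by apply/seteqP; split=> [x [t Jt [Ax Yx]]|x [[t Jt Ax] Yx]]; [split=> //; exists t|exists t].
  have DE : \bigcup_(t in proper_powset s) A (t `|` u) `<=` E.
    move=> x [t [ts _] Ax]; apply: AE Ax; apply: down Isu _.
    by move=> y [/ts|]; [left|right].
  move=> [Dc Dst]; rewrite UE; split.
    apply: meets_complete => // r hr; apply: hY; left; right; exists (q, q') => //; right.
    by rewrite /punion /= qs qu.
  move=> A' A's A'e; apply: Dst => // g; rewrite A'e.
  move: g; apply/elem_equivP => f v.
  apply: (@meets_tarski_vaught _ _ _ _ E); [exact: DE| |by case].
  by move=> r hr; apply: hY; left; right; exists (q, q') => //; left; rewrite /punion /= qs qu.
- move=> l u ll ul; have /andP[l0 ln] := ll.
  have h1 : u `<=` [set j | l <= j < n] by move=> x /ul/andP[lx xn]; rewrite /mkset ltnW.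
  have h2 : [set l] `|` u `<=` [set j | l <= j < n].
    by move=> x [->|/h1//]; rewrite /mkset leqnn.
  have /system_inclP[_ H1] := system_incl_subset h1 (introT andP (conj l0 (ltnW ln))).
  have /system_inclP[_ H2] := system_incl_subset h2 (introT andP (conj l0 (ltnW ln))).
  have /system_inclP[sub H] := flat_incl A_flat ll ul.
  have setE (Z : set nat -> set C) : (fun s => Z (s `|` [set l] `|` u)) = (fun s => Z (s `|` ([set l] `|` u))).
    by apply: funext => s; rewrite setUA.
  have mono s : powset [set j | 0 < j < l] s -> A (s `|` u) `<=` A (s `|` [set l] `|` u).
    move=> sl; apply: (flat_mono A_flat); last by move=> x [|]; [left; left|right].
    apply: low => x [[/sl/andP[x0 xl]|->]|/ul/andP[lx xn]]; rewrite /mkset.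
    - by rewrite x0 (ltn_trans xl).
    - by rewrite l0.
    - by rewrite xn (ltn_trans l0).
  apply/system_inclP; split; first by move=> x [s sl [Ax Yx]]; exists s => //; split=> //; exact: mono Ax.
  rewrite (setE (fun s => A s `&` Y)) => m f v Dv.
  rewrite H1 // H2; last first.
    by move=> i; have [s sl [Ax Yx]] := Dv i; exists s => //; split=> //; rewrite setUA; exact: mono Ax.
  rewrite H ?(setE A) // => i; have [s sl [Ax Yx]] := Dv i; by exists s.
- move=> l u ll ul m f t b tb sb; have /andP[l0 ln] := ll.
  have [b' [h1 h2 h3]] := flat_pull A_flat ll ul (b := b) (t := t) (fun i => conj (tb i).1 (proj1 (tb i).2)) sb.
  have [q' qu] : exists q, seq_set q = u by apply: (@seq_setP n) => x /ul/andP[].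
  have /choice[q qP] : forall i, exists q, seq_set q = t i by move=> i; exact: (seq_setP (proj1 (tb i).1)).
  pose w := [seq q i | i <- enum 'I_m].
  have wE i : seq_set (nth [::] w (i : 'I_m)) = t i.
    by rewrite (nth_map i) ?size_enum_ord // nth_ord_enum.
  have It i : PP n (t i `\ l `|` u).
    by apply: down (proj2 (tb i).1) _ => x [[tx _]|]; [left|right].
  have := @hY (req (fun b b' : 'I_m -> C =>
      [/\ forall i : 'I_m, A (seq_set (nth [::] w i) `\ l `|` seq_set q') (b' i),
          forall i : 'I_m, ~ seq_set (nth [::] w i) l -> b' i = b i & sat f b'])).
  case/(_ _ b) => [|i||x [Yx [x1 x2 x3]]].
  - by do 4!left; right; exists m => //; exists (w, l, q') => //; exists f.
  - by case: (tb i) => _ [].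
  - exists b'; split=> [i|]; first by apply: AE (h1 i).
    by split=> // i; rewrite wE ?qu //; exact: h2.
  - exists x; split=> // i; first by split=> //; have := x1 i; rewrite wE qu.
    by move=> til; apply: x2; rewrite wE.
Qed.

Lemma inner_pull m k (f : formula L (m + k)) (a : 'I_k -> C) (t : 'I_m -> set nat) (b : 'I_m -> C) :
  (forall i, Y (a i)) -> (forall i, PP n (t i) /\ A (t i) (b i)) -> sat f (vcat b a) ->
  exists b' : 'I_m -> C, (forall i, (A (t i) `&` Y) (b' i)) /\ sat f (vcat b' a).
Proof.
move=> Ya tb sb.
have /choice[q qP] : forall i, exists q, seq_set q = t i by move=> i; exact: (seq_setP (proj1 (proj1 (tb i)))).
pose w := [seq q i | i <- enum 'I_m].
have wE i : seq_set (nth [::] w (i : 'I_m)) = t i.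
  by rewrite (nth_map i) ?size_enum_ord // nth_ord_enum.
have := @hY (req (fun (a : 'I_k -> C) (b : 'I_m -> C) =>
      (forall i : 'I_m, A (seq_set (nth [::] w i)) (b i)) /\ sat f (vcat b a))).
case/(_ _ a Ya) => [||x [Yx [Ax sx]]].
- by do 3!left; right; exists m => //; exists k => //; exists w => //; exists f.
- exists b; split=> [i|]; first by case: (tb i) => It; exact: AE.
  by split=> // i; rewrite wE; case: (tb i).
- by exists x; split=> // i; split=> //; have := Ax i; rewrite wE.
Qed.

End Subset.

Lemma system_incl_subsets Y Y' : Y `<=` Y' ->
  (forall q, system_reqs q -> closed_for E Y q) -> (forall q, system_reqs q -> closed_for E Y' q) ->
  system_incl (powset [set j | 0 < j < n]) (fun s => A s `&` Y) (fun s => A s `&` Y').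
Proof.
move=> YY hY hY'.
have aux Z : (forall q, system_reqs q -> closed_for E Z q) ->
    system_incl (powset [set j | 0 < j < n]) (fun s => A s `&` Z) A.
  move=> hZ; have := @system_incl_subset Z hZ n set0 (fun _ => @False_ind _).
  rewrite n0 leqnn => /(_ isT); apply: system_incl_eq => s _; by rewrite setU0.
have /system_inclP[_ H1] := aux Y hY; have /system_inclP[_ H2] := aux Y' hY'.
apply/system_inclP; split; first by move=> x [s sl [Ax Yx]]; exists s => //; split=> //; exact: YY.
move=> m f v Dv; rewrite H1 // H2 // => i.
by have [s sl [Ax Yx]] := Dv i; exists s => //; split=> //; exact: YY.
Qed.

End Subsystem.

Lemma complete_nonempty L (P : symb L) (C : structure L) (Y : set C) :
  (exists x, predicate P C x) -> complete_set P Y -> exists y, predicate P C y /\ Y y.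
Proof.
move=> [x Px] /complete_dov H.
have [||a [Pa _]] := H 1 (fun=> ~ False).
- by apply: dov_not; apply: dov_dfn; exact: dfn_bot.
- by exists (fun=> x); split=> // -[].
- by exists (a ord0); case: (Pa ord0).
Qed.

(** * Moving solutions and isolation between a system and its trace *)

Section PullAtomic.
Variables (L : vocabulary) (P : symb L) (C : structure L).
Local Notation PP n := (proper_powset `I_n).
Variables (n : nat) (A : set nat -> set C) (E Y X : set C).
Hypothesis AE : forall s, PP n s -> A s `<=` E.
Hypothesis hY : forall q, system_reqs P A E q -> closed_for E Y q.
Hypothesis X_atomic : atomic_over E Y X.
Variables (x0 e0 : C) (t0 : set nat).
Hypotheses (Xx0 : X x0) (It0 : PP n t0) (Ae0 : A t0 e0).

(** A formula over [Y] isolates the coordinates from [X] over [E]. That it implies [f] is a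
    statement over [Y] about the other coordinates, and by closure [Y] contains a solution with each
    entry in its own [A s]. *)
Lemma pull_atomic p (f : formula L p) (t : 'I_p -> option (set nat)) (b : 'I_p -> C) :
  (forall i, if t i is Some s then PP n s /\ A s (b i) else X (b i)) -> sat f b ->
  exists b' : 'I_p -> C,
    (forall i, if t i is Some s then (A s `&` Y) (b' i) else b' i = b i) /\ sat f b'.
Proof.
move=> tb sb.
(* Two copies of the coordinates separate those in [X] from those in the system; [x0] and [e0] fill
   the vacant places. *)
pose x i := if t i is Some _ then x0 else b i.
pose y i := if t i is Some _ then b i else e0.
pose ty i := if t i is Some s then s else t0.
pose r (i : 'I_p) : 'I_(p + p) := if t i is Some _ then rshift p i else lshift p i.
pose merge (u v : 'I_p -> C) i := if t i is Some _ then v i else u i.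
have rE u v : vcat u v \o r = merge u v.
  by apply: funext => i; rewrite /= /r /merge; case: (t i) => [s|]; rewrite (vcatl, vcatr).
have xyb : merge x y = b by apply: funext => i; rewrite /merge /x /y; case: (t i).
have Xx i : X (x i) by rewrite /x; have := tb i; case: (t i).
have tyP i : PP n (ty i) /\ A (ty i) (y i).
  by rewrite /ty /y; have := tb i; case: (t i).
have [Z [dZ Zx dec]] := X_atomic Xx (ren f r).
have /dovP[k [th [a [Ya thE]]]] := dZ.
have pos z : Z z -> sat (ren f r) (vcat z y).
  move=> Zz; case: (dec y) => [i|h|h]; [by apply: AE (proj1 (tyP i)) _ (proj2 (tyP i))|exact: h|].
  by case: (h x Zx); rewrite sat_ren rE xyb.
have [g gE] : exists g : formula L (p + k), forall v, (forall z : 'I_p -> C,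
    sat th (vcat z (v \o @rshift p k)) -> sat (ren f r) (vcat z (v \o @lshift p k))) <-> sat g v.
  have : @dfn L C 'I_(p + k) (fun v => forall z : 'I_p -> C,
    sat th (vcat z (v \o @rshift p k)) -> sat (ren f r) (vcat z (v \o @lshift p k))).
    apply: (@dfn_all _ _ _ p (fun u => sat th (vcat (u \o inl) (u \o inr \o @rshift p k)) ->
      sat (ren f r) (vcat (u \o inl) (u \o inr \o @lshift p k)))).
    apply: dfn_imp.
      by exists (p + k), th, (vcat inl (inr \o @rshift p k)) => v; rewrite vcat_comp.
    by exists (p + p), (ren f r), (vcat inl (inr \o @lshift p k)) => v; rewrite vcat_comp.
  by move=> [m [g [h gE]]]; exists (ren g h) => v; rewrite sat_ren gE.
have vl (u : 'I_p -> C) (v : 'I_k -> C) : vcat u v \o @lshift p k = u by apply: funext => i; exact: vcatl.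
have vr (u : 'I_p -> C) (v : 'I_k -> C) : vcat u v \o @rshift p k = v by apply: funext => i; exact: vcatr.
have [|y' [Yy' sy']] := @inner_pull L P C n A E AE Y hY p k g a ty y Ya tyP.
  by apply/gE; rewrite vl vr => z /thE; exact: pos.
exists (merge x y'); split=> [i|].
  by rewrite /merge /x; have := Yy' i; rewrite /ty; case: (t i).
by have /gE := sy'; rewrite vl vr => /(_ x (proj1 (thE x) Zx)); rewrite sat_ren rE.
Qed.

(** The equation of two coordinates is pulled back, one regarded as lying in [A s] and the other as
    fixed in [X]. *)
Lemma atomic_mem z s : PP n s -> A s z -> X z -> (A s `&` Y) z.
Proof.
move=> Is Az Xz; pose t (i : 'I_2) := if val i == 0 then Some s else None.
have [i||b' [h1 h2]] := @pull_atomic 2 (fEq L ord0 (lift ord0 ord0)) t (fun=> z).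
- by rewrite /t; case: ifP.
- by [].
- have := h1 (lift ord0 ord0); rewrite /t /= => e.
  by have := h1 ord0; rewrite /t /= -e -(h2 : b' ord0 = b' (lift ord0 ord0)).
Qed.

(** That [f] is undecided at [b] is a formula about [b] and the parameters [a] of the isolating
    formula. Pulling it back fixes [a] and moves [b] into [X1], where every instance is decided. *)
Lemma isolated_upgrade X1 m (x : 'I_m -> C) :
  X1 `<=` X -> (forall z, E z -> X1 z \/ exists2 s, PP n s & A s z) -> Y `<=` X1 ->
  isolated_over X1 X1 x -> isolated_over (X1 `|` E) X1 x.
Proof.
move=> X1X EX YX1 iso k f; have [Z [dZ Zx dec]] := iso k f; exists Z; split=> // b Eb.
have /dovP[q [th [a [Xa thE]]]] := dZ.
have /choice[t tP] : forall i, exists o : option (set nat),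
    if o is Some s then PP n s /\ A s (b i) else X1 (b i).
  move=> i; have [h|h] := pselect (X1 (b i)); first by exists None.
  by case: (Eb i) => [//|/EX[//|[s Is As]]]; exists (Some s).
apply: contrapT => /not_orP[/existsNP[z1 /not_implyP[Z1 n1]] /existsNP[z2 /not_implyP[Z2 /contrapT n2]]].
pose body neg (u : 'I_m + 'I_(q + k) -> C) := sat th (vcat (u \o inl) (u \o inr \o @lshift q k)) /\
  (if neg then ~ sat f (vcat (u \o inl) (u \o inr \o @rshift q k)) else sat f (vcat (u \o inl) (u \o inr \o @rshift q k))).
have dbody neg : dfn (body neg).
  apply: dfn_and.
    by exists (m + q), th, (vcat inl (inr \o @lshift q k)) => v; rewrite vcat_comp.
  have df : @dfn L C ('I_m + 'I_(q + k)) (fun u => sat f (vcat (u \o inl) (u \o inr \o @rshift q k))).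
    by exists (m + k), f, (vcat inl (inr \o @rshift q k)) => v; rewrite vcat_comp.
  by case: neg => //; exact: dfn_not.
have [g gE] : exists g : formula L (q + k), forall v, ((exists z : 'I_m -> C, body true (sumv z v)) /\
    (exists z : 'I_m -> C, body false (sumv z v))) <-> sat g v.
  have := dfn_and (dfn_ex (dbody true)) (dfn_ex (dbody false)).
  by move=> [p [g [h gE]]]; exists (ren g h) => v; rewrite sat_ren gE.
have vl (u : 'I_q -> C) (v : 'I_k -> C) : vcat u v \o @lshift q k = u by apply: funext => i; exact: vcatl.
have vr (u : 'I_q -> C) (v : 'I_k -> C) : vcat u v \o @rshift q k = v by apply: funext => i; exact: vcatr.
have sE (z : 'I_m -> C) (v : 'I_(q + k) -> C) neg : body neg (sumv z v) <->
    sat th (vcat z (v \o @lshift q k)) /\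
    (if neg then ~ sat f (vcat z (v \o @rshift q k)) else sat f (vcat z (v \o @rshift q k))) by [].
have [i||b' [h1 h2]] := @pull_atomic _ g (fun i => match fintype.split i with inl _ => None | inr j => t j end) (vcat a b).
- rewrite /vcat; case: fintype.split => j; first exact: X1X.
  by have := tP j; case: (t j) => // /X1X.
- by apply/gE; split; [exists z1|exists z2]; apply/sE; rewrite vl vr; split=> //; apply/thE.
have b'E : b' = vcat a (b' \o @rshift q k).
  rewrite {1}(vcat_split b'); congr vcat; apply: funext => i /=.
  have := h1 (lshift k i); rewrite (unsplitK (inl i)) => ->; exact: vcatl.
move: h2; rewrite b'E => /gE[[w1 /sE[]]]; rewrite vl vr => /thE Zw1 nw1 [w2 /sE[]]; rewrite vl vr => /thE Zw2 nw2.
case: (dec (b' \o @rshift q k)) => [i|h|h].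
- have := h1 (rshift q i); rewrite (unsplitK (inr i)); have := tP i; case: (t i) => [s|h].
    by move=> _ [_ Yb]; apply: YX1.
  by rewrite /= => ->; rewrite vcatr.
- by apply: nw1; exact: h.
- by apply: (h _ Zw2).
Qed.

End PullAtomic.

(** * Smallness of unions *)

Lemma card_total (S T : Type) (A : set S) (B : set T) : A #<= B \/ B #<= A.
Proof.
have [lt wo] := well_ordering S.
have [[x [Ax Bx]]|no] := pselect (exists x, A x /\ B #<= [set z | A z /\ lt z x]).
  by right; apply: card_le_trans Bx _; apply: subset_card_le => z [].
left; apply: (initial_segments_card_le wo) => x Ax Bx; apply: no; by exists x.
Qed.

Lemma small_setU K L (T : set (sentence L)) (X : Type) (A B : set X) : complete_theory T ->
  small K T -> small K A -> small K B -> small K (A `|` B).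
Proof.
move=> Tc Ts; wlog AB : A B / A #<= B => [H sA sB|].
  by case: (card_total A B) => h; [|rewrite setUC]; exact: H.
move=> sA sB; have [Bf|Bi] := pselect (finite_set B).
  apply: (countable_small Tc Ts); apply: finite_set_countable.
  by rewrite finite_setU; split=> //; exact: (card_le_finite AB Bf).
have Binf : [set: nat] #<= [set: B].
  by move/infiniteP: Bi => h; apply: card_le_trans h _; apply: (card_le_rel (R := fun x y => x = val y)) => [x Bx|x y z _ _ -> ->//];
    exists (SigSub (mem_set Bx)).
have BB : B #<= [set: B].
  by apply: (card_le_rel (R := fun x y => x = val y)) => [x Bx|x y z _ _ -> ->//]; exists (SigSub (mem_set Bx)).
apply: small_le sB; apply: card_le_trans (@card_sub_le _ B).
by apply: (absorbing_setU (infinite_absorbing Binf)) => //; exact: card_le_trans AB BB.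
Qed.

Lemma small_system K L (T : set (sentence L)) (X : Type) (A : set nat -> set X) n (c : set X) :
  complete_theory T -> small K T -> countable c ->
  (forall s, proper_powset `I_n s -> small K (A s)) ->
  small K (\bigcup_(s in proper_powset `I_n) A s `|` c).
Proof.
move=> Tc Ts cc As; have cs : small K c by exact: (countable_small Tc Ts).
apply: (small_setU Tc Ts) => //.
have [ss ssP] := @powset_enum_of n `I_n (fun _ h => h).
have main (l : seq (set nat)) : small K [set x | exists s, [/\ s \in l, proper_powset `I_n s & A s x]].
  elim: l => [|s l IH].
    apply: small_le cs; have -> : [set x | exists s, [/\ s \in [::], proper_powset `I_n s & A s x]] = set0.
      by rewrite -subset0 => x [s []].
    exact: card_ge0.
  have [Is|nIs] := pselect (proper_powset `I_n s).
    apply: small_le (small_setU Tc Ts (As _ Is) IH); apply: subset_card_le => x [t []].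
    by rewrite inE => /predU1P[->|tl] It At; [left|right; exists t].
  apply: small_le IH; apply: subset_card_le => x [t []].
  by rewrite inE => /predU1P[->//|tl] It At; exists t.
apply: small_le (main ss); apply: subset_card_le => x [s Is Ax]; exists s; split=> //.
by apply/ssP; case: Is.
Qed.

(** ** The induction on the cardinality *)

Lemma flat_pos L (P : symb L) T K (C : structure L) n A :
  @flat L P T K C n (proper_powset `I_n) A -> 0 < n.
Proof.
move=> FA; rewrite lt0n; apply/eqP => n_0; subst n.
have [[_ h _] _] := flat_nice FA; have [|_] := h set0; first by [].
by apply=> x.
Qed.

Section Main.
Variables (L : vocabulary) (P : symb L) (T : set (sentence L)) (K : Type) (C : structure L).
Let PC := predicate P C.
Hypotheses (T_complete : complete_theory T) (T_countable : countable T).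
Hypotheses (SL : strong_limit K) (T_small : small K T) (C_sat : saturated K C).
Hypothesis PC_nonempty : exists x, PC x.
Hypothesis T_k_stable : forall k, k_stable P T K C k.
Local Notation flat := (flat P T K).
Local Notation PP n := (proper_powset `I_n).
Local Notation union n A := (\bigcup_(s in PP n) A s).

Let cL : countable [set: symb L]. Proof. exact: countable_voc T_complete T_countable. Qed.

(** The size bound is needed along the chain, where the models already built belong to the next
    base. *)
Definition bounded_constructible (E M : set C) :=
  locally_constructible P K M E /\
  forall Q, absorbing Q -> E #<= [set: Q] -> M #<= [set: Q].

Lemma bounded_countable n A mc (c : 'I_mc -> C) : flat n (PP n) A ->
  let E := union n A `|` range c in
  complete_set P E -> PC `&` E `<=` union n A -> countable E ->
  exists M, bounded_constructible E M.
Proof.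
move=> FA E Ec PE cE; have [b [Pb Eb]] := complete_nonempty PC_nonempty Ec.
have cB : countable (union n A) by apply: sub_countable cE; apply: subset_card_le => z; left.
have [M [LM cM]] := constructible_countable T_complete T_countable SL T_small C_sat
  (flat_stable_union T_k_stable FA) cB (PE _ (conj Pb Eb)) Ec PE.
by exists M; split=> // Q Qa _; exact: absorbing_countable.
Qed.

Variables (lt : K -> K -> Prop) (wo : well_ordered lt).

Section Step.
Variables (n : nat) (A : set nat -> set C) (mc : nat) (c : 'I_mc -> C).
Hypothesis FA : flat n (PP n) A.
Let E := union n A `|` range c.
Hypotheses (Ec : complete_set P E) (PE : PC `&` E `<=` union n A) (E_small : small K E).
Hypothesis E_uncountable : ~ countable E.
Variable x : K.
Hypothesis Ex : E #<= [set z | lt z x].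
(** With [Ex], this makes the segment below [x] an initial ordinal of the size of [E]. *)
Hypothesis E_big : forall z, lt z x -> ~ (E #<= [set y | lt y z]).
Hypothesis IH : forall A', flat n.+1 (PP n.+1) A' -> small K (union n.+1 A') ->
  (exists2 z, lt z x & union n.+1 A' #<= [set y | lt y z]) ->
  exists M, bounded_constructible (union n.+1 A') M.

Let n0 : 0 < n. Proof. exact: flat_pos FA. Qed.
Let tr : forall u v w, lt u v -> lt v w -> lt u w. Proof. by case: wo. Qed.

Let AE s : PP n s -> A s `<=` E. Proof. by move=> Is z Az; left; exists s. Qed.

Let E_ex : exists e0, PC e0 /\ E e0. Proof. exact: complete_nonempty Ec. Qed.

Let S : Type := [set z | lt z x].
Let ltS (s t : S) := lt (val s) (val t).
Let leS (s t : S) := ltS s t \/ s = t.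
Let woS : well_ordered ltS. Proof. by apply: wo_pull wo _; exact: val_inj. Qed.
Let trS r s t : ltS r s -> ltS s t -> ltS r t. Proof. exact: tr. Qed.

Let Sx (s : S) : lt (val s) x. Proof. exact: (@set_valP _ [set z | lt z x] s). Qed.

(* E is enumerated along S, and H s is the hull of c and of the elements of index at most s. *)
Lemma chain_exists : exists (idx : C -> K) (cl : set C -> set C),
  [/\ forall y, E y -> lt (idx y) x,
      forall y z, E y -> E z -> idx y = idx z -> y = z
    & forall G, G `<=` E -> G `<=` cl G /\ cl G `<=` E] /\
  [/\ forall G G', G `<=` G' -> cl G `<=` cl G',
      forall G, G `<=` E -> forall q, system_reqs P A E q -> closed_for E (cl G) q
    & forall G Q, absorbing Q -> G #<= [set: Q] -> cl G #<= [set: Q]].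
Proof.
have [e0 [Pe0 Ee0]] := E_ex.
have [idx [i1 i2]] := card_le_injP x Ex.
have [cl [c1 c2 c3 c4]] := hull (ex_intro _ e0 Ee0) (countable_system_reqs P cL A E).
by exists idx, cl.
Qed.

Let idx := sval (cid chain_exists).
Let cl := sval (cid (svalP (cid chain_exists))).
Let cP := svalP (cid (svalP (cid chain_exists))).

Let gens (s : S) := range c `|` [set y | E y /\ (lt (idx y) (val s) \/ idx y = val s)].
Let H s := cl (gens s).

Let gensE s : gens s `<=` E. Proof. by move=> y [[j _ <-]|[]] //; right; exists j. Qed.

Let HE s : H s `<=` E. Proof. by case: cP => -[_ _ h] _; have [] := h _ (gensE (s := s)). Qed.
Let gH s : gens s `<=` H s. Proof. by case: cP => -[_ _ h] _; have [] := h _ (gensE (s := s)). Qed.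
Let cH s : range c `<=` H s. Proof. by move=> y cy; apply: gH; left. Qed.
Let Hreq s q : system_reqs P A E q -> closed_for E (H s) q.
Proof. by case: cP => _ [_ h _]; apply: h; exact: gensE. Qed.

Let Hmono s t : leS s t -> H s `<=` H t.
Proof.
case: cP => _ [h _ _] [st|->//]; apply: h => y [cy|[Ey ys]]; [by left|right; split=> //; left].
by case: ys => [ys|->] //; apply: tr st.
Qed.

Let EH y : E y -> exists s, H s y.
Proof.
move=> Ey; have [[h _ _] _] := cP.
exists (SigSub (mem_set (h y Ey)) : S); apply: gH; right; split=> //; by right.
Qed.

Let HU s : H s = \bigcup_(t in PP n) (A t `&` H s) `|` range c.
Proof.
apply/seteqP; split=> y; last by move=> [[t It []//]|/cH].
by move=> Hy; case: (HE Hy) => [[t It Ay]|cy]; [left; exists t|right].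
Qed.

Let Hc s : complete_set P (H s).
Proof. exact: (subset_complete (@HE s) (@Hreq s) Ec). Qed.

Let flatH s : flat n (PP n) (fun t => A t `&` H s).
Proof. exact: (flat_subset FA AE n0 (@Hreq s)). Qed.

Let setT_E : E #<= [set: E].
Proof.
by apply: (card_le_rel (R := fun x y => x = val y)) => [y Ey|y z w _ _ -> ->//]; exists (SigSub (mem_set Ey)).
Qed.

Let E_absorbing : absorbing E.
Proof.
apply: infinite_absorbing; apply: card_le_trans setT_E.
by apply/infiniteP => /finite_set_countable.
Qed.

Let seg_E (s : S) : [set z | lt z (val s)] #<= E.
Proof.
have := @initial_segments_card_le K lt wo [set z | lt z (val s)] C E; apply => y ys h.
apply: (E_big (z := y)); first by apply: tr (Sx s).
by apply: card_le_trans h _; apply: subset_card_le => z [].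
Qed.

Let S_E : [set: S] #<= E.
Proof.
apply: card_le_trans (card_sub_le _) _.
have := @initial_segments_card_le K lt wo [set z | lt z x] C E; apply => y yx h.
apply: (E_big yx).
by apply: card_le_trans h _; apply: subset_card_le => z [].
Qed.

Let ch_spec D : exists M, (exists M, bounded_constructible D M) -> bounded_constructible D M.
Proof.
have [[M h]|h] := pselect (exists M, bounded_constructible D M); first by exists M.
by exists set0 => /h.
Qed.

(** The models are chosen by recursion before they are known to exist, with a default otherwise;
    existence and the invariant [Inv] are then proved together by induction. *)
Lemma models_exist : exists Mo : S -> set C, forall s,
  let D := H s `|` \bigcup_(v in [set v | ltS v s]) Mo v in
  (exists M, bounded_constructible D M) -> bounded_constructible D (Mo s).
Proof.
have [ch chP] := choice ch_spec.
have [Mo MoE] := wo_recursion woS (set0 : set C)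
  (fun F s => ch (H s `|` \bigcup_(v in [set v | ltS v s]) F v)).
exists Mo => s D ex; have -> : Mo s = ch D; last exact: chP.
rewrite MoE /D; congr (ch (_ `|` _)); apply: eq_bigcupr => v vs.
by rewrite asboolT.
Qed.

Let Mo := sval (cid models_exist).
Let Ml s := \bigcup_(v in [set v | ltS v s]) Mo v.
Let Dm s := H s `|` Ml s.

Let MoP s : (exists M, bounded_constructible (Dm s) M) -> bounded_constructible (Dm s) (Mo s).
Proof. exact: (svalP (cid models_exist) s). Qed.

Let Inv s := [/\ bounded_constructible (Dm s) (Mo s), atomic_over E (H s) (Mo s) & PC `&` Mo s `<=` H s].

Let DmMo s : Inv s -> Dm s `<=` Mo s. Proof. by move=> [[[_ _ h _] _] _ _]. Qed.

Let HMo s : Inv s -> H s `<=` Mo s. Proof. by move=> /DmMo h y Hy; apply: h; left. Qed.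

Let Mo_mono s t : Inv t -> leS s t -> Mo s `<=` Mo t.
Proof. by move=> /DmMo h [st|->//] y My; apply: h; right; exists s. Qed.

Let Mo_E s y : Inv s -> E y -> Mo s y -> H s y.
Proof.
move=> inv [[t It Ay]|cy] My; last exact: cH.
have [_ at_ _] := inv.
by have [] := @atomic_mem L P C n A E (H s) (Mo s) AE (@Hreq s) at_ y y t My It Ay y t It Ay My.
Qed.

Let Mo_card Q s : absorbing Q -> (forall v, leS v s -> Inv v) -> H s #<= [set: Q] ->
  [set v | ltS v s] #<= [set: Q] -> Mo s #<= [set: Q].
Proof.
move=> Qa; elim/(well_founded_induction (wo_wf woS)): s => s IHs inv Hs segs.
have [[_ h] _ _] := inv s (or_intror erefl); apply: h => //; apply: absorbing_setU => //.
apply: absorbing_bigcup => // v vs; apply: IHs => //.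
- by move=> u [uv|->]; apply: inv; left => //; exact: trS vs.
- by apply: card_le_trans Hs; apply: subset_card_le; apply: Hmono; left.
- by apply: card_le_trans segs; apply: subset_card_le => u uv; exact: trS vs.
Qed.

(** Adding [nat] makes the segment infinite, so that cardinal arithmetic applies; the result bounds
    stage [s] and is still smaller than [E]. *)
Let Q_ (s : S) : Type := ([set z | lt z (val s)] + nat)%type.

Let Q_absorbing (s : S) : absorbing (Q_ s).
Proof. by apply: infinite_absorbing; apply: (fun_card_le (f := inr)) => i j _ _ []. Qed.

Let Q_big (s : S) : ~ (E #<= [set: Q_ s]).
Proof.
move=> EQ; have [sf|si] := pselect (countable [set: [set z | lt z (val s)]]).
  by apply: E_uncountable; apply: sub_countable EQ _; exact: countable_sumT.
have sinf : absorbing [set z | lt z (val s)].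
  by apply: infinite_absorbing; apply/infiniteP => /finite_set_countable.
apply: (E_big (Sx s)); apply: card_le_trans EQ _; apply: card_le_trans (@card_sub_le _ [set z | lt z (val s)]).
by apply: absorbing_sum => //; case: sinf.
Qed.

Let seg_Q (s : S) : [set v | ltS v s] #<= [set: Q_ s].
Proof.
apply: (@card_le_trans _ _ _ [set: [set z | lt z (val s)]]); last first.
  by apply: (fun_card_le (f := inl)) => i j _ _ [].
apply: (card_le_rel (R := fun v z => val v = val z)) => [v vs|u v w _ _ e e']; last first.
  by apply: val_inj; rewrite e.
by exists (SigSub (mem_set (vs : [set z | lt z (val s)] (val v)))).
Qed.

Let H_Q s : H s #<= [set: Q_ s].
Proof.
have [[_ inj _] [_ _ h]] := cP; apply: h; first exact: Q_absorbing.
apply: absorbing_setU; [exact: Q_absorbing| |].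
  by apply: absorbing_countable; [exact: Q_absorbing|apply: countable_range; exact: countableP].
apply: (card_le_rel (R := fun y q => match q with inl z => idx y = val z | inr _ => idx y = val s end)).
  move=> y [Ey [ys|ys]]; last by exists (inr 0).
  by exists (inl (SigSub (mem_set (ys : [set z | lt z (val s)] (idx y))))).
by move=> y z [u|u] [Ey _] [Ez _] e e'; apply: inj => //; exact: etrans e (esym e').
Qed.

Let Dm_Q s : (forall v, ltS v s -> Inv v) -> Dm s #<= [set: Q_ s].
Proof.
move=> inv; apply: (absorbing_setU (@Q_absorbing s) (@H_Q s)).
apply: (absorbing_bigcup (@Q_absorbing s) (@seg_Q s)) => v vs.
apply: Mo_card; first exact: Q_absorbing.
- by move=> u [uv|->]; apply: inv => //; exact: trS vs.
- by apply: card_le_trans (@H_Q s); apply: subset_card_le; apply: Hmono; left.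
- by apply: card_le_trans (@seg_Q s); apply: subset_card_le => u uv; exact: trS vs.
Qed.

(** This puts the base of stage [s] within reach of the induction hypothesis. *)
Let Dm_bound s : (forall v, ltS v s -> Inv v) -> exists2 z, lt z x & Dm s #<= [set y | lt y z].
Proof.
move=> inv; apply: contrapT => no; apply: (@Q_big s).
apply: card_le_trans Ex _; apply: card_le_trans (Dm_Q inv).
apply: (initial_segments_card_le wo) => z zx h; apply: no; exists z => //.
by apply: card_le_trans h _; apply: subset_card_le => y [].
Qed.

Let Dm_small s : (forall v, ltS v s -> Inv v) -> small K (Dm s).
Proof.
move=> inv; apply: small_le E_small; apply: card_le_trans (Dm_Q inv) _.
apply: card_le_trans (@card_sub_le _ E); apply: absorbing_sum => //.
- by apply: card_le_trans (card_sub_le _) _; apply: card_le_trans (@seg_E s) _; exact: setT_E.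
- by case: E_absorbing.
Qed.

Let union_elementary (I : set S) : I !=set0 -> (forall v, I v -> Inv v) ->
  elem_sub (\bigcup_(v in I) Mo v).
Proof.
move=> [v0 Iv0] inv; apply: elem_sub_tv => k f v Mv ex.
have [w Iw Mw] : exists2 w, I w & forall i, Mo w (v i).
  clear ex f; elim: k v Mv => [|k IHk] v Mv; first by exists v0 => // -[].
  have [w Iw Mw] := IHk (v \o lift ord0) (fun i => Mv _).
  have [u Iu Mu] := Mv ord0.
  have [wu|uw] : leS w u \/ leS u w.
    by case: (wo_total woS w u) => h; [left; left|left; right|right; left].
    exists u => // i; case: (unliftP ord0 i) => [j|] -> //; exact: (Mo_mono (inv _ Iu) wu) (Mw j).
  exists w => // i; case: (unliftP ord0 i) => [j|] ->; [exact: Mw|exact: (Mo_mono (inv _ Iw) uw)].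
have [[[[_ el] _ _ _] _] _ _] := inv w Iw.
by have [y [My sy]] := elem_sub_witness el Mw ex; exists y; split=> //; exists w.
Qed.

(** A finite tuple from the base lies in [H s] and one earlier model. The invariant isolates its
    part in that model, and the entries from [H s] are constants. *)
Let Dm_atomic s : (forall v, ltS v s -> Inv v) -> atomic_over E (H s) (Dm s).
Proof.
move=> inv p y hy.
have [[i ni]|no] := pselect (exists i, ~ H s (y i)); last first.
  by apply: isolated_constant => i; apply: contrapT => ni; apply: no; exists i.
have [w [ws Mw]] : exists w, ltS w s /\ forall i, H s (y i) \/ Mo w (y i).
  have [w0 w0s _] : exists2 w0, ltS w0 s & True by case: (hy i) => // -[w0 ws _]; exists w0.
  clear i ni; elim: p y hy => [|p IHp] y hy; first by exists w0; split=> // -[].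
  have [w [ws Mw]] := IHp (y \o lift ord0) (fun i => hy _).
  have yP (Z : set C) : (H s (y ord0) \/ Z (y ord0)) -> (forall i, H s (y (lift ord0 i)) \/ Z (y (lift ord0 i))) ->
      forall i, H s (y i) \/ Z (y i).
    by move=> h0 hS i; case: (unliftP ord0 i) => [j|] ->.
  case: (hy ord0) => [h0|[u us Mu]].
    by exists w; split=> //; apply: yP; [left|exact: Mw].
  have [wu|uw] : leS w u \/ leS u w.
    by case: (wo_total woS w u) => h; [left; left|left; right|right; left].
    exists u; split=> //; apply: yP => [|j]; first by right.
    by case: (Mw j) => h; [left|right; exact: (Mo_mono (inv _ us) wu)].
  exists w; split=> //; apply: yP => [|j]; last exact: Mw.
  by right; exact: (Mo_mono (inv _ ws) uw).
have [_ at_ _] := inv w ws.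
have [x0 Mx0] : exists x0, Mo w x0 by case: (Mw i) => [//|h]; exists (y i).
pose xx i := if `[< H s (y i) >] then x0 else y i.
have Mxx j : Mo w (xx j) by rewrite /xx; case: asboolP => // h; case: (Mw j).
apply: (@isolated_mix L C E (H s) p p xx).
- exact: HE.
- by have [e0 [_ Ee0]] := E_ex; exists e0.
- by apply: isolated_over_sub (at_ _ _ Mxx) => //; apply: Hmono; left.
- move=> j; have [h|h] := pselect (H s (y j)); first by left.
  by right; exists j; rewrite /xx asboolF.
Qed.

Let E_parts z : E z -> range c z \/ exists2 t, PP n t & A t z.
Proof. by move=> [[t It Az]|cz]; [right; exists t|left]. Qed.

Let Dm_ex s : exists m0 t0, [/\ PP n t0, A t0 m0 & H s m0].
Proof.
have [m0 [Pm0 Hm0]] := complete_nonempty PC_nonempty (@Hc s).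
have [t0 It0 Am0] := PE (conj Pm0 (HE Hm0)).
by exists m0, t0.
Qed.

Let upgrade s X1 (X : set C) m (y : 'I_m -> C) : atomic_over E (H s) X -> X1 `<=` X -> H s `<=` X1 ->
  isolated_over X1 X1 y -> isolated_over (X1 `|` E) X1 y.
Proof.
move=> at_ X1X HX1; have [m0 [t0 [It0 Am0 Hm0]]] := Dm_ex s.
apply: (@isolated_upgrade L P C n A E (H s) X AE (@Hreq s) at_ m0 m0 t0 (X1X _ (HX1 _ Hm0)) It0 Am0) => //.
by move=> z /E_parts[cz|h]; [left; apply: HX1; exact: cH|right].
Qed.

(** Isolation over the base is upgraded to isolation over the base and [E], and then composed with
    atomicity of the base. *)
Let Inv_of s : (forall v, ltS v s -> Inv v) -> (exists M, bounded_constructible (Dm s) M) -> Inv s.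
Proof.
move=> inv ex; have bM := MoP ex; split=> //.
  have [m0 [t0 [It0 Am0 Hm0]]] := Dm_ex s.
  have at1 := Dm_atomic inv.
  have at2 : atomic_over (Dm s) (Dm s) (Mo s).
    by apply: (@constructible_atomic L P K C); [exists m0; left|case: bM].
  have E1 : E `<=` Dm s `|` E by move=> z; right.
  have H1 : H s `<=` Dm s by move=> z; left.
  apply: (atomic_trans E1 at1) => p y My.
  exact: (upgrade at1 (@subset_refl _ _) H1 (at2 _ _ My)).
move=> z [Pz Mz]; have [[_ h _ _] _] := bM; have [//|[v vs Mv]] := h z (conj Pz Mz).
by have [_ _ hv] := inv v vs; apply: (Hmono (or_introl vs)); exact: hv.
Qed.

(** At the least stage the hull is generated by [c] and at most one element of [E], hence is
    countable. *)
Let bottom s : ~ (exists v, ltS v s) -> exists M, bounded_constructible (Dm s) M.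
Proof.
move=> nv; have DE : Dm s = union n (fun t => A t `&` H s) `|` range c.
  rewrite -HU /Dm; apply/seteqP; split=> y; last by left.
  by case=> // -[v vs _]; case: nv; exists v.
rewrite DE; apply: bounded_countable; first exact: flatH.
- by rewrite -HU; exact: Hc.
- rewrite -HU => y [Py Hy]; have [t It Ay] := PE (conj Py (HE Hy)); by exists t.
- rewrite -HU; have [[lx inj _] [_ _ h]] := cP; apply: (h _ nat absorbing_natT).
  apply: absorbing_setU; [exact: absorbing_natT|apply: countable_range; exact: countableP|].
  apply: (@card_le_inj _ _ _ _ (fun=> 0)) => // y z [Ey ys] [Ez zs] _; apply: inj => //.
  have only u : E u -> lt (idx u) (val s) \/ idx u = val s -> idx u = val s.
    move=> Eu [us|//]; case: nv; exists (SigSub (mem_set (lx u Eu)) : S); exact: us.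
  exact: etrans (only _ Ey ys) (esym (only _ Ez zs)).
Qed.

(** All stages but the least are treated alike, limits included: a union of earlier hulls is closed
    under the same requirements, and a union of earlier models is a model. *)
Let successor s : (forall v, ltS v s -> Inv v) -> (exists v, ltS v s) ->
  exists M, bounded_constructible (Dm s) M.
Proof.
move=> inv [v0 v0s]; pose Hl := \bigcup_(v in [set v | ltS v s]) H v.
have HlH : Hl `<=` H s by move=> y [v vs Hy]; apply: (Hmono (or_introl vs)).
have HlE : Hl `<=` E by move=> y /HlH/HE.
have HlM : Hl `<=` Ml s by move=> y [v vs Hy]; exists v => //; exact: (HMo (inv _ vs)).
have Hlreq q : system_reqs P A E q -> closed_for E Hl q.
  move=> hq; apply: closed_for_bigcup; first by exists v0.
    move=> u v _ _; case: (wo_total woS u v) => h; [left|left; rewrite h|right] => //; by apply: Hmono; left.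
  by move=> v _; exact: Hreq.
have MlE y : E y -> Ml s y -> Hl y by move=> Ey [v vs My]; exists v => //; exact: (Mo_E (inv _ vs)).
have [m0 [t0 [It0 Am0 Hm0]]] := Dm_ex v0.
have ap : amalgam_problem P T K n (fun t => A t `&` Hl) (fun t => A t `&` H s) (Ml s).
  split=> //.
  - exact: (flat_subset FA AE n0 Hlreq).
  - split; last by apply: union_elementary; [exists v0|].
    by apply: small_le (Dm_small inv); apply: subset_card_le => y; right.
  - move=> t It; apply/seteqP; split=> y.
      by move=> [Ay Hy]; split; [split=> //; exact: HlH|exact: HlM].
    by move=> [[Ay Hy] My]; split=> //; apply: MlE => //; exact: (AE It).
  - move=> y [[v vs My] Py]; have [_ _ hv] := inv v vs; have Hvy := hv y (conj Py My).
    have Hly : Hl y by exists v.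
    split=> //; have [t It Ay] := PE (conj Py (HlE _ Hly)).
    have : (A t `&` PC) y by [].
    rewrite (flat_pred FA It); apply: (flat_mono FA).
      case: (nice_proper n0) => -[_ h _] _; exact: h.
    move=> j [tj j0]; rewrite /mkset lt0n; apply/andP; split; first exact/eqP.
    by case: It => h _; exact: h.
  - exact: (system_incl_subsets AE n0 HlH Hlreq (@Hreq s)).
  - move=> m f t b tb sb.
    (* Finitely many coordinates from [Ml s] lie in one earlier model, to which [pull_atomic]
       applies; the solutions lie in [H w], hence in [Hl]. *)
    have [w [ws Mw]] : exists w, ltS w s /\ forall i, t i = None -> Mo w (b i).
      have {}tb i : t i = None -> Ml s (b i) by move=> ti; have := tb i; rewrite ti.
      clear sb f; elim: m t b tb => [|m IHm] t b tb; first by exists v0; split=> // -[].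
      have [w [ws Mw]] := IHm (t \o lift ord0) (b \o lift ord0) (fun i => tb _).
      have bP w' : (t ord0 = None -> Mo w' (b ord0)) -> (forall i, t (lift ord0 i) = None -> Mo w' (b (lift ord0 i))) ->
        forall i, t i = None -> Mo w' (b i).
        by move=> h0 hS i; case: (unliftP ord0 i) => [j|] ->; [exact: hS|exact: h0].
      case t0E : (t ord0) => [u|]; first by exists w; split=> //; apply: bP => //; rewrite t0E.
      have [u us Mu] := tb ord0 t0E.
      have [wu|uw] : leS w u \/ leS u w.
        by case: (wo_total woS w u) => h; [left; left|left; right|right; left].
        exists u; split=> //; apply: bP => // j tj; exact: (Mo_mono (inv _ us) wu) (Mw j tj).
      by exists w; split=> //; apply: bP => // _; exact: (Mo_mono (inv _ ws) uw).
    have [_ at_ _] := inv w ws.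
    have [y0 [_ Hy0]] := complete_nonempty PC_nonempty (@Hc w).
    have [i|b' [h1 h2]] := @pull_atomic L P C n A E (H w) (Mo w) AE (@Hreq w) at_ y0 m0 t0
      (HMo (inv _ ws) Hy0) It0 Am0 m f t b _ sb.
      by have := tb i; case ti : (t i) => [u|]; [move=> [Iu []]|move=> _; exact: Mw].
    exists b'; split=> // i; have := h1 i; case: (t i) => // u [Au Hu]; split=> //.
    by exists w.
have am := amalgam_stable_union PC_nonempty T_k_stable ap.
(* The tuple [c] disappears here: it lies in the hull at [v0], hence in the model face. *)
have DE : union n.+1 (amalgam n (fun t => A t `&` Hl) (fun t => A t `&` H s) (Ml s)) = Dm s.
  rewrite (amalgam_union ap) /Dm [in RHS]HU; apply/seteqP; split=> y.
    by move=> [h|h]; [left; left|right].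
  case=> [[h|cy]|h]; [by left| |by right].
  by right; exists v0 => //; apply: (HMo (inv _ v0s)); exact: cH.
rewrite -DE; apply: IH => //; rewrite DE; [exact: Dm_small|exact: Dm_bound].
Qed.

Let all_inv s : Inv s.
Proof.
elim/(well_founded_induction (wo_wf woS)): s => s inv; apply: Inv_of => //.
have [h|h] := pselect (exists v, ltS v s); [exact: successor|exact: bottom].
Qed.

Lemma step_constructible : exists M, bounded_constructible E M.
Proof.
have [e0 [_ Ee0]] := E_ex; have [s0 _] := EH Ee0.
pose M := \bigcup_(s in [set: S]) Mo s.
have Mcard Q : absorbing Q -> E #<= [set: Q] -> M #<= [set: Q].
  move=> Qa EQ; apply: absorbing_bigcup => // [|s _]; first exact: card_le_trans S_E EQ.
  apply: (Mo_card Qa (fun v _ => @all_inv v)).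
    by apply: card_le_trans EQ; apply: subset_card_le; exact: HE.
  by apply: card_le_trans (card_le_trans S_E EQ); exact: card_leT.
have /choice[sq sqP] : forall s, exists w : {W : Type & ((W -> W -> Prop) * (W -> C))%type},
    [/\ well_ordered (projT2 w).1, Mo s = Dm s `|` range (projT2 w).2 &
      forall i, let X := Dm s `|` (projT2 w).2 @` [set j | (projT2 w).1 j i] in
        isolated_over X X (fun _ : 'I_1 => (projT2 w).2 i)].
  move=> s; have [[[_ _ _ [W [le [d [wole ME iso]]]]] _] _ _] := all_inv s.
  exists (existT _ W ((fun i j => le i j /\ i <> j), d)); split=> //=.
    exact: well_ordered_of.
  by move=> i; apply/locally_isolatedP; exact: iso.
pose W s := projT1 (sq s); pose lW s := (projT2 (sq s)).1 : W s -> W s -> Prop.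
pose d s := (projT2 (sq s)).2 : W s -> C.
have ME s : Mo s = Dm s `|` range (d s) by have [] := sqP s.
pose ltW := @lex_lt S W ltS lW.
have woW : well_ordered ltW by apply: wo_lex => // s; have [] := sqP s.
pose dd (p : {s : S & W s}) := d (projT1 p) (projT2 p).
have Mdd s y : Mo s y -> E y \/ exists2 p, leS (projT1 p) s & dd p = y.
  elim/(well_founded_induction (wo_wf woS)): s y => s IHs y; rewrite ME => -[[/HE|[v vs My]]|[i _ <-]].
  - by left.
  - have [|[p pv py]] := IHs v vs y My; [by left|right]; exists p => //; left.
    by case: pv => [pv|->] //; exact: trS vs.
  - by right; exists (existT W s i) => //; right.
have ddM p : Mo (projT1 p) (dd p) by rewrite ME; right; exists (projT2 p).
exists M; split=> //; split.
- split; last by apply: union_elementary; [exists s0|move=> v _; exact: all_inv].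
  apply: small_le E_small; apply: card_le_trans (Mcard _ E_absorbing setT_E) _.
  exact: card_sub_le.
- by move=> y [Py [s _ My]]; have [_ _ h] := all_inv s; apply: (@HE s); exact: h.
- by move=> y /EH[s Hy]; exists s => //; exact: (HMo (all_inv s)).
exists {s : S & W s}, (fun p q => `[< ltW p q \/ p = q >]), dd; split.
- exact: well_order_of.
- apply/seteqP; split=> y.
    by move=> [s _ /Mdd[Ey|[p _ <-]]]; [left|right; exists p].
  case=> [/EH[s Hy]|[p _ <-]]; first by exists s => //; exact: (HMo (all_inv s)).
  by exists (projT1 p).
move=> [s i]; apply/locally_isolatedP.
have -> : [set q | `[< ltW q (existT W s i) \/ q = existT W s i >] /\ q <> existT W s i] =
    [set q | ltW q (existT W s i)].
  apply/seteqP; split=> q /=; first by move=> [/asboolP[]].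
  move=> qp; split; first by apply/asboolP; left.
  by move=> qE; have [irrW _ _] := woW; apply: (irrW q); rewrite {2}qE.
pose X1 := Dm s `|` d s @` [set j | lW s j i].
have iso : isolated_over X1 X1 (fun _ : 'I_1 => d s i) by have [_ _ h] := sqP s; exact: h.
have [_ at_ _] := all_inv s.
have X1M : X1 `<=` Mo s.
  by rewrite ME => y [|[j _ <-]]; [left|right; exists j].
have HX1 : H s `<=` X1 by move=> y Hy; left; left.
have := upgrade at_ X1M HX1 iso.
(* Up to elements of [E], the base of stage [s] consists of what earlier stages have enumerated. *)
have -> : X1 `|` E = E `|` dd @` [set q | ltW q (existT W s i)].
  apply/seteqP; split=> y.
    case=> [[[/HE|[v vs /Mdd[|[p pv py]]]]|[j ji <-]]|]; try by left.
      by right; exists p => //; left => /=; case: pv => [pv|->] //; exact: trS vs.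
    by right; exists (existT W s j) => //; right; exists j.
  case=> [|[q qi <-]]; first by right.
  left; case: qi => [/= qs|/= [j -> ji]]; last by right; exists j.
  by left; right; exists (projT1 q) => //; exact: ddM.
move=> iso'; apply: isolated_over_sub iso' => // y.
case=> [[Hy|[v vs /Mdd[|[p pv py]]]]|[j ji <-]]; try by left; exact: HE Hy.
- by left.
- by right; exists p => //; left => /=; case: pv => [pv|->] //; exact: trS vs.
- by right; exists (existT W s j) => //; right; exists j.
Qed.

End Step.

(** Induction on a bound [x] for the size of [E]; when no smaller bound works and [E] is
    uncountable, the chain construction applies. *)
Lemma constructible_exists x n A mc (c : 'I_mc -> C) : flat n (PP n) A ->
  let E := union n A `|` range c in
  complete_set P E -> PC `&` E `<=` union n A -> small K E -> E #<= [set z | lt z x] ->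
  exists M, bounded_constructible E M.
Proof.
elim/(well_founded_induction (wo_wf wo)): x n A mc c => x IH n A mc c FA E Ec PE Es Ex.
have [cE|ncE] := pselect (countable E); first exact: bounded_countable FA Ec PE cE.
have [[z zx Ez]|no] := pselect (exists2 z, lt z x & E #<= [set y | lt y z]).
  exact: IH zx _ _ _ _ FA Ec PE Es Ez.
apply: (step_constructible FA Ec PE Es ncE Ex); first by move=> z zx Ez; apply: no; exists z.
move=> A' FA' A's [z zx Az].
pose c0 (i : 'I_0) : C := match notF (ltn_ord i) with end.
have E0 : union n.+1 A' `|` range c0 = union n.+1 A'.
  by apply/seteqP; split=> y; [case=> // -[[]]|left].
have := IH z zx n.+1 A' 0 c0 FA'; rewrite E0; apply=> //.
by have [] := flat_stable_union T_k_stable FA'.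
Qed.

End Main.

(** * From types in [S_star] to the theorem *)

(** Membership in [S_star] provides some realization [c'], possibly other than [c]. That a given
    tuple of [P] and [B] solves an instance is a formula over [B], so the solutions found for [c']
    also serve [c]. *)
Lemma S_star_complete L (P : symb L) (C : structure L) (B : set C) m (c c' : 'I_m -> C) :
  tp c B = tp c' B -> complete_set P (B `|` range c') ->
  predicate P C `&` (B `|` range c') = predicate P C `&` B ->
  complete_set P (B `|` range c) /\ predicate P C `&` (B `|` range c) `<=` B.
Proof.
move=> tpE c'c c'P; pose PC := predicate P C.
have same (X : ('I_m -> C) -> Prop) : dov B X -> (X c <-> X c').
  move=> /dovP[k [f [b [Bb fE]]]].
  have tpP d : tp d B (PFormula f b) <-> X d.
    rewrite fE; split=> [[]//|h]; split=> // z [i _ <-]; exact: Bb.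
  by rewrite -!tpP tpE.
have wit p k (f : formula L (p + k)) (b : 'I_k -> C) : (forall i, (B `|` range c) (b i)) ->
    (exists y : 'I_p -> C, (forall i, PC (y i)) /\ sat f (vcat y b)) ->
    exists y : 'I_p -> C, (forall i, (PC `&` B) (y i)) /\ sat f (vcat y b).
  move=> Bb ex.
  have /choice[z zP] : forall j, exists z : 'I_m + B, b j = match z with inl i => c i | inr x => val x end.
    move=> j; case: (Bb j) => [h|[i _ <-]]; last by exists (inl i).
    by exists (inr (SigSub (mem_set h))).
  pose bb (u : 'I_m -> C) := sumv u (fun x : B => val x) \o z.
  have bE : b = bb c by apply: funext => j; rewrite zP /bb /=; case: (z j).
  pose X1 u := exists y : 'I_p -> C, (forall i, PC (y i)) /\ sat f (vcat y (bb u)).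
  have dX1 : dov B X1.
    exists (fun v => exists y : 'I_p -> C, (forall i, PC (y i)) /\ sat f (vcat y (v \o z))) => //.
    apply: (@dfn_ex _ _ ('I_m + B) p (fun w => (forall i, PC (w (inl i))) /\ sat f (vcat (w \o inl) (w \o inr \o z)))).
    apply: dfn_and; first by apply: dfn_forall_fin => i; exact: dfn_predicate.
    by exists (p + k), f, (vcat inl (inr \o z)) => w; rewrite vcat_comp.
  have X1c : X1 c by move: ex; rewrite bE.
  have bbc' j : (B `|` range c') (bb c' j).
    by rewrite /bb /=; case: (z j) => [i|w]; [right; exists i|left; exact: set_valP].
  have [y [Py sy]] := c'c p k f (bb c') bbc' (proj1 (same X1 dX1) X1c).
  have {}Py i : (PC `&` B) (y i) by rewrite -c'P; exact: Py.
  exists y; split=> //; rewrite bE.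
  apply/(same (fun u => sat f (vcat y (bb u)))) => //.
  apply: (@dov_par _ _ B 'I_m 'I_p (fun w => sat f (vcat (w \o inr) (bb (w \o inl))))).
    by move=> i; case: (Py i).
  pose r (i : 'I_k) : ('I_m + 'I_p) + B := match z i with inl j => inl (inl j) | inr w => inr w end.
  apply: dov_ext (@dov_sat L C B ('I_m + 'I_p) (p + k) f (vcat (inl \o inr) r)) => w.
  rewrite vcat_comp; suff -> : sumv w (fun x : B => val x) \o r = bb (w \o inl) by [].
  by apply: funext => i; rewrite /bb /r /=; case: (z i).
split.
  move=> p k f b Bb ex; have [y [Py sy]] := wit p k f b Bb ex.
  by exists y; split=> // i; have [? ?] := Py i; split=> //; left.
move=> z [Pz Bz]; have [||y [Py sy]] := wit 1 1 (fEq L (lshift 1 ord0) (rshift 1 ord0)) (fun=> z).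
- by [].
- by exists (fun=> z); split=> //=; rewrite vcatl vcatr.
- by move: sy => /=; rewrite vcatl vcatr => <-; case: (Py ord0).
Qed.

Theorem theorem7p2 (L : vocabulary) (P : symb L) (T : set (sentence L))
    (K : Type) (C : structure L)
    (P_unary : arity P = 1)
    (T_complete : complete_theory T)
    (T_P_infinite : forall M : structure L, is_model M T ->
       infinite_set (predicate P M))
    (T_morleyized : morleyized T)
    (C_monster : monster T K C)
    (P_stably_embedded : stably_embedded P C)
    (P_no_new_structure : no_new_structure P C)
    (models_stable : forall M : set C, model K M -> stable P T K M)
    (T_countable : countable T)
    (T_k_stable : forall k : nat, k_stable P T K C k)
    (n : nat) (A : set nat -> set C)
    (A_good : good_system P T K n (proper_powset `I_n) A) :
  let B := \bigcup_(s in proper_powset `I_n) A s in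
  (exists M : set C, locally_constructible P K M B) /\
  (forall (m : nat) (c : 'I_m -> C),
     S_star P B (existT _ m (tp c B)) ->
     exists M : set C, locally_constructible P K M (B `|` range c)).
Proof.
move=> B; have [CT Ts SL Csat _] := C_monster.
have PC0 : exists x, predicate P C x.
  by have [x Px] := infinite_setN0 (T_P_infinite C CT); exists x.
have FA := good_flat A_good; have [lt wo] := well_ordering K.
have main m (c : 'I_m -> C) : complete_set P (B `|` range c) ->
    predicate P C `&` (B `|` range c) `<=` B ->
    exists M, locally_constructible P K M (B `|` range c).
  move=> Ec PE.
  have Es : small K (B `|` range c).
    apply: (small_system T_complete Ts); first by apply: countable_range; exact: countableP.
    by move=> s Is; exact: (flat_small FA).
  have [x Ex] : exists x, B `|` range c #<= [set z | lt z x].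
    apply: contrapT => no; case/andP: Es => _ /negP; apply.
    apply: (initial_segments_card_le wo) => x _ h; apply: no; exists x.
    by apply: card_le_trans h _; apply: subset_card_le => z [].
  have [M [LM _]] := constructible_exists T_complete T_countable SL Ts Csat PC0 T_k_stable wo FA Ec PE Es Ex.
  by exists M.
split.
  (* The first claim is the case of the empty tuple; completeness of [B] is part of its
     stability. *)
  pose c0 (i : 'I_0) : C := match notF (ltn_ord i) with end.
  have E0 : B `|` range c0 = B by apply/seteqP; split=> y; [case=> // -[[]]|left].
  rewrite -E0; apply: main; rewrite E0; last by move=> y [].
  by have [] := flat_stable_union T_k_stable FA.
move=> m c [m' [c' [c'P c'c e]]].
have mm : m = m' := congr1 (@projT1 _ _) e; subst m'.
have [Ec PE] := S_star_complete (existT_inj e) c'c c'P.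
exact: main.
Qed.
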